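(* Let $\Sigma$ be a real analytic surface without boundary contained in the support of a $3$-uniform measure on $(\mathbb{H},d_H)$. Then the equation $$\mathcal{H}_0^2+\tfrac32\mathcal{P}_0^2+4\,\vec e_1(\mathcal{P}_0)=0$$ holds at all noncharacteristic points of $\Sigma$.
   Context: The first Heisenberg group $\mathbb{H}$ is $\mathbb{R}^3$ with the group law $(x_1,x_2,x_3)*(y_1,y_2,y_3)=(x_1+y_1,\,x_2+y_2,\,x_3+y_3-2x_1y_2+2x_2y_1)$. It is equipped with the Korányi metric $d_H(x,y)=\|x^{-1}*y\|_H$, where $\|(x_1,x_2,x_3)\|_H^4=(x_1^2+x_2^2)^2+x_3^2$. $B_H(x,r)$ is the closed $d_H$-ball with center $x$ and radius $r$. A nonzero Borel measure $\mu$ on $\mathbb{H}$ is $3$-uniform if there is a constant $c>0$ such that $\mu(B_H(x,r))=cr^3$ for all $x\in\operatorname{spt}\mu$ and all $r>0$. Left-invariant vector fields: $X_1=\partial_1+2x_2\partial_3$, $X_2=\partial_2-2x_1\partial_3$, $X_3=\partial_3$. The horizontal space is $H_x\mathbb{H}=\operatorname{span}\{X_1(x),X_2(x)\}$. A surface is an embedded two-dimensional submanifold of $\mathbb{R}^3$. A point $x\in\Sigma$ is noncharacteristic if $T_x\Sigma\neq H_x\mathbb{H}$. Write $\Sigma$ near a noncharacteristic point as a level set $\{u=0\}$ of a smooth function $u$ with nonvanishing gradient, and put $|\nabla_0u|=\sqrt{(X_1u)^2+(X_2u)^2}$. Define on $\Sigma$: - characteristic vector field $\vec e_1=|\nabla_0u|^{-1}\big((X_1u)X_2-(X_2u)X_1\big)$;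 - horizontal mean curvature $\mathcal{H}_0=X_1\big(X_1u/|\nabla_0u|\big)+X_2\big(X_2u/|\nabla_0u|\big)$; - imaginary curvature $\mathcal{P}_0=4X_3u/|\nabla_0u|$. The vector field $\vec e_1$ is tangent to $\Sigma$, and $\vec e_1(\mathcal P_0)$ denotes the derivative of $\mathcal{P}_0$ along it. The quantities $\mathcal{H}_0^2$, $\mathcal{P}_0^2$, $\vec e_1(\mathcal{P}_0)$ do not depend on the choice of $u$. *)

(* Defs.v *)
From mathcomp Require Import all_boot all_order all_algebra.
From mathcomp Require Import all_classical all_reals all_analysis.

Set Implicit Arguments.
Unset Strict Implicit.
Unset Printing Implicit Defensive.

Import Order.TTheory GRing.Theory Num.Theory.
Import numFieldTopology.Exports numFieldNormedType.Exports.

Local Open Scope classical_set_scope.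
Local Open Scope ring_scope.

Definition row3 (R : realType) (a b c : R) : 'rV[R]_3 :=
  \row_(i < 3) [:: a; b; c]`_i.

(* The coordinates x_1, x_2, x_3 of the text are x 0 0, x 0 1, x 0 2. *)

Definition hmul (R : realType) (x y : 'rV[R]_3) : 'rV[R]_3 :=
  row3 (x 0 0 + y 0 0) (x 0 1 + y 0 1)
       (x 0 2 + y 0 2 - 2 * x 0 0 * y 0 1 + 2 * x 0 1 * y 0 0).

Definition hinv (R : realType) (x : 'rV[R]_3) : 'rV[R]_3 := - x.

Lemma hmulVx (R : realType) (x : 'rV[R]_3) : hmul (hinv x) x = 0.
Proof.
apply/rowP => -[[|[|[|//]]] Hi]; rewrite /hmul /hinv !mxE /= ?addNr //.
by rewrite sub0r !(mulrN, mulNr) opprK mulrAC subrr.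
Qed.

Lemma hmulxV (R : realType) (x : 'rV[R]_3) : hmul x (hinv x) = 0.
Proof.
apply/rowP => -[[|[|[|//]]] Hi]; rewrite /hmul /hinv !mxE /= ?subrr //.
by rewrite sub0r !(mulrN, mulNr) opprK mulrAC subrr.
Qed.

Definition hnorm (R : realType) (x : 'rV[R]_3) : R :=
  Num.sqrt (Num.sqrt ((x 0 0 ^+ 2 + x 0 1 ^+ 2) ^+ 2 + x 0 2 ^+ 2)).

Lemma hnorm4E (R : realType) (x : 'rV[R]_3) :
  hnorm x ^+ 4 = (x 0 0 ^+ 2 + x 0 1 ^+ 2) ^+ 2 + x 0 2 ^+ 2.
Proof.
by rewrite /hnorm (exprM _ 2 2) !sqr_sqrtr ?sqrtr_ge0 ?addr_ge0 ?sqr_ge0.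
Qed.

Definition hdist (R : realType) (x y : 'rV[R]_3) : R := hnorm (hmul (hinv x) y).

Definition hball (R : realType) (x : 'rV[R]_3) (r : R) : set 'rV[R]_3 :=
  [set y | hdist x y <= r].

(* The Koranyi metric induces the Euclidean topology, so the Borel sets of
   (H, d_H) are those of R^3. *)
Definition borel_heis (R : realType) := g_sigma_algebraType (@open 'rV[R]_3).

Definition spt (R : realType) (mu : {measure set (borel_heis R) -> \bar R}) :
    set 'rV[R]_3 :=
  [set x | forall r : R, 0 < r -> (0 < mu (hball x r))%E].

Definition three_uniform (R : realType)
    (mu : {measure set (borel_heis R) -> \bar R}) : Prop :=
  mu setT != 0%E /\
  exists2 c : R, 0 < c &
    forall (x : 'rV[R]_3) (r : R),
      spt mu x -> 0 < r -> mu (hball x r) = (c * r ^+ 3)%:E.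

Definition basis_vec (R : realType) (i : 'I_3) : 'rV[R]_3 := delta_mx 0 i.

Definition gradient (R : realType) (u : 'rV[R]_3 -> R) (x : 'rV[R]_3) :
    'rV[R]_3 :=
  \row_(i < 3) 'D_(basis_vec R i) u x.

Fixpoint Ck_on (R : realType) (k : nat) (U : set 'rV[R]_3)
    (f : 'rV[R]_3 -> R) : Prop :=
  match k with
  | 0 => forall x, U x -> {for x, continuous f}
  | k'.+1 => (forall x, U x -> differentiable f x) /\
             (forall i : 'I_3, Ck_on k' U ('D_(basis_vec R i) f))
  end.

Definition smooth_on (R : realType) (U : set 'rV[R]_3) (f : 'rV[R]_3 -> R) :=
  forall k, Ck_on k U f.

Definition monomial_term (R : realType) (a : nat -> nat -> nat -> R)
    (h : 'rV[R]_3) (m : nat * nat * nat) : R :=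
  a m.1.1 m.1.2 m.2 * h 0 0 ^+ m.1.1 * h 0 1 ^+ m.1.2 * h 0 2 ^+ m.2.

(* Near p, f is the sum of an absolutely convergent power series in y - p.
   The order of summation being then irrelevant, the sum is taken over cubes. *)
Definition analytic_at (R : realType) (f : 'rV[R]_3 -> R) (p : 'rV[R]_3) :=
  exists a : nat -> nat -> nat -> R,
    \forall y \near p,
      summable setT (fun m => (monomial_term a (y - p) m)%:E) /\
      (fun n : nat => \sum_(i < n) \sum_(j < n) \sum_(k < n)
         monomial_term a (y - p) (nat_of_ord i, nat_of_ord j, nat_of_ord k))
        @ \oo --> f y.

Definition analytic_on (R : realType) (U : set 'rV[R]_3)
    (f : 'rV[R]_3 -> R) :=
  forall x, U x -> analytic_at f x.

(* On the open set U, S is the zero level set of u, whose gradient does not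
   vanish; the values of u outside U play no role. *)
Definition level_set_on (R : realType) (S U : set 'rV[R]_3)
    (u : 'rV[R]_3 -> R) : Prop :=
  [/\ open U,
      forall x, U x -> gradient u x <> 0 &
      S `&` U = [set x | u x = 0] `&` U].

(* Embedded two-dimensional real analytic submanifold of R^3 (without
   boundary, not necessarily closed in R^3), by local defining functions. *)
Definition analytic_surface (R : realType) (S : set 'rV[R]_3) : Prop :=
  forall p, S p -> exists U : set 'rV[R]_3, exists u : 'rV[R]_3 -> R,
    [/\ U p, analytic_on U u & level_set_on S U u].

(* Velocities at time 0 of the curves in S through x. *)
Definition tangent_space (R : realType) (S : set 'rV[R]_3) (x : 'rV[R]_3) :
    set 'rV[R]_3 :=
  [set v | exists gamma : R -> 'rV[R]_3,
     [/\ gamma 0 = x,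
         \forall t \near (0 : R), S (gamma t) &
         is_derive (0 : R) (1 : R) gamma v]].

Definition X1 (R : realType) (x : 'rV[R]_3) : 'rV[R]_3 := row3 1 0 (2 * x 0 1).
Definition X2 (R : realType) (x : 'rV[R]_3) : 'rV[R]_3 := row3 0 1 (- (2 * x 0 0)).
Definition X3 (R : realType) (x : 'rV[R]_3) : 'rV[R]_3 := row3 0 0 1.

Definition vf_derive (R : realType) (X : 'rV[R]_3 -> 'rV[R]_3)
    (f : 'rV[R]_3 -> R) (x : 'rV[R]_3) : R :=
  'D_(X x) f x.

Definition horizontal_space (R : realType) (x : 'rV[R]_3) : set 'rV[R]_3 :=
  [set v | exists a b : R, v = a *: X1 x + b *: X2 x].

Definition noncharacteristic (R : realType) (S : set 'rV[R]_3)
    (x : 'rV[R]_3) : Prop :=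
  tangent_space S x <> horizontal_space x.

Definition hgrad_norm (R : realType) (u : 'rV[R]_3 -> R) (x : 'rV[R]_3) : R :=
  Num.sqrt (vf_derive (@X1 R) u x ^+ 2 + vf_derive (@X2 R) u x ^+ 2).

Definition char_field (R : realType) (u : 'rV[R]_3 -> R) (x : 'rV[R]_3) :
    'rV[R]_3 :=
  (hgrad_norm u x)^-1 *:
    (vf_derive (@X1 R) u x *: X2 x - vf_derive (@X2 R) u x *: X1 x).

Definition hor_mean_curv (R : realType) (u : 'rV[R]_3 -> R) (x : 'rV[R]_3) : R :=
  vf_derive (@X1 R) (fun y => vf_derive (@X1 R) u y / hgrad_norm u y) x +
  vf_derive (@X2 R) (fun y => vf_derive (@X2 R) u y / hgrad_norm u y) x.

Definition imag_curv (R : realType) (u : 'rV[R]_3 -> R) (x : 'rV[R]_3) : R :=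
  4 * vf_derive (@X3 R) u x / hgrad_norm u x.

(* Main.v *)
(* In coordinates (phi, eta, tau) obtained by left translating to x and rotating
   the horizontal frame so that (e_1, normal) becomes (d_eta, d_phi), the fourth
   power of the distance is the polynomial [korK], and Sigma is a graph
   phi = a eta^2 + b tau + c eta tau + d eta^3 + O(eta^4 + tau^2) at x, with
   horizontal slope A. Let psi be the kernel [bump] and w = sqrt(1 + A^2).
   Uniformity makes the integral of psi(d(y, .)^4 / r^4) against mu equal to
   C r^3 for all y in spt mu, while its integral over the graph against
   d eta d tau is (c0 / w(y) + O(r)) r^3. Integrating the product of two such
   kernels over both measures (Tonelli, then r -> 0) identifies mu on Sigma with
   a constant multiple of w d eta d tau and, comparing with the total mass,
   shows that spt mu has no point off Sigma near x. Hence the integral of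
   psi(d(x, .)^4 / r^4) w d eta d tau is exactly c0 r^3. The r^5 coefficient of
   its expansion is, up to a divergence, a positive multiple of
   a^2/2 + 3 b^2 - 2 c, and H_0^2 + 3/2 P_0^2 + 4 e_1(P_0) is 8 times that. *)

From HB Require Import structures.
Require Import Defs.
From mathcomp Require Import all_boot all_order all_algebra.
From mathcomp Require Import all_classical all_reals all_analysis.
From mathcomp Require Import measurable_realfun ring lra.

Set Implicit Arguments.
Unset Strict Implicit.
Unset Printing Implicit Defensive.

Import Order.TTheory GRing.Theory Num.Theory.
Import numFieldTopology.Exports numFieldNormedType.Exports.

Local Open Scope classical_set_scope.
Local Open Scope ring_scope.

(** * The kernel and the distance polynomial *)

Section bump.
Context {R : realType}.
Implicit Types s t e : R.

(** The hypothesis only places [Sigma] inside the support: a priori the measure may have any density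
    on [Sigma] and may carry further mass arbitrarily close to it. Kernels rather than balls exclude
    both, because a Lipschitz kernel is almost constant at a smaller scale, so that Tonelli and
    dominated convergence take the place of a differentiation theorem for measures. The power 3 in
    [bump] gives a Lipschitz second derivative, just what an expansion to relative order r^2 with
    error r^3 requires, while its superlevel sets are balls, so that uniformity passes to it. The
    function phi is never differentiated: [graph_data] records Taylor estimates in which eta has
    weight 1 and tau weight 2, and A stands for the derivative of phi along the horizontal field
    d_eta - 4 phi d_tau. Remainders are written as explicit functions of centre, radius and rescaled
    point, bounded on an index set, so that every O(.) is a constant uniform in all of these. *)

Definition ppart t : R := Num.max 0 t.
Definition bump t : R := ppart (1 - t) ^+ 3.

Lemma ppart_ge0 t : 0 <= ppart t.
Proof. by rewrite /ppart le_max lexx. Qed.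

Lemma bump_ge0 t : 0 <= bump t.
Proof. by rewrite /bump exprn_ge0// ppart_ge0. Qed.

Lemma bump_le1 t : 0 <= t -> bump t <= 1.
Proof.
move=> t0; rewrite /bump exprn_ile1 ?ppart_ge0//.
by rewrite /ppart ge_max ler01 gerBl.
Qed.

Lemma bump_eq0 t : 1 <= t -> bump t = 0.
Proof.
by move=> t1; rewrite /bump /ppart max_l ?subr_le0// expr0n.
Qed.

Lemma bump_neq0 t : bump t != 0 -> t <= 1.
Proof. by move=> bt; rewrite leNgt; apply/negP => /ltW /bump_eq0 /eqP; apply/negP. Qed.

Lemma bump_half t : t <= 2^-1 -> 8^-1 <= bump t.
Proof.
move=> t1; rewrite /bump (_ : 8^-1 = 2^-1 ^+ 3); last by rewrite !exprS expr0; field.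
apply: lerXn2r; rewrite ?nnegrE ?ppart_ge0 ?invr_ge0//.
rewrite /ppart le_max; apply/orP; right; lra.
Qed.

Lemma ppart_cases t : (0 <= t /\ ppart t = t) \/ (t < 0 /\ ppart t = 0).
Proof.
rewrite /ppart; case: (lerP 0 t) => h; [left|right]; split=> //.
Qed.

Lemma bump_lip s t : 0 <= s -> 0 <= t -> `|bump s - bump t| <= 3 * `|s - t|.
Proof.
move=> s0 t0; rewrite /bump.
have [[a ->]|[a ->]] := ppart_cases (1 - s);
have [[b ->]|[b ->]] := ppart_cases (1 - t).
- rewrite (_ : _ - _ = (t - s) * ((1-s)^+2 + (1-s)*(1-t) + (1-t)^+2)); last by ring.
  rewrite normrM distrC mulrC ler_wpM2r// ger0_norm; last by nra.
  nra.
- rewrite expr0n subr0 ger0_norm ?exprn_ge0//.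
  rewrite ler0_norm; last lra.
  rewrite opprB; have : (1-s)^+3 <= 1-s.
    by rewrite exprS ler_piMr// exprn_ile1//; lra.
  lra.
- rewrite expr0n sub0r normrN ger0_norm ?exprn_ge0//.
  rewrite ger0_norm; last lra.
  have : (1-t)^+3 <= 1-t.
    by rewrite exprS ler_piMr// exprn_ile1//; lra.
  lra.
- by rewrite subrr normr0 mulr_ge0.
Qed.

(** The second derivative [6 * ppart (1 - t)] is Lipschitz with constant 6, so the cubic remainder
    has constant 1, even across the kink at 1. *)
Lemma bump_taylor t e :
  `|bump (t + e) - (bump t - 3 * e * ppart (1 - t) ^+ 2 + 3 * e ^+ 2 * ppart (1 - t))|
  <= `|e| ^+ 3.
Proof.
rewrite /bump -normrX.
have [[a ->]|[a ->]] := ppart_cases (1 - t);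
have [[b ->]|[b ->]] := ppart_cases (1 - (t + e)).
- rewrite (_ : _ - _ = - e ^+ 3) ?normrN//; ring.
- set x := 1 - t in a *; have ex : x < e by rewrite /x; lra.
  rewrite (_ : 0 ^+ 3 - _ = (e - x) ^+ 3 - e ^+ 3); last by ring.
  rewrite ler0_norm; last by rewrite subr_le0 lerXn2r ?nnegrE//; lra.
  rewrite ger0_norm ?exprn_ge0//; last lra.
  have : 0 <= (e-x)^+3 by rewrite exprn_ge0; lra.
  lra.
- rewrite (_ : _ - _ = (1 - (t+e))^+3); last by ring.
  rewrite ger0_norm ?exprn_ge0// ler0_norm; last first.
    rewrite (_ : e^+3 = e * e^+2); last by ring.
    by rewrite mulr_le0_ge0 ?sqr_ge0//; lra.
  rewrite -(_ : (-e)^+3 = - e^+3); last by ring.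
  by rewrite lerXn2r ?nnegrE//; lra.
- by rewrite !expr0n/= !mulr0 !subr0 addr0 subrr normr0.
Qed.

End bump.

Section korK.
Context {R : realType}.
Implicit Types x y z : R * R * R.

(** A point is [((phi, eta), tau)]. A displacement in phi alone has [korK] equal to its fourth
    power: phi-lines are horizontal, and graphs over (eta, tau) are intrinsic graphs. A curve is
    horizontal when d tau = - 4 phi d eta. *)
Definition korK x y : R :=
  ((y.1.1 - x.1.1) ^+ 2 + (y.1.2 - x.1.2) ^+ 2) ^+ 2 +
  (y.2 - x.2 + 2 * (y.1.2 - x.1.2) * (y.1.1 + x.1.1)) ^+ 2.

Lemma korK_sym x y : korK x y = korK y x.
Proof. rewrite /korK; ring. Qed.

Lemma korK_ge0 x y : 0 <= korK x y.
Proof. by rewrite addr_ge0// sqr_ge0. Qed.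

(** The cross term [b * c - d * a] is the area by which the group law twists the vertical
    coordinate; Cauchy-Schwarz bounds its square by [p * q]. The constant 16 rounds up 8 + 6, the
    shares of the horizontal part and of the twist. *)
Lemma korK_triangle x y z : korK x z <= 16 * (korK x y + korK y z).
Proof.
rewrite /korK.
set a := y.1.1 - x.1.1; set b := y.1.2 - x.1.2.
set c := z.1.1 - y.1.1; set d := z.1.2 - y.1.2.
set T := y.2 - _ + _; set S := z.2 - y.2 + _.
have -> : z.1.1 - x.1.1 = a + c by rewrite /a /c; ring.
have -> : z.1.2 - x.1.2 = b + d by rewrite /b /d; ring.
have -> : z.2 - x.2 + 2 * (b + d) * (z.1.1 + x.1.1) = T + S + 2 * (b * c - d * a).
  by rewrite /T /S /a /b /c /d; ring.
have h1 : (a + c) ^+ 2 + (b + d) ^+ 2 <= 2 * ((a^+2+b^+2) + (c^+2+d^+2)).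
  rewrite -subr_ge0 (_ : _ - _ = (a-c)^+2+(b-d)^+2); last by ring.
  by rewrite addr_ge0// sqr_ge0.
set p := a^+2+b^+2; set q := c^+2+d^+2.
have p0 : 0 <= p by rewrite addr_ge0// sqr_ge0.
have q0 : 0 <= q by rewrite addr_ge0// sqr_ge0.
have h2 : ((a + c) ^+ 2 + (b + d) ^+ 2)^+2 <= 8 * (p^+2+q^+2).
  apply: (@le_trans _ _ ((2 * (p+q))^+2)).
    apply: lerXn2r => //; rewrite nnegrE; last lra.
    by rewrite addr_ge0// sqr_ge0.
  rewrite -subr_ge0 (_ : _ - _ = 4 * (p - q)^+2); last by ring.
  by rewrite mulr_ge0// sqr_ge0.
have h3 : (b * c - d * a) ^+ 2 <= (p^+2+q^+2)/2.
  apply: (@le_trans _ _ (p * q)).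
    rewrite -subr_ge0 (_ : _ - _ = (a * c + b * d)^+2); last by rewrite /p/q; ring.
    exact: sqr_ge0.
  rewrite -subr_ge0 (_ : _ - _ = (p - q)^+2/2); last by field.
  by rewrite divr_ge0// sqr_ge0.
set w := b * c - d * a in h3 *.
have h4 : (T + S + 2 * w) ^+ 2 <= 3 * (T^+2+S^+2+4 * w^+2).
  rewrite -subr_ge0 (_ : _ - _ = (T - S)^+2 + (T - 2 * w)^+2 + (S - 2 * w)^+2); last by ring.
  by rewrite !addr_ge0// sqr_ge0.
have := sqr_ge0 T; have := sqr_ge0 S; have := sqr_ge0 p; have := sqr_ge0 q.
lra.
Qed.

(** The vertical displacement is measured from the horizontal direction at [x]. Replacing
    [y.1.1 + x.1.1] by [2 * x.1.1] costs at most 2 r^2, whence the 3. *)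
Lemma korK_bounds x y r : 0 <= r -> korK x y <= r ^+ 4 ->
  [/\ `|y.1.1 - x.1.1| <= r, `|y.1.2 - x.1.2| <= r &
      `|y.2 - x.2 + 4 * (y.1.2 - x.1.2) * x.1.1| <= 3 * r ^+ 2].
Proof.
move=> r0; rewrite /korK; set a := y.1.1 - x.1.1; set b := y.1.2 - x.1.2.
set T := y.2 - _ + _ => h.
have h1 : a^+2+b^+2 <= r^+2.
  rewrite -(@ler_pXn2r _ 2%N)// ?nnegrE ?addr_ge0 ?sqr_ge0//.
  rewrite -exprM; have := sqr_ge0 T; lra.
have h2 : `|T| <= r^+2.
  rewrite -(@ler_pXn2r _ 2%N)// ?nnegrE ?sqr_ge0// real_normK ?num_real// -exprM.
  by have := sqr_ge0 (a^+2+b^+2); lra.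
have ha : `|a| <= r.
  rewrite -(@ler_pXn2r _ 2%N)// ?nnegrE// real_normK ?num_real//.
  by have := sqr_ge0 b; lra.
have hb : `|b| <= r.
  rewrite -(@ler_pXn2r _ 2%N)// ?nnegrE// real_normK ?num_real//.
  by have := sqr_ge0 a; lra.
split=> //.
have -> : y.2 - x.2 + 4 * b * x.1.1 = T - 2 * (b * a) by rewrite /T /a /b; ring.
apply: (le_trans (ler_normB _ _)); rewrite !normrM ger0_norm//.
have : `|b| * `|a| <= r * r by rewrite ler_pM.
rewrite -expr2; lra.
Qed.

End korK.

(** * Image measures and change of variables *)

Section pushm.
Context d1 d2 (T1 : measurableType d1) (T2 : measurableType d2) (R : realType).
Variables (m : {measure set T1 -> \bar R}) (f : T1 -> T2).
Hypothesis mf : measurable_fun [set: T1] f.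

Definition image_measure : {measure set T2 -> \bar R}.
Proof. by refine (pushforward m f : {measure set T2 -> \bar R}). Defined.

Lemma image_measureE A : image_measure A = m (f @^-1` A).
Proof. by []. Qed.

Lemma ge0_integral_image_measure (g : T2 -> \bar R) :
  measurable_fun setT g -> (forall y, 0 <= g y)%E ->
  (\int[image_measure]_y g y = \int[m]_x g (f x))%E.
Proof. by move=> mg g0; exact: ge0_integral_pushforward. Qed.

End pushm.

Section leb2.
Context {R : realType}.
Local Notation leb := (@lebesgue_measure R).

Lemma preimage_affine_ocitv (a b x y : R) : 0 < b ->
  (fun t => a + b * t) @^-1` `]x, y]%classic = `](x - a) / b, (y - a) / b]%classic.
Proof.
move=> b0; apply/seteqP; split => t /=; rewrite !in_itv/=;
  rewrite ltr_pdivrMr// ler_pdivlMr//; lra.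
Qed.

Local Open Scope ereal_scope.

Lemma measurable_affine (a b : R) :
  measurable_fun [set: R] (fun t => a + b * t : R)%R.
Proof. by apply: measurable_funD => //; exact: measurable_funM. Qed.

(** Lebesgue measure is determined by its values on half-open intervals, where it agrees with [b]
    times its image under the affine map. *)
Lemma ge0_integral_affine (a b : R) (f : R -> \bar R) : (0 < b)%R ->
  measurable_fun setT f -> (forall x, 0 <= f x) ->
  \int[leb]_x f x = b%:E * \int[leb]_x f (a + b * x)%R.
Proof.
move=> b0 mf f0.
have mh : measurable_fun [set: measurableTypeR R]
    ((fun t => a + b * t)%R : measurableTypeR R -> measurableTypeR R).
  exact: measurable_affine.
pose B : {nonneg R} := NngNum (ltW b0).
have key (A : set (measurableTypeR R)) : measurable A -> leb A = mscale B (image_measure leb mh) A.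
  move=> mA; apply: (@lebesgue_measure_unique _ (mscale B (image_measure leb mh))) => //.
  move=> _ [[x y]] _ <-.
  change (leb `](x, y).1, (x, y).2] =
    b%:E * leb ((fun t => a + b * t)%R @^-1` `](x, y).1, (x, y).2])).
  rewrite preimage_affine_ocitv// !lebesgue_measure_itv/=.
  rewrite !lte_fin ltr_pM2r ?invr_gt0// ltrD2r.
  case: ifPn => _; last by rewrite mule0.
  rewrite -!EFinB -EFinM; congr EFin; field; lra.
transitivity (\int[mscale B (image_measure leb mh)]_x f x).
  by apply: eq_measure_integral => /= A mA _; exact: key.
by rewrite ge0_integral_mscale// ge0_integral_image_measure.
Qed.

End leb2.
Section cov.
Context {R : realType}.
Local Notation leb := (@lebesgue_measure R).
Local Open Scope ereal_scope.
(** On each vertical line the map is affine, so measurability of [k] suffices. In the kernel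
    integrals [k] follows a horizontal curve through the centre; its bend does not enter the
    Jacobian. *)
Lemma ge0_integral_shear (e0 al be : R) (k : R -> R) (F : R * R -> \bar R) :
  (0 < al)%R -> (0 < be)%R -> measurable_fun setT k ->
  measurable_fun setT F -> (forall p, 0 <= F p) ->
  \int[leb \x leb]_p F p =
  (al * be)%:E * \int[leb \x leb]_p F (e0 + al * p.1, k p.1 + be * p.2)%R.
Proof.
move=> al0 be0 mk mF F0.
have mG : measurable_fun setT
    (fun p : R * R => F (e0 + al * p.1, k p.1 + be * p.2)%R).
  apply: (measurableT_comp mF); apply: measurable_fun_pair.
    apply: (measurableT_comp (measurable_affine e0 al)); exact: measurable_fst.
  apply: measurable_funD; first exact: (measurableT_comp mk).
  exact: measurable_funM.
rewrite fubini_tonelli1// fubini_tonelli1// /fubini_F.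
rewrite (ge0_integral_affine e0 al0); last 2 first.
- exact: measurable_fun_fubini_tonelli_F.
- by move=> x; apply: integral_ge0.
rewrite EFinM -muleA; congr (_ * _).
rewrite -ge0_integralZl//; last 3 first.
- exact: (@measurable_fun_fubini_tonelli_F _ _ (measurableTypeR R) (measurableTypeR R) R leb _ mG (fun p => F0 _)).
- by move=> x _; apply: integral_ge0.
- by rewrite lee_fin ltW.
apply: eq_integral => x _ /=.
rewrite (ge0_integral_affine (k x) be0)//.
exact: (measurableT_comp mF (measurable_pair1 _)).
Qed.

End cov.

Section integral_EFin.
Local Open Scope ereal_scope.
Context d (T : measurableType d) (R : realType) (m : {measure set T -> \bar R}).
Implicit Types f g : T -> R.

Lemma integral_EFin_ge0 f : (forall x, 0 <= f x)%R -> 0 <= \int[m]_x (f x)%:E.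
Proof. by move=> f0; apply: integral_ge0 => x _; rewrite lee_fin. Qed.

Lemma integral_EFin_le f g : measurable_fun setT f -> measurable_fun setT g ->
  (forall x, 0 <= f x)%R -> (forall x, f x <= g x)%R ->
  \int[m]_x (f x)%:E <= \int[m]_x (g x)%:E.
Proof.
move=> mf mg f0 fg; apply: ge0_le_integral => //.
- by move=> x _; rewrite lee_fin.
- exact/measurable_EFinP.
- exact/measurable_EFinP.
- by move=> x _; rewrite lee_fin.
Qed.

Lemma integral_EFin_add f g : measurable_fun setT f -> measurable_fun setT g ->
  (forall x, 0 <= f x)%R -> (forall x, 0 <= g x)%R ->
  \int[m]_x (f x + g x)%:E = \int[m]_x (f x)%:E + \int[m]_x (g x)%:E.
Proof.
move=> mf mg f0 g0; rewrite -ge0_integralD//.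
- by move=> x _; rewrite lee_fin.
- exact/measurable_EFinP.
- by move=> x _; rewrite lee_fin.
- exact/measurable_EFinP.
Qed.

Lemma integral_EFin_scale (c : R) f : measurable_fun setT f -> (0 <= c)%R ->
  (forall x, 0 <= f x)%R ->
  \int[m]_x (c * f x)%:E = c%:E * \int[m]_x (f x)%:E.
Proof.
move=> mf c0 f0; rewrite -ge0_integralZl//.
- exact/measurable_EFinP.
- by move=> x _; rewrite lee_fin.
Qed.

End integral_EFin.

(** * Integration over boxes *)

Section box.
Context {R : realType}.
Local Notation leb := (@lebesgue_measure R).
Local Notation leb2 := (leb \x leb)%E.
Implicit Types (N M : R) (F G : R * R -> R).

Definition box N : set (R * R) := `[- N, N]%classic `*` `[- N, N]%classic.

Lemma boxP N p : box N p <-> `|p.1| <= N /\ `|p.2| <= N.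
Proof. by rewrite /box /= !in_itv/= !ler_norml; split=> -[-> ->]. Qed.

Lemma measurable_box N :
  measurable (box N : set (measurableTypeR R * measurableTypeR R)).
Proof. by apply: measurableX; exact: measurable_itv. Qed.
Hint Resolve measurable_box : core.

Lemma box_volume N : 0 <= N -> leb2 (box N) = (4 * N ^+ 2)%:E.
Proof.
move=> N0; rewrite /box product_measure1E//.
rewrite /= !lebesgue_measure_itv /= lte_fin.
case: ltP => h; first by rewrite -!EFinB -EFinM; congr EFin; ring.
have -> : N = 0 by apply/eqP; rewrite eq_le N0 andbT; lra.
by rewrite mule0 expr0n mulr0.
Qed.

(** Measurability on the plane and a bound on the box both survive sums, products, powers and
    [bump], so the tactic [boxnice] proves integrability by following the syntax of the
    integrand. *)
Definition boxnice N F := measurable_fun setT F /\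
  exists M, forall p, box N p -> `|F p| <= M.

Lemma boxnice_integrable N F : 0 <= N -> boxnice N F ->
  leb2.-integrable (box N) (EFin \o F).
Proof.
move=> N0 [mF [M FM]]; apply: measurable_bounded_integrable => //.
- have bfin : (leb2 (box N) < +oo)%E by rewrite box_volume// ltry.
  exact: bfin.
- exact: measurable_funTS.
- exists M; split; first exact: num_real.
  by move=> x Mx p /FM /le_trans; apply; exact: ltW.
Qed.

Lemma boxnice_cst N (c : R) : boxnice N (fun _ => c).
Proof. by split; [exact: measurable_cst|exists `|c|]. Qed.

Lemma boxnice_fst N : boxnice N fst.
Proof. by split; [exact: measurable_fst|exists N => p /boxP[]]. Qed.

Lemma boxnice_snd N : boxnice N snd.
Proof. by split; [exact: measurable_snd|exists N => p /boxP[]]. Qed.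

Lemma boxniceD N F G : boxnice N F -> boxnice N G ->
  boxnice N (fun p => F p + G p).
Proof.
move=> [mF [M FM]] [mG [M' GM]]; split; first exact: measurable_funD.
by exists (M + M') => p bp; rewrite (le_trans (ler_normD _ _))// lerD ?FM ?GM.
Qed.

Lemma boxniceM N F G : boxnice N F -> boxnice N G ->
  boxnice N (fun p => F p * G p).
Proof.
move=> [mF [M FM]] [mG [M' GM]]; split; first exact: measurable_funM.
by exists (M * M') => p bp; rewrite normrM ler_pM ?FM ?GM.
Qed.

Lemma boxniceN N F : boxnice N F -> boxnice N (fun p => - F p).
Proof.
move=> [mF [M FM]]; split; first exact: measurableT_comp.
by exists M => p bp; rewrite normrN FM.
Qed.

Lemma boxniceX N F n : boxnice N F -> boxnice N (fun p => F p ^+ n).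
Proof.
move=> nF; elim: n => [|n IH]; first exact: boxnice_cst.
by rewrite (_ : (fun _ => _) = (fun p => F p * F p ^+ n));
  [exact: boxniceM|apply/funext => p; rewrite exprS].
Qed.

Lemma boxnice_ppart N F : boxnice N F -> boxnice N (fun p => ppart (F p)).
Proof.
move=> [mF [M FM]]; split.
  by apply: measurable_maxr => //; exact: measurable_cst.
exists M => p bp; apply: le_trans (FM p bp).
by have [[? ->]|[? ->]] := ppart_cases (F p); rewrite ?normr0.
Qed.

Lemma boxnice_bump N F : boxnice N F -> boxnice N (fun p => bump (F p)).
Proof.
move=> nF; apply/boxniceX/boxnice_ppart/boxniceD; first exact: boxnice_cst.
exact: boxniceN.
Qed.

Definition boxint N F : R := (\int[leb2]_(p in box N) F p)%R.

Lemma boxintD N F G : 0 <= N -> boxnice N F -> boxnice N G ->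
  boxint N (fun p => F p + G p) = boxint N F + boxint N G.
Proof. by move=> N0 nF nG; apply: RintegralD => //; exact: boxnice_integrable. Qed.

Lemma boxintB N F G : 0 <= N -> boxnice N F -> boxnice N G ->
  boxint N (fun p => F p - G p) = boxint N F - boxint N G.
Proof. by move=> N0 nF nG; apply: RintegralB => //; exact: boxnice_integrable. Qed.

Lemma boxintZ N F (c : R) : 0 <= N -> boxnice N F ->
  boxint N (fun p => c * F p) = c * boxint N F.
Proof. by move=> N0 nF; apply: RintegralZl => //; exact: boxnice_integrable. Qed.

Lemma eq_boxint N F G : (forall p, F p = G p) -> boxint N F = boxint N G.
Proof. by move=> /funext ->. Qed.

Lemma boxint_ge0 N F : (forall p, box N p -> 0 <= F p) -> 0 <= boxint N F.
Proof. by move=> F0; rewrite /boxint; apply: Rintegral_ge0. Qed.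

Lemma boxint_cst N (c : R) : 0 <= N -> boxint N (fun _ => c) = c * (4 * N ^+ 2).
Proof.
move=> N0; transitivity (c * fine (leb2 (box N))); first exact: Rintegral_cst.
by rewrite box_volume.
Qed.

Lemma le_boxint N F G : 0 <= N -> boxnice N F -> boxnice N G ->
  (forall p, box N p -> F p <= G p) -> boxint N F <= boxint N G.
Proof. by move=> N0 nF nG FG; apply: le_Rintegral => //; exact: boxnice_integrable. Qed.

Lemma boxint_close N F G e : 0 <= N -> boxnice N F -> boxnice N G ->
  (forall p, box N p -> `|F p - G p| <= e) ->
  `|boxint N F - boxint N G| <= e * (4 * N ^+ 2).
Proof.
move=> N0 nF nG FG; rewrite -boxintB// -boxint_cst// ler_norml; apply/andP; split.
  rewrite -mulN1r -boxintZ//; last exact: boxnice_cst.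
  apply: le_boxint => //.
  - by apply: boxniceM; exact: boxnice_cst.
  - by apply: boxniceD => //; exact: boxniceN.
  - by move=> p /FG; rewrite mulN1r ler_norml => /andP[].
apply: le_boxint => //; last by move=> p /FG; rewrite ler_norml => /andP[].
- by apply: boxniceD => //; exact: boxniceN.
- exact: boxnice_cst.
Qed.

Lemma integral_boxint N F : 0 <= N -> boxnice N F ->
  (forall p, ~ box N p -> F p = 0) ->
  (\int[leb2]_p (F p)%:E = (boxint N F)%:E)%E.
Proof.
move=> N0 nF F0; rewrite /boxint /Rintegral fineK; last first.
  by apply: integrable_fin_num => //; exact: boxnice_integrable.
rewrite [RHS]integral_mkcond; apply: eq_integral => p _.
rewrite patchE; case: ifPn => // /negP; rewrite inE => /F0 ->//.
Qed.

Lemma integral_segment_deriv (V f : R -> R) (a b : R) : a < b ->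
  (forall t, is_derive t (1 : R) V (f t)) -> continuous f ->
  V a = 0 -> V b = 0 ->
  (\int[leb]_(t in `[a, b]) (f t)%:E = 0)%E.
Proof.
move=> ab dV cf Va Vb.
have cV t : {for t, continuous V}.
  by apply/differentiable_continuous/derivable1_diffP; exact: ex_derive.
rewrite (@continuous_FTC2 _ f V a b)//; first by rewrite Va Vb subee.
- exact: continuous_subspaceT.
- split.
  + by move=> x _; exact: ex_derive.
  + exact/cvg_at_right_filter/cV.
  + exact/cvg_at_left_filter/cV.
- by move=> x _; rewrite derive1E derive_val.
Qed.

(** Half of the divergence theorem: on each line the derivative of a function vanishing at both ends
    integrates to 0, and Fubini sums the lines. *)
Lemma boxint_dsnd N (F V : R -> R -> R) : 0 < N ->
  boxnice N (fun p => F p.1 p.2) ->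
  (forall s, continuous (F s)) ->
  (forall s t, is_derive t (1 : R) (V s) (F s t)) ->
  (forall s, V s (- N) = 0 /\ V s N = 0) ->
  boxint N (fun p => F p.1 p.2) = 0.
Proof.
move=> N0 nF cF dV V0.
have := boxnice_integrable (ltW N0) nF.
rewrite /boxint /Rintegral integrable_mkcond// => iF.
rewrite integral_mkcond -integral12_prod_meas1//= /fubini_F integral0_eq//= => s _.
have [sN|sN] := pselect (`[- N, N]%classic s).
  rewrite -(@integral_segment_deriv (V s) (F s) (- N) N) ?(proj1 (V0 s)) ?(proj2 (V0 s))//; last lra.
  rewrite [RHS]integral_mkcond; apply: eq_integral => t _.
  by rewrite !patchE /box in_setX/= mem_set//=.
apply: integral0_eq => t _; rewrite patchE /box in_setX/= memNset//=.
Qed.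

Lemma boxint_dfst N (F V : R -> R -> R) : 0 < N ->
  boxnice N (fun p => F p.1 p.2) ->
  (forall t, continuous (F ^~ t)) ->
  (forall s t, is_derive s (1 : R) (V ^~ t) (F s t)) ->
  (forall t, V (- N) t = 0 /\ V N t = 0) ->
  boxint N (fun p => F p.1 p.2) = 0.
Proof.
move=> N0 nF cF dV V0.
have := boxnice_integrable (ltW N0) nF.
rewrite /boxint /Rintegral integrable_mkcond// => iF.
rewrite integral_mkcond -integral21_prod_meas1//= /fubini_G integral0_eq//= => t _.
have [tN|tN] := pselect (`[- N, N]%classic t).
  rewrite -(@integral_segment_deriv (V ^~ t) (F ^~ t) (- N) N) ?(proj1 (V0 t)) ?(proj2 (V0 t))//; last lra.
  rewrite [RHS]integral_mkcond; apply: eq_integral => s _.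
  by rewrite !patchE /box in_setX/= (mem_set tN) andbT.
apply: integral0_eq => s _; rewrite patchE /box in_setX/= (memNset tN) andbF//.
Qed.

End box.

(* The library's sigma-finite instance of product measures is shadowed by the
   one of product probabilities, whence this copy of the plane measure. *)
Definition plane_measure (R : realType) :
    set (measurableTypeR R * measurableTypeR R) -> \bar R :=
  (@lebesgue_measure R \x @lebesgue_measure R)%E.

HB.instance Definition _ (R : realType) := Measure.on (@plane_measure R).

Lemma plane_measure_sigma_finite (R : realType) :
  sigma_finite [set: measurableTypeR R * measurableTypeR R] (@plane_measure R).
Proof.
exists (fun n => box n%:R); last first.
  move=> n; split; first exact: measurable_box.
  by rewrite /plane_measure box_volume// ltry.
apply/seteqP; split => // p _; pose x := `|p.1| + `|p.2|.
exists (Num.bound x) => //; apply/boxP.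
have : x < (Num.bound x)%:R by apply: archi_boundP; rewrite addr_ge0.
by rewrite /x; have := normr_ge0 p.1; have := normr_ge0 p.2; split; lra.
Qed.

HB.instance Definition _ (R : realType) := @Measure_isSigmaFinite.Build _ _ _
  (@plane_measure R) (@plane_measure_sigma_finite R).

Ltac boxnice := lazymatch goal with
  | |- boxnice _ (fun p => @?F p + @?G p) =>
      apply: (@boxniceD _ _ F G); boxnice
  | |- boxnice _ (fun p => - @?F p) => apply: (@boxniceN _ _ F); boxnice
  | |- boxnice _ (fun p => @?F p * @?G p) =>
      apply: (@boxniceM _ _ F G); boxnice
  | |- boxnice _ (fun p => @?F p ^+ ?n) => apply: (@boxniceX _ _ F n); boxnice
  | |- boxnice _ (fun p => bump (@?F p)) => apply: (@boxnice_bump _ _ F); boxnice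
  | |- boxnice _ (fun p => ppart (@?F p)) => apply: (@boxnice_ppart _ _ F); boxnice
  | |- boxnice _ (fun p => p.1) => exact: boxnice_fst
  | |- boxnice _ (fun p => p.2) => exact: boxnice_snd
  | |- boxnice _ (fun p => ?c) => first [assumption | exact: (boxnice_cst _ c)]
  | _ => try assumption
  end.

(** A quadratic error bound gives the derivative at one point without regularity elsewhere. It
    serves the powers of [ppart], and later a curve through a characteristic point whose vertical
    component is picked pointwise. *)
Lemma is_derive_quadratic (R : realType) (V : normedModType R) (f : R -> V)
    (x : R) (d : V) (C e : R) : 0 < e ->
  (forall h, `|h| <= e -> `|f (h + x) - f x - h *: d| <= C * h ^+ 2) ->
  is_derive x (1 : R) f d.
Proof.
move=> e0 fC.
have key : h^-1 *: ((f \o shift x) (h *: (1 : R)) - f x) @[h --> (0 : R)^'] --> d.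
  apply/cvgrPdist_le => eps eps0.
  have C0 : 0 < `|C| + 1 by rewrite ltr_pwDr.
  near=> h.
  have h0 : h != 0 by near: h; exact: nbhs_dnbhs_neq.
  have hC : `|f (h + x) - f x - h *: d| <= C * h ^+ 2.
    by apply: fC; near: h; exact: dnbhs0_le.
  have he : `|h| <= eps / (`|C| + 1).
    by near: h; apply: dnbhs0_le; rewrite divr_gt0.
  rewrite /= /shift scaler1 -normrN opprB.
  have -> : h^-1 *: (f (h + x) - f x) - d = h^-1 *: (f (h + x) - f x - h *: d).
    by rewrite [in RHS]scalerBr scalerA mulVf// scale1r.
  rewrite normrZ normfV ler_pdivrMl ?normr_gt0//.
  apply: (le_trans hC); rewrite -real_normK ?num_real// expr2 mulrCA.
  rewrite ler_pM2l ?normr_gt0//.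
  apply: (@le_trans _ _ ((`|C| + 1) * `|h|)).
    by rewrite ler_wpM2r// (le_trans (ler_norm _))// lerDl.
  by rewrite mulrC -ler_pdivlMr.
split; first by apply/cvg_ex; exists d.
exact/cvg_lim.
Unshelve. all: by end_near. Qed.

(** * Powers of the positive part *)

Section ppart_derive.
Context {R : realType}.
Implicit Types x : R.

Lemma is_derive_ppart2 x : is_derive x (1 : R) (fun t => ppart t ^+ 2) (2 * ppart x).
Proof.
apply: (is_derive_quadratic (C := 1) (e := 1)) => // h _.
rewrite mul1r /GRing.scale/=.
have [[a ->]|[a ->]] := ppart_cases x;
have [[b ->]|[b ->]] := ppart_cases (h + x).
- rewrite (_ : _ - _ = h ^+ 2) ?ger0_norm ?sqr_ge0//; ring.
- rewrite (_ : _ - _ = - x ^+ 2 - 2 * x * h); last by ring.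
  rewrite ler_norml; apply/andP; split; nra.
- rewrite (_ : _ - _ = (h + x) ^+ 2); last by ring.
  rewrite ger0_norm ?sqr_ge0//; nra.
- by rewrite !expr0n/= !mulr0 !subr0 normr0 sqr_ge0.
Qed.

Lemma is_derive_ppart3 x : is_derive x (1 : R) (fun t => ppart t ^+ 3) (3 * ppart x ^+ 2).
Proof.
apply: (is_derive_quadratic (C := 4 * `|x| + 1) (e := 1)) => // h h1.
rewrite /GRing.scale/=.
have h2 : 0 <= h ^+ 2 := sqr_ge0 h.
move: h1; rewrite ler_norml => /andP[h1 h3].
have [[a ->]|[a ->]] := ppart_cases x;
have [[b ->]|[b ->]] := ppart_cases (h + x).
- rewrite (_ : _ - _ = (3 * x + h) * h ^+ 2); last by ring.
  rewrite normrM (ger0_norm h2) ler_wpM2r// (ger0_norm a).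
  rewrite ler_norml; apply/andP; split; lra.
- rewrite (_ : _ - _ = x ^+ 2 * (- x - 3 * h)); last by ring.
  rewrite (ger0_norm a) ger0_norm; last by rewrite mulr_ge0 ?sqr_ge0//; lra.
  apply: (@le_trans _ _ ((x * - h) * (- h - 3 * h))).
    rewrite ler_pM ?sqr_ge0//; [lra|rewrite expr2; nra|lra].
  rewrite (_ : _ * _ = 4 * x * h ^+ 2); last by ring.
  by rewrite ler_wpM2r//; lra.
- rewrite (_ : _ - _ = (h + x) * (h + x) ^+ 2); last by ring.
  rewrite ger0_norm ?mulr_ge0 ?sqr_ge0//.
  rewrite ler_pM ?sqr_ge0//; last by nra.
  by have := normr_ge0 x; lra.
- rewrite !expr0n/= !mulr0 !subr0 normr0 mulr_ge0//.
Qed.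

End ppart_derive.

Lemma continuous_ppart (R : realType) : continuous (@ppart R).
Proof.
have -> : @ppart R = (fun x => 2^-1 * (x + `|x|)).
  apply/funext => x; have [[h ->]|[h ->]] := ppart_cases x.
    by rewrite ger0_norm//; lra.
  by rewrite ltr0_norm//; lra.
move=> x; apply: cvgM; first exact: cvg_cst.
by apply: cvgD; [exact: cvg_id|exact: norm_continuous].
Qed.

Lemma cvg_exp (R : realType) (f : R -> R) (l x : R) (n : nat) :
  f y @[y --> x] --> l -> f y ^+ n @[y --> x] --> l ^+ n.
Proof.
move=> fl; elim: n => [|n IH]; first exact: cvg_cst.
rewrite exprS; under eq_fun do rewrite exprS.
exact: cvgM.
Qed.

Section continuous_closure.
Context {R : realType}.
Implicit Types f g : R -> R.

Lemma continuous_add f g : continuous f -> continuous g ->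
  continuous (fun x => f x + g x).
Proof. by move=> cf cg x; apply: cvgD; [exact: cf|exact: cg]. Qed.

Lemma continuous_mul f g : continuous f -> continuous g ->
  continuous (fun x => f x * g x).
Proof. by move=> cf cg x; apply: cvgM; [exact: cf|exact: cg]. Qed.

Lemma continuous_opp f : continuous f -> continuous (fun x => - f x).
Proof. by move=> cf x; apply: cvgN; exact: cf. Qed.

Lemma continuous_exp f n : continuous f -> continuous (fun x => f x ^+ n).
Proof. by move=> cf x; apply: cvg_exp; exact: cf. Qed.

Lemma continuous_ppart_comp f : continuous f -> continuous (fun x => ppart (f x)).
Proof.
by move=> cf x; apply: (cvg_comp _ _ (cf x)); exact: continuous_ppart.
Qed.

End continuous_closure.

Ltac contin := lazymatch goal with
  | |- continuous (fun x => @?f x + @?g x) =>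
      apply: (@continuous_add _ f g); contin
  | |- continuous (fun x => - @?f x) => apply: (@continuous_opp _ f); contin
  | |- continuous (fun x => @?f x * @?g x) =>
      apply: (@continuous_mul _ f g); contin
  | |- continuous (fun x => @?f x ^+ ?n) => apply: (@continuous_exp _ f n); contin
  | |- continuous (fun x => ppart (@?f x)) =>
      apply: (@continuous_ppart_comp _ f); contin
  | |- continuous (fun x => x) => by move=> ?; exact: cvg_id
  | |- continuous (fun x => ?c) => by move=> ?; exact: cvg_cst
  end.

(** * The second variation as a divergence plus a multiple of one moment *)

Section second_variation.
Context {R : realType}.
Variables (a b c d : R).

Let n0 (s t : R) : R := s ^+ 4 + t ^+ 2.
Let P (s t : R) : R := ppart (1 - n0 s t).

Let n1 (s t : R) : R := 4 * s * t * (a * s ^+ 2 + b * t).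
Let n2 (s t : R) : R := 6 * s ^+ 2 * (a * s ^+ 2 + b * t) ^+ 2
  + 4 * s * t * (c * s * t + d * s ^+ 3).

(** Under the dilation (s, t) -> (r s, r^2 t), [korK / r^4] at a graph point begins with n0 + r n1 +
    r^2 n2. The r^2 terms of w times [bump] are collected here: the first derivative of [bump] on
    n2, half the second on n1^2, and 2 a^2 s^2 from w, as A is 2 a r s to first order. *)
Definition var2 (p : R * R) : R :=
  - 3 * P p.1 p.2 ^+ 2 * n2 p.1 p.2 + 3 * P p.1 p.2 * n1 p.1 p.2 ^+ 2
  + 2 * a ^+ 2 * p.1 ^+ 2 * P p.1 p.2 ^+ 3.

Definition var1 (p : R * R) : R := - 3 * P p.1 p.2 ^+ 2 * n1 p.1 p.2.

(** Built to lower the t-degree: the t-derivative of [P] is - 2 t, so the P^2 part of [V] removes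
    the P n1^2 term of [var2], and the P^3 part removes all P^2 terms then present except - 6 a^2
    s^6 P^2, which has no factor t and is left to [W]. *)
Let V (s t : R) : R :=
  P s t ^+ 2 * (- 12 * a ^+ 2 * s ^+ 6 * t - 24 * a * b * s ^+ 4 * t ^+ 2
                - 12 * b ^+ 2 * s ^+ 2 * t ^+ 3) +
  P s t ^+ 3 * ((2 * d - 2 * a * b) * s ^+ 4 + (2 * c - 3 * b ^+ 2) * s ^+ 2 * t).

Let dV (s t : R) : R :=
  - 4 * t * P s t * (- 12 * a ^+ 2 * s ^+ 6 * t - 24 * a * b * s ^+ 4 * t ^+ 2
                - 12 * b ^+ 2 * s ^+ 2 * t ^+ 3) +
  P s t ^+ 2 * (- 12 * a ^+ 2 * s ^+ 6 - 48 * a * b * s ^+ 4 * t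
                - 36 * b ^+ 2 * s ^+ 2 * t ^+ 2) +
  - 6 * t * P s t ^+ 2 *
    ((2 * d - 2 * a * b) * s ^+ 4 + (2 * c - 3 * b ^+ 2) * s ^+ 2 * t) +
  P s t ^+ 3 * ((2 * c - 3 * b ^+ 2) * s ^+ 2).

Let W (s t : R) : R := 2^-1 * a ^+ 2 * s ^+ 3 * P s t ^+ 3.

Let dW (s t : R) : R := 2^-1 * a ^+ 2 * (3 * s ^+ 2 * P s t ^+ 3
  - 12 * s ^+ 6 * P s t ^+ 2).

Let P_comp (g : R -> R) (x dg : R) :
  is_derive x (1 : R) g dg ->
  is_derive x (1 : R) (fun t => ppart (1 - g t) ^+ 2) (- 2 * ppart (1 - g x) * dg) /\
  is_derive x (1 : R) (fun t => ppart (1 - g t) ^+ 3) (- 3 * ppart (1 - g x) ^+ 2 * dg).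
Proof.
move=> hg.
have h1 : is_derive x (1 : R) (fun t => 1 - g t) (- dg).
  by apply: is_derive_eq; ring.
split.
- have := @is_derive1_comp _ (fun t => ppart t ^+ 2) (fun t => 1 - g t) x _ _
    (is_derive_ppart2 (1 - g x)) h1.
  by move=> h; apply: is_derive_eq; ring.
- have := @is_derive1_comp _ (fun t => ppart t ^+ 3) (fun t => 1 - g t) x _ _
    (is_derive_ppart3 (1 - g x)) h1.
  by move=> h; apply: is_derive_eq; ring.
Qed.

Let is_derive_V s t : is_derive t (1 : R) (V s) (dV s t).
Proof.
have hn : is_derive t (1 : R) (n0 s) (2 * t).
  by apply: is_derive_eq; rewrite /GRing.scale/=; ring.
have [h2 h3] := @P_comp (n0 s) t _ hn.
rewrite /V /P; apply: is_derive_eq; rewrite /dV /P /GRing.scale /=; ring.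
Qed.

Let is_derive_W s t : is_derive s (1 : R) (W ^~ t) (dW s t).
Proof.
have hn : is_derive s (1 : R) (n0 ^~ t) (4 * s ^+ 3).
  by apply: is_derive_eq; rewrite /GRing.scale/=; ring.
have [h2 h3] := @P_comp (n0 ^~ t) s _ hn.
rewrite /W /P; apply: is_derive_eq; rewrite /dW /P /GRing.scale /=; ring.
Qed.

Lemma boxint_var2 (N : R) : 1 <= N ->
  boxint N var2 = (a ^+ 2 / 2 + 3 * b ^+ 2 - 2 * c) *
    boxint N (fun p => p.1 ^+ 2 * ppart (1 - (p.1 ^+ 4 + p.2 ^+ 2)) ^+ 3).
Proof.
move=> N1; have N0 : 0 < N by lra.
have P0 s t : N ^+ 2 <= t ^+ 2 \/ N ^+ 4 <= s ^+ 4 -> P s t = 0.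
  rewrite /P /n0 => h; rewrite /ppart max_l// subr_le0.
  case: h => h.
    have : 0 <= s ^+ 4 by rewrite (exprM s 2 2) sqr_ge0.
    have : 1 <= N ^+ 2 by rewrite exprn_ege1.
    lra.
  have := sqr_ge0 t.
  have : 1 <= N ^+ 4 by rewrite exprn_ege1.
  lra.
have nV : boxnice N (fun p => dV p.1 p.2) by rewrite /dV /P /n0; boxnice.
have nW : boxnice N (fun p => dW p.1 p.2) by rewrite /dW /P /n0; boxnice.
have IV : boxint N (fun p => dV p.1 p.2) = 0.
  apply: (boxint_dsnd N0 nV _ is_derive_V).
    by move=> s; rewrite /dV /P /n0; contin.
  by move=> s; rewrite /V !P0 ?sqrrN; [split; ring|by left|by left].
have IW : boxint N (fun p => dW p.1 p.2) = 0.
  apply: (boxint_dfst N0 nW _ is_derive_W).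
    by move=> t; rewrite /dW /P /n0; contin.
  move=> s; rewrite /W !P0; [split; ring|by right|right].
  by rewrite (exprM (- N) 2 2) sqrrN -exprM.
have nS : boxnice N (fun p => p.1 ^+ 2 * ppart (1 - (p.1 ^+ 4 + p.2 ^+ 2)) ^+ 3).
  by boxnice.
rewrite -boxintZ//; last exact: ltW.
rewrite -[RHS]add0r -IV -[RHS]add0r -[X in X + _]IW.
have nK : boxnice N (fun p => (a ^+ 2 / 2 + 3 * b ^+ 2 - 2 * c) *
    (p.1 ^+ 2 * ppart (1 - (p.1 ^+ 4 + p.2 ^+ 2)) ^+ 3)) by boxnice.
rewrite -(boxintD (ltW N0) nV nK) -(boxintD (ltW N0) nW); last first.
  exact: (boxniceD nV nK).
apply: eq_boxint => p.
by rewrite /var2 /dV /dW /n1 /n2 -/(n0 p.1 p.2) -/(P p.1 p.2); field.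
Qed.

Lemma boxnice_var1 (N : R) : boxnice N var1.
Proof. by rewrite /var1 /P /n0 /n1; boxnice. Qed.

Lemma boxnice_var2 (N : R) : boxnice N var2.
Proof. by rewrite /var2 /P /n0 /n1 /n2; boxnice. Qed.
End second_variation.

(** * Integrals over a graph *)

Section bddon.
Context {R : realType} {I : Type}.
Implicit Types (D : set I) (F G : I -> R).

(** Uniform O(1). The index gathers parameters such as centre, radius and rescaled point; a
    remainder becomes a function of the index, and the tactic [bddon] reads its boundedness off its
    formula. *)
Definition bddon D F := exists C, forall i, D i -> `|F i| <= C.

Lemma bddon_cst D (c : R) : bddon D (fun _ => c).
Proof. by exists `|c|. Qed.

Lemma bddonD D F G : bddon D F -> bddon D G -> bddon D (fun i => F i + G i).
Proof.
move=> [M FM] [M' GM]; exists (M + M') => i Di.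
by rewrite (le_trans (ler_normD _ _))// lerD ?FM ?GM.
Qed.

Lemma bddonM D F G : bddon D F -> bddon D G -> bddon D (fun i => F i * G i).
Proof.
by move=> [M FM] [M' GM]; exists (M * M') => i Di; rewrite normrM ler_pM ?FM ?GM.
Qed.

Lemma bddonN D F : bddon D F -> bddon D (fun i => - F i).
Proof. by move=> [M FM]; exists M => i Di; rewrite normrN FM. Qed.

Lemma bddonX D F n : bddon D F -> bddon D (fun i => F i ^+ n).
Proof. by move=> [M FM]; exists (M ^+ n) => i Di; rewrite normrX lerXn2r ?nnegrE ?FM// (le_trans _ (FM i Di)). Qed.

Lemma bddon_ppart D F : bddon D F -> bddon D (fun i => ppart (F i)).
Proof.
move=> [M FM]; exists M => i Di; apply: le_trans (FM i Di).
by have [[? ->]|[? ->]] := ppart_cases (F i); rewrite ?normr0.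
Qed.

Lemma bddon_le D F G : bddon D G -> (forall i, D i -> `|F i| <= `|G i|) -> bddon D F.
Proof. by move=> [M GM] FG; exists M => i Di; rewrite (le_trans (FG i Di))// GM. Qed.

Lemma bddon_pos D F : bddon D F -> exists2 C, 0 < C & forall i, D i -> `|F i| <= C.
Proof.
move=> [M FM]; exists (`|M| + 1); first by rewrite ltr_pwDr.
by move=> i /FM /le_trans; apply; rewrite (le_trans (ler_norm M))// lerDl.
Qed.

End bddon.

Ltac bddon := lazymatch goal with
  | |- bddon _ (fun p => @?F p + @?G p) => apply: (@bddonD _ _ _ F G); bddon
  | |- bddon _ (fun p => - @?F p) => apply: (@bddonN _ _ _ F); bddon
  | |- bddon _ (fun p => @?F p * @?G p) => apply: (@bddonM _ _ _ F G); bddon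
  | |- bddon _ (fun p => @?F p ^+ ?n) => apply: (@bddonX _ _ _ F n); bddon
  | |- bddon _ (fun p => ppart (@?F p)) => apply: (@bddon_ppart _ _ _ F); bddon
  | |- bddon _ (fun p => ?c) => first [assumption | exact: (bddon_cst _ c)]
  | _ => try assumption
  end.

(** With x = y^2 - 1 the error is exactly - (y - 1)^2 / 2. *)
Lemma sqrt1p_approx (R : realType) (x : R) : 0 <= x ->
  `|Num.sqrt (1 + x) - 1 - x / 2| <= x ^+ 2.
Proof.
move=> x0; set y := Num.sqrt (1 + x).
have y2 : y ^+ 2 = 1 + x by rewrite sqr_sqrtr//; lra.
have y0 : 0 <= y by exact: sqrtr_ge0.
have -> : x = y ^+ 2 - 1 by lra.
have y1 : 1 <= y by nra.
rewrite (_ : y - 1 - _ = - ((y - 1) ^+ 2 / 2)); last by field.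
rewrite normrN ger0_norm ?divr_ge0 ?sqr_ge0//.
rewrite (_ : (y ^+ 2 - 1) ^+ 2 = (y - 1) ^+ 2 * (y + 1) ^+ 2); last by ring.
rewrite ler_wpM2l ?sqr_ge0//; nra.
Qed.

(** In [gd_order1] the vertical displacement is relative to the horizontal direction at [q], as the
    weights demand. [gd_order3] has no term linear in eta: the axes are rotated so that A vanishes
    at the origin. The 1 in [gd_phiM] leaves room for points close to the graph. *)
Record graph_data (R : realType) (phi A : R -> R -> R) (del M a b c d : R) : Prop := {
  gd_del : 0 < del;
  gd_M : 0 <= M;
  gd_mphi : measurable_fun setT (fun p : R * R => phi p.1 p.2);
  gd_mA : measurable_fun setT (fun p : R * R => A p.1 p.2);
  gd_phiM : forall p, box del p -> `|phi p.1 p.2| + 1 <= M;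
  gd_AM : forall p, box del p -> `|A p.1 p.2| <= M;
  gd_Alip : forall p q, box del p -> box del q ->
    `|A p.1 p.2 - A q.1 q.2| <= M * (`|p.1 - q.1| + `|p.2 - q.2|);
  gd_order1 : forall p q, box del p -> box del q ->
    `|phi p.1 p.2 - phi q.1 q.2 - A q.1 q.2 * (p.1 - q.1)| <=
    M * ((p.1 - q.1) ^+ 2 + `|p.2 - q.2 + 4 * (p.1 - q.1) * phi q.1 q.2|);
  gd_order3 : forall p, box del p ->
    `|phi p.1 p.2 - (a * p.1 ^+ 2 + b * p.2 + c * p.1 * p.2 + d * p.1 ^+ 3)| <=
    M * (p.1 ^+ 4 + p.2 ^+ 2);
  gd_Aorder : forall p, box del p ->
    `|A p.1 p.2 - 2 * a * p.1| <= M * (p.1 ^+ 2 + `|p.2|)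
}.

Section graph.
Context {R : realType}.
Local Notation leb := (@lebesgue_measure R).
Local Notation leb2 := (leb \x leb)%E.
Variables (phi A : R -> R -> R) (del M a b c d : R).
Hypothesis gd : graph_data phi A del M a b c d.

Definition graph_pt (p : R * R) : R * R * R := (phi p.1 p.2, p.1, p.2).
Definition graph_w (e t : R) : R := Num.sqrt (1 + A e t ^+ 2).
(** Half-width of a box containing every rescaled kernel support: [|p.1|] is at most w, hence at
    most 1 + M, and [|p.2|] at most 3 + 2 M, with 3 from [korK_bounds] and 2 M from the quadratic
    shear. *)
Definition big_box : R := 4 + 2 * M.
Local Notation N := big_box.
(** The kernel integral at scale 1 over the vertical plane phi = 0; for nonnegative M the box
    contains the support of the integrand. *)
Definition c0 : R := boxint N (fun p => bump (p.1 ^+ 4 + p.2 ^+ 2)).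

Let N0 : 0 <= N. Proof. by rewrite /big_box; have := gd_M gd; lra. Qed.

Lemma graph_phi_le p : box del p -> `|phi p.1 p.2| <= M.
Proof. by move=> /(gd_phiM gd); lra. Qed.

Lemma graph_w_ge1 e t : 1 <= graph_w e t.
Proof.
by rewrite /graph_w -{1}sqrtr1 ler_sqrt ?lerDl ?sqr_ge0// addr_ge0// sqr_ge0.
Qed.

Lemma graph_w_le p : box del p -> graph_w p.1 p.2 <= 1 + M.
Proof.
move=> /(gd_AM gd) AM; have M0 := gd_M gd.
rewrite /graph_w -(ger0_norm (_ : 0 <= 1 + M)); last lra.
rewrite -sqrtr_sqr ler_sqrt ?sqr_ge0//.
have : A p.1 p.2 ^+ 2 <= M ^+ 2.
  by rewrite -real_normK ?num_real// lerXn2r ?nnegrE.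
nra.
Qed.

Lemma graph_w_sqr e t : graph_w e t ^+ 2 = 1 + A e t ^+ 2.
Proof. by rewrite sqr_sqrtr// addr_ge0// sqr_ge0. Qed.

Lemma measurable_korK_graph y (r : R) :
  measurable_fun setT (fun p : R * R => bump (korK y (graph_pt p) / r ^+ 4)).
Proof.
have mphi := gd_mphi gd.
rewrite /bump /ppart /korK /graph_pt /=.
apply: measurable_funX; apply: measurable_maxr; first exact: measurable_cst.
apply: measurable_funB; first exact: measurable_cst.
apply: measurable_funM; last exact: measurable_cst.
apply: measurable_funD; apply: measurable_funX.
  apply: measurable_funD; apply: measurable_funX; apply: measurable_funB => //.
apply: measurable_funD; first exact: measurable_funB.
apply: measurable_funM; first by apply: measurable_funM => //; exact: measurable_funB.
exact: measurable_funD.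
Qed.

Lemma boxnice_graph y (r al be e0 : R) (k : R -> R) :
  measurable_fun setT k ->
  boxnice N (fun p => bump (korK y
     (graph_pt (e0 + al * p.1, k p.1 + be * p.2)) / r ^+ 4)).
Proof.
move=> mk; split.
  apply: (measurableT_comp (measurable_korK_graph y r)).
  apply: measurable_fun_pair.
    apply: (measurableT_comp (measurable_affine e0 al)); exact: measurable_fst.
  apply: measurable_funD; first exact: (measurableT_comp mk).
  exact: measurable_funM.
exists 1 => p _; rewrite ger0_norm ?bump_ge0// bump_le1//.
by rewrite divr_ge0 ?korK_ge0// (exprM _ 2 2) sqr_ge0.
Qed.

Let stretch := 1 + N + 4 * N * M + 2 * M * N ^+ 2.

Let stretch_ge1 : 1 <= stretch.
Proof.
have M0 := gd_M gd; have := N0; rewrite /stretch => h.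
have : 0 <= N * M by exact: mulr_ge0.
have : 0 <= M * N ^+ 2 by rewrite mulr_ge0 ?sqr_ge0.
lra.
Qed.

(** Chosen with [r * stretch <= del / 2], so that the rescaled box around a point of [box (del / 2)]
    stays inside [box del]. *)
Definition small_radius : R := Num.min 1 (del / 2 / stretch).

Lemma small_radius_gt0 : 0 < small_radius.
Proof.
have := gd_del gd; have := stretch_ge1 => h d0.
by rewrite /small_radius lt_min ltr01/= !divr_gt0//; lra.
Qed.

Lemma small_radius_le1 : small_radius <= 1.
Proof. by rewrite /small_radius ge_min lexx. Qed.

Lemma near_box q r x y z : box (del / 2) q -> 0 < r <= small_radius ->
  `|x| <= N -> `|y| <= N -> `|z| <= M ->
  box del (q.1 + r * x, q.2 - 4 * (r * x) * z - 2 * A q.1 q.2 * (r * x) ^+ 2 + r ^+ 2 * y).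
Proof.
move=> /boxP[q1 q2] /andP[r0 rs] xN yN zM.
have M0 := gd_M gd; have d0 := gd_del gd; have st := stretch_ge1.
have AM : `|A q.1 q.2| <= M by apply: (gd_AM gd); apply/boxP; split; lra.
have r1 : r <= 1 by rewrite (le_trans rs)// small_radius_le1.
have rst : r * stretch <= del / 2.
  rewrite -ler_pdivlMr; last lra.
  by rewrite (le_trans rs)// /small_radius ge_min lexx orbT.
have rx : `|r * x| <= r * N by rewrite normrM (gtr0_norm r0) ler_wpM2l// ltW.
have MN : 0 <= N * M by rewrite mulr_ge0.
have MN2 : 0 <= M * N ^+ 2 by rewrite mulr_ge0 ?sqr_ge0.
have rr : r ^+ 2 <= r by rewrite expr2 ler_piMl// ltW.
apply/boxP => /=; split.
  apply: (le_trans (ler_normD _ _)).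
  have : r * N <= r * stretch by rewrite ler_wpM2l ?(ltW r0)// /stretch; have := N0; nra.
  lra.
have h1 : `|4 * (r * x) * z| <= 4 * (r * N) * M.
  rewrite !normrM -normrM (ger0_norm (_ : 0 <= 4))// ler_pM ?mulr_ge0//.
  by rewrite ler_wpM2l.
have h2 : `|2 * A q.1 q.2 * (r * x) ^+ 2| <= 2 * M * (r * N ^+ 2).
  rewrite normrM ler_pM//.
    by rewrite normrM ger0_norm// ler_wpM2l.
  rewrite normrX (@le_trans _ _ ((r * N) ^+ 2))//.
    by rewrite lerXn2r ?nnegrE ?mulr_ge0 ?(ltW r0).
  by rewrite exprMn ler_wpM2r ?sqr_ge0.
have h3 : `|r ^+ 2 * y| <= r * N.
  rewrite normrM ger0_norm ?sqr_ge0// ler_pM ?sqr_ge0//.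
apply: (le_trans (ler_normD _ _)); apply: (@le_trans _ _ (del / 2 + r * stretch)); last lra.
apply: (@le_trans _ _ (del / 2 + 4 * (r * N) * M + 2 * M * (r * N ^+ 2) + r * N)).
  rewrite lerD//; apply: (le_trans (ler_normB _ _)); rewrite lerD//.
  by apply: (le_trans (ler_normB _ _)); rewrite lerD.
rewrite /stretch; nra.
Qed.

(** The substitution follows, to second order, the horizontal curve of the graph through [q]: the
    shear - 4 (r s') phi - 2 A (r s')^2 cancels the drift in the vertical part of [korK]. With s' =
    s / w one has (1 + A^2) s'^2 = s^2, so [korK / r^4] is s^4 + t^2 + O(r), and the Jacobian r^3 /
    w leaves the factor 1 / w. *)
Lemma graph_first_order : exists2 C, 0 <= C &
  forall q r, box (del / 2) q -> 0 < r <= small_radius ->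
  exists2 l, (\int[leb2]_p (bump (korK (graph_pt q) (graph_pt p) / r ^+ 4))%:E =
              (r ^+ 3 * l)%:E)%E &
    `|l - c0 / graph_w q.1 q.2| <= C * r.
Proof.
have M0 := gd_M gd; have d0 := gd_del gd.
pose I := ((R * R) * R * (R * R))%type.
pose D : set I := [set i | box (del / 2) i.1.1 /\ 0 < i.1.2 <= small_radius /\ box N i.2].
pose Aq (i : I) := A i.1.1.1 i.1.1.2.
pose s' (i : I) := i.2.1 / graph_w i.1.1.1 i.1.1.2.
pose ph (i : I) := phi i.1.1.1 i.1.1.2.
pose pt (i : I) : R * R := (i.1.1.1 + i.1.2 * s' i,
  i.1.1.2 - 4 * (i.1.2 * s' i) * ph i - 2 * Aq i * (i.1.2 * s' i) ^+ 2 + i.1.2 ^+ 2 * i.2.2).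
pose xi (i : I) := (phi (pt i).1 (pt i).2 - ph i - Aq i * (i.1.2 * s' i)) / i.1.2 ^+ 2.
have boxd i : D i -> box del i.1.1.
  by move=> [/boxP[h1 h2] _]; apply/boxP; split; lra.
have b_r : bddon D (fun i => i.1.2).
  exists 1 => i [_ [/andP[h1 h2] _]]; rewrite gtr0_norm//.
  by rewrite (le_trans h2)// small_radius_le1.
have b_A : bddon D Aq by exists M => i /boxd; exact: (gd_AM gd).
have s'N i : D i -> `|s' i| <= N.
  move=> [_ [_ /boxP[h _]]]; rewrite /s' normrM normfV.
  rewrite ler_pdivrMr; last by rewrite normr_gt0 gt_eqF// (lt_le_trans ltr01)// graph_w_ge1.
  rewrite (le_trans h)// ler_peMr// (le_trans (graph_w_ge1 i.1.1.1 i.1.1.2))//.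
  exact: ler_norm.
have b_s' : bddon D s' by exists N.
have b_th : bddon D (fun i => i.2.2) by exists N => i [_ [_ /boxP[]]].
have b_sg : bddon D (fun i => i.2.1) by exists N => i [_ [_ /boxP[]]].
have ptd i : D i -> box del (pt i).
  move=> Di; have := Di => -[h1 [h2 /boxP[h3 h4]]].
  by apply: near_box => //; [exact: s'N|apply: graph_phi_le; exact: boxd].
have b_xi : bddon D xi.
  have : bddon D (fun i => M * (s' i ^+ 2 + `|i.2.2 - 2 * Aq i * s' i ^+ 2|)).
    apply: bddonM; first exact: bddon_cst.
    apply: bddonD; first exact: bddonX.
    apply: (@bddon_le _ _ _ _ (fun i => i.2.2 - 2 * Aq i * s' i ^+ 2)).
      by bddon.
    by move=> i Di; rewrite normr_id.
  move/bddon_le; apply => i Di.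
  have r0 : 0 < i.1.2 by have := Di => -[_ [/andP[]]].
  rewrite /xi normrM normfV (ger0_norm (sqr_ge0 i.1.2)) ler_pdivrMr ?exprn_gt0//.
  have := gd_order1 gd (ptd i Di) (boxd i Di).
  rewrite /pt /= -/(ph i) -/(Aq i).
  rewrite (_ : i.1.1.1 + i.1.2 * s' i - i.1.1.1 = i.1.2 * s' i); last by ring.
  move/le_trans; apply; rewrite [`|M * _|]ger0_norm; last first.
    by rewrite mulr_ge0// addr_ge0// sqr_ge0.
  rewrite (_ : _ - _ + _ = (i.2.2 - 2 * Aq i * s' i ^+ 2) * i.1.2 ^+ 2); last by ring.
  rewrite normrM (ger0_norm (sqr_ge0 i.1.2)) exprMn le_eqVlt.
  by apply/orP; left; apply/eqP; ring.
(* The exact remainder in [korK / r^4 = s^4 + t^2 + r Z], established in [KE]; [xi] is the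
   first-order remainder of phi over r^2. *)
pose Z (i : I) := 2 * i.2.1 ^+ 2 * (2 * Aq i * s' i * xi i + i.1.2 * xi i ^+ 2)
  + i.1.2 * (2 * Aq i * s' i * xi i + i.1.2 * xi i ^+ 2) ^+ 2
  + 4 * i.2.2 * s' i * xi i + 4 * i.1.2 * s' i ^+ 2 * xi i ^+ 2.
have [C C0 ZC] : exists2 C, 0 < C & forall i, D i -> `|Z i| <= C.
  by apply: bddon_pos; rewrite /Z; bddon.
(* 3 is the Lipschitz constant of [bump], [4 * N ^+ 2] the area of the box. *)
exists (3 * C * (4 * N ^+ 2)) => [|q r qd r0s].
  by rewrite !mulr_ge0 ?sqr_ge0// ltW.
have /andP[r0 rs] := r0s.
have w1 := graph_w_ge1 q.1 q.2.
have w0 : 0 < graph_w q.1 q.2 by lra.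
pose al := r / graph_w q.1 q.2; have al0 : 0 < al by exact: divr_gt0.
have be0 : 0 < r ^+ 2 by exact: exprn_gt0.
pose k x := q.2 - 4 * (al * x) * phi q.1 q.2 - 2 * A q.1 q.2 * (al * x) ^+ 2.
have mk : measurable_fun setT k.
  apply: measurable_funB; last first.
    by apply: measurable_funM => //; apply: measurable_funX; exact: measurable_funM.
  apply: measurable_funB => //; apply: measurable_funM => //.
  by apply: measurable_funM => //; exact: measurable_funM.
have Ept p : (q.1 + al * p.1, k p.1 + r ^+ 2 * p.2) = pt (q, r, p).
  by rewrite /pt /s' /k /al /= -/(Aq (q, r, p)) /Aq /ph /=; congr pair;
    [field|field]; rewrite gt_eqF.
pose G p := bump (korK (graph_pt q) (graph_pt (q.1 + al * p.1, k p.1 + r ^+ 2 * p.2)) / r ^+ 4).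
have nG : boxnice N G by exact: boxnice_graph.
have KE p : korK (graph_pt q) (graph_pt (pt (q, r, p))) / r ^+ 4 =
    p.1 ^+ 4 + p.2 ^+ 2 + r * Z (q, r, p).
  set i := (q, r, p).
  have phE : phi (pt i).1 (pt i).2 = ph i + Aq i * (r * s' i) + r ^+ 2 * xi i.
    by rewrite /xi /=; field; rewrite gt_eqF.
  have sE : p.1 ^+ 2 = (1 + Aq i ^+ 2) * s' i ^+ 2.
    rewrite /Aq -(graph_w_sqr q.1 q.2) /s' /=; field; rewrite gt_eqF//.
  rewrite /korK /graph_pt /= phE -/(ph i).
  rewrite (_ : q.1 + r * s' i - q.1 = r * s' i); last by ring.
  rewrite (_ : _ - _ + _ = r ^+ 2 * p.2 + 2 * r ^+ 3 * s' i * xi i); last first.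
    by rewrite -/(ph i); ring.
  rewrite (_ : (_ - _) ^+ 2 + _ = r ^+ 2 * (p.1 ^+ 2 +
      r * (2 * Aq i * s' i * xi i + r * xi i ^+ 2))); last by rewrite sE; ring.
  by rewrite /Z /=; field; rewrite gt_eqF.
have G0 p : ~ box N p -> G p = 0.
  move=> npN; apply: contrapT => /eqP /bump_neq0; rewrite Ept => K1.
  apply: npN; move: K1; rewrite ler_pdivrMr ?exprn_gt0// mul1r.
  move=> /(korK_bounds (ltW r0))[_]; rewrite /graph_pt/=.
  rewrite (_ : q.1 + _ - q.1 = r * s' (q, r, p)); last by ring.
  rewrite -/(ph (q, r, p)) (_ : _ - _ + _ = r ^+ 2 * (p.2 - 2 * Aq (q, r, p) * s' (q, r, p) ^+ 2)); last by ring.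
  rewrite (normrM r) (normrM (r ^+ 2)) (gtr0_norm r0) (gtr0_norm be0).
  have rle (x : R) : r * x <= r -> x <= 1 by rewrite -{2}(mulr1 r) ler_pM2l.
  move=> /rle h1; rewrite [3 * _]mulrC ler_pM2l// => h2.
  have Dbox : box del q by case/boxP: qd => ? ?; apply/boxP; split; lra.
  have p1 : `|p.1| <= graph_w q.1 q.2.
    by move: h1; rewrite /s' /= normrM normfV ler_pdivrMr ?normr_gt0 ?gt_eqF// mul1r (gtr0_norm w0).
  have AM : `|Aq (q, r, p)| <= M by exact: (gd_AM gd).
  apply/boxP; split.
    by rewrite (le_trans p1)// (le_trans (graph_w_le Dbox))// /big_box; lra.
  rewrite (_ : p.2 = (p.2 - 2 * Aq (q, r, p) * s' (q, r, p) ^+ 2) + 2 * Aq (q, r, p) * s' (q, r, p) ^+ 2); last by ring.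
  apply: (le_trans (ler_normD _ _)).
  have : `|2 * Aq (q, r, p) * s' (q, r, p) ^+ 2| <= 2 * M * 1.
    rewrite normrM ler_pM//.
      by rewrite normrM ger0_norm// ler_wpM2l.
    by rewrite normrX exprn_ile1.
  by rewrite /big_box; lra.
exists ((graph_w q.1 q.2)^-1 * boxint N G).
  rewrite (ge0_integral_shear q.1 al0 be0 mk); last 2 first.
  - apply/measurable_EFinP; exact: measurable_korK_graph.
  - by move=> p; rewrite lee_fin bump_ge0.
  rewrite (integral_boxint N0 nG G0) -EFinM; congr EFin.
  by rewrite /al; field; rewrite gt_eqF.
have -> : (graph_w q.1 q.2)^-1 * boxint N G - c0 / graph_w q.1 q.2 =
   (graph_w q.1 q.2)^-1 * (boxint N G - c0) by ring.
rewrite normrM ger0_norm ?invr_ge0 ?(ltW w0)//.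
apply: (@le_trans _ _ (1 * `|boxint N G - c0|)).
  by rewrite ler_wpM2r// invf_le1.
rewrite mul1r /c0 (_ : 3 * C * _ * _ = (3 * C * r) * (4 * N ^+ 2)); last by ring.
apply: boxint_close => //; first by boxnice.
move=> p pN; rewrite /G Ept.
have h4 (x : R) : 0 <= x ^+ 4 by rewrite (exprM _ 2 2) sqr_ge0.
apply: (le_trans (bump_lip _ _)).
- by rewrite divr_ge0 ?korK_ge0.
- by rewrite addr_ge0 ?sqr_ge0.
rewrite KE addrAC subrr add0r normrM (gtr0_norm r0) -mulrA ler_wpM2l// mulrC.
rewrite ler_wpM2r ?(ltW r0)//; apply: ZC; split=> //.
Qed.

End graph.

Section graph2.
Context {R : realType}.
Local Notation leb := (@lebesgue_measure R).
Local Notation leb2 := (leb \x leb)%E.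
Variables (phi A : R -> R -> R) (del M a b c d : R).
Hypothesis gd : graph_data phi A del M a b c d.
Local Notation N := (big_box M).
Local Notation graph_pt := (graph_pt phi).
Local Notation graph_w := (graph_w A).
Local Notation r0 := (small_radius del M).
Local Notation c0 := (c0 M).

Let M0 := gd_M gd.
Let N0 : 0 <= N. Proof. by rewrite /big_box; have := M0; lra. Qed.

Lemma support_near (z : R * R * R) p r : box (del / 2) (z.1.2, z.2) -> `|z.1.1| <= M ->
  0 < r <= r0 -> korK z (graph_pt p) <= r ^+ 4 ->
  [/\ box del p, `|p.1 - z.1.2| <= r, `|p.2 - z.2| <= (3 + 4 * M) * r,
      `|phi p.1 p.2 - z.1.1| <= r &
      `|p.2 - z.2 + 4 * (p.1 - z.1.2) * z.1.1| <= 3 * r ^+ 2].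
Proof.
move=> /boxP[/= z1 z2] zM /andP[rp rs] /(korK_bounds (ltW rp))[/= h1 h2 h3].
have r1 : r <= 1 by rewrite (le_trans rs)// small_radius_le1.
have h4 : `|p.2 - z.2| <= (3 + 4 * M) * r.
  rewrite (_ : p.2 - z.2 = (p.2 - z.2 + 4 * (p.1 - z.1.2) * z.1.1)
    - 4 * ((p.1 - z.1.2) * z.1.1)); last by ring.
  apply: (le_trans (ler_normB _ _)); rewrite normrM (ger0_norm (_ : 0 <= 4))//.
  have : `|(p.1 - z.1.2) * z.1.1| <= r * M by rewrite normrM ler_pM.
  have : r ^+ 2 <= r by rewrite expr2 ler_piMr// ltW.
  lra.
have rst : (3 + 4 * M) * r <= del / 2.
  have d0 := gd_del gd.
  have st : 3 + 4 * M <= 1 + N + 4 * N * M + 2 * M * N ^+ 2.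
    have := M0; rewrite /big_box => m0.
    have : 0 <= M * (4 + 2 * M) by rewrite mulr_ge0//; lra.
    have : 0 <= M * (4 + 2 * M) ^+ 2 by rewrite mulr_ge0// sqr_ge0.
    nra.
  have st0 : 0 < 1 + N + 4 * N * M + 2 * M * N ^+ 2 by have := M0; lra.
  apply: (@le_trans _ _ ((1 + N + 4 * N * M + 2 * M * N ^+ 2) * r)).
    by rewrite ler_wpM2r// ltW.
  rewrite mulrC -ler_pdivlMr//.
  by rewrite (le_trans rs)// /small_radius ge_min lexx orbT.
have rr : r <= (3 + 4 * M) * r.
  by rewrite ler_peMl ?(ltW rp)//; have := M0; lra.
split=> //; apply/boxP; split.
  rewrite (_ : p.1 = z.1.2 + (p.1 - z.1.2)); last by ring.
  by apply: (le_trans (ler_normD _ _)); lra.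
rewrite (_ : p.2 = z.2 + (p.2 - z.2)); last by ring.
by apply: (le_trans (ler_normD _ _)); lra.
Qed.

Lemma graph_w_lip p q : box del p -> box del q ->
  `|graph_w p.1 p.2 - graph_w q.1 q.2| <= M * (`|p.1 - q.1| + `|p.2 - q.2|).
Proof.
move=> bp bq; apply: le_trans (gd_Alip gd bp bq).
set x := A p.1 p.2; set y := A q.1 q.2.
have := graph_w_sqr A p.1 p.2; have := graph_w_sqr A q.1 q.2; rewrite -/x -/y.
have := graph_w_ge1 A p.1 p.2; have := graph_w_ge1 A q.1 q.2.
set u := graph_w p.1 p.2; set v := graph_w q.1 q.2 => v1 u1 v2 u2.
have uv : 0 < u + v by lra.
rewrite -(ler_pM2r uv) -{1}(gtr0_norm uv) -normrM.
rewrite (_ : (u - v) * (u + v) = (x - y) * (x + y)); last by rewrite -!subr_sqr; lra.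
rewrite normrM ler_wpM2l//.
have xu : `|x| <= u by rewrite -(@ler_pXn2r _ 2) ?nnegrE// ?real_normK ?num_real//; lra.
have yv : `|y| <= v by rewrite -(@ler_pXn2r _ 2) ?nnegrE// ?real_normK ?num_real//; lra.
by rewrite (le_trans (ler_normD _ _))// lerD.
Qed.

Lemma measurable_graph_w : measurable_fun setT (fun p : R * R => graph_w p.1 p.2).
Proof.
have ms : measurable_fun setT (@Num.sqrt R).
  by apply: continuous_measurable_fun; exact: sqrt_continuous.
apply: (measurableT_comp ms); apply: measurable_funD; first exact: measurable_cst.
apply: measurable_funX; exact: (gd_mA gd).
Qed.

Lemma measurable_weighted y (r : R) : measurable_fun setT
  (fun p : R * R => graph_w p.1 p.2 * bump (korK y (graph_pt p) / r ^+ 4)).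
Proof.
apply: measurable_funM; first exact: measurable_graph_w.
exact: (measurable_korK_graph gd).
Qed.

(** On the support of the kernel w differs by O(r) from its value at [q]. This cancels the factor 1
    / w of [graph_first_order] and makes the limit independent of the centre. *)
Lemma graph_first_order_weighted : exists2 C, 0 <= C &
  forall q r, box (del / 2) q -> 0 < r <= r0 ->
  exists2 l, (\int[leb2]_p (graph_w p.1 p.2 *
                 bump (korK (graph_pt q) (graph_pt p) / r ^+ 4))%:E =
              (r ^+ 3 * l)%:E)%E &
    `|l - c0| <= C * r.
Proof.
have [C C0 H] := graph_first_order gd.
pose L := M * (4 + 4 * M).
have L0 : 0 <= L by rewrite /L mulr_ge0//; have := M0; lra.
have c00 : 0 <= c0 by apply: boxint_ge0 => p _; exact: bump_ge0.
exists ((1 + M) * C + L * (c0 + C)) => [|q r qd r0s].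
  by rewrite addr_ge0// mulr_ge0//; [have := M0; lra|rewrite addr_ge0].
have [l0 Il0 l0c] := H q r qd r0s.
have /andP[rp rs] := r0s.
have qdel : box del q by case/boxP: qd => ? ?; have := gd_del gd; move=> ?; apply/boxP; split; lra.
have wq1 := graph_w_ge1 A q.1 q.2; have wq2 := graph_w_le gd qdel.
set wq := graph_w q.1 q.2 in l0c wq1 wq2.
pose B p := bump (korK (graph_pt q) (graph_pt p) / r ^+ 4).
have mB : measurable_fun setT B by exact: (measurable_korK_graph gd).
have B0 p : 0 <= B p by exact: bump_ge0.
have wB0 p : 0 <= graph_w p.1 p.2 * B p.
  by rewrite mulr_ge0//; have := graph_w_ge1 A p.1 p.2; lra.
have wL p : `|graph_w p.1 p.2 * B p - wq * B p| <= L * r * B p.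
  rewrite -mulrBl normrM (ger0_norm (B0 p)).
  have [->|Bp] := eqVneq (B p) 0; first by rewrite !mulr0.
  rewrite ler_wpM2r//.
  have : korK (graph_pt q) (graph_pt p) <= r ^+ 4.
    by have := bump_neq0 Bp; rewrite ler_pdivrMr ?exprn_gt0// mul1r.
  have q1M : `|(graph_pt q).1.1| <= M by exact: (graph_phi_le gd qdel).
  move=> /(@support_near (graph_pt q) p r)[]//.
  move=> bp h1 h2 _ _; apply: (le_trans (graph_w_lip bp qdel)).
  rewrite /L -mulrA ler_wpM2l//; lra.
have r30 : 0 < r ^+ 3 by rewrite exprn_gt0.
have l00 : 0 <= l0.
  have : (0 <= (r ^+ 3 * l0)%:E)%E by rewrite -Il0; exact: integral_EFin_ge0.
  by rewrite lee_fin pmulr_rge0.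
have IZ x : 0 <= x -> (\int[leb2]_p (x * B p)%:E = (x * (r ^+ 3 * l0))%:E)%E.
  by move=> x0; rewrite EFinM -Il0; exact: integral_EFin_scale.
have mwB : measurable_fun setT (fun p => graph_w p.1 p.2 * B p).
  exact: measurable_weighted.
have mZ x : measurable_fun setT (fun p => x * B p) by exact: measurable_funM.
have Lr0 : 0 <= L * r by rewrite mulr_ge0// ltW.
have up : (\int[leb2]_p (graph_w p.1 p.2 * B p)%:E <= ((wq + L * r) * (r ^+ 3 * l0))%:E)%E.
  rewrite -IZ; last lra.
  apply: integral_EFin_le => //; first exact: mZ.
  by move=> p; have := wL p; rewrite ler_norml => /andP[]; lra.
(* Stated additively, since the integral is still an extended real here. *)
have lo : ((wq * (r ^+ 3 * l0))%:E <=
    \int[leb2]_p (graph_w p.1 p.2 * B p)%:E + (L * r * (r ^+ 3 * l0))%:E)%E.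
  rewrite -IZ; last lra.
  rewrite -IZ// -integral_EFin_add//; last 2 first.
  - exact: mZ.
  - by move=> p; rewrite mulr_ge0.
  apply: integral_EFin_le; first exact: mZ.
  - by apply: measurable_funD; [exact: mwB|exact: mZ].
  - by move=> p; rewrite mulr_ge0//; lra.
  - by move=> p; have := wL p; rewrite ler_norml => /andP[]; lra.
have W0 : (0 <= \int[leb2]_p (graph_w p.1 p.2 * B p)%:E)%E.
  exact: integral_EFin_ge0.
move: up lo W0; case E : (\int[leb2]_p (graph_w p.1 p.2 * B p)%:E)%E => [W| |]//.
rewrite -EFinD !lee_fin => up lo W0.
exists (W / r ^+ 3); first by congr EFin; field; rewrite gt_eqF.
have r1 : r <= 1 by rewrite (le_trans rs)// small_radius_le1.
have up' : W / r ^+ 3 <= (wq + L * r) * l0 by rewrite ler_pdivrMr//; lra.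
have lo' : (wq - L * r) * l0 <= W / r ^+ 3 by rewrite ler_pdivlMr//; lra.
have h1 : `|wq * l0 - c0| <= (1 + M) * C * r.
  rewrite (_ : wq * l0 - c0 = wq * (l0 - c0 / wq)); last by field; rewrite gt_eqF//; lra.
  rewrite normrM ger0_norm; last lra.
  by rewrite -mulrA ler_pM//; lra.
have h2 : l0 <= c0 + C.
  have : c0 / wq <= c0 by rewrite ler_pdivrMr; [rewrite ler_peMr|lra].
  have : C * r <= C by rewrite ler_piMr.
  move: l0c; rewrite ler_norml => /andP[_]; lra.
have h3 : L * r * l0 <= L * (c0 + C) * r.
  by rewrite mulrAC ler_wpM2r ?(ltW rp)// ler_wpM2l.
by move: h1; rewrite ler_norml => /andP[h4 h5]; rewrite ler_norml; apply/andP; split; lra.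
Qed.

End graph2.

Section graph3.
Context {R : realType}.
Local Notation leb := (@lebesgue_measure R).
Local Notation leb2 := (leb \x leb)%E.
Variables (phi A : R -> R -> R) (del M a b c d : R).
Hypothesis gd : graph_data phi A del M a b c d.
Local Notation N := (big_box M).
Local Notation graph_pt := (graph_pt phi).
Local Notation graph_w := (graph_w A).
Local Notation r0 := (small_radius del M).
Local Notation c0 := (c0 M).

Let M0 := gd_M gd.
Let N0 : 0 <= N. Proof. by rewrite /big_box; have := M0; lra. Qed.

Let box0 : box del (0, 0).
Proof. by apply/boxP; rewrite /= normr0; split; exact/ltW/(gd_del gd). Qed.

Lemma graph_phi0 : phi 0 0 = 0.
Proof.
have := gd_order3 gd box0.
by rewrite /= !expr0n/= !mulr0 !addr0 mulr0 subr0 normr_le0 => /eqP.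
Qed.

Lemma graph_A0 : A 0 0 = 0.
Proof.
have := gd_Aorder gd box0.
by rewrite /= !expr0n/= normr0 !mulr0 !addr0 mulr0 subr0 normr_le0 => /eqP.
Qed.

(** At the origin phi and A vanish, so the substitution is the plain dilation (r s, r^2 t), under
    which phi is r^2 h + r^3 k + O(r^4) and A is 2 a r s + O(r^2). *)
Lemma graph_second_order : exists2 C, 0 <= C &
  forall r, 0 < r <= r0 ->
  exists2 l, (\int[leb2]_p (graph_w p.1 p.2 *
                 bump (korK (graph_pt (0, 0)) (graph_pt p) / r ^+ 4))%:E =
              (r ^+ 3 * l)%:E)%E &
    `|l - (c0 + r * boxint N (var1 a b) + r ^+ 2 * boxint N (var2 a b c d))| <= C * r ^+ 3.
Proof.
pose I := (R * (R * R))%type.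
pose D : set I := [set i | 0 < i.1 <= r0 /\ box N i.2].
pose r' (i : I) := i.1; pose s (i : I) := i.2.1; pose t (i : I) := i.2.2.
pose pt (i : I) : R * R := (r' i * s i, r' i ^+ 2 * t i).
pose h i := a * s i ^+ 2 + b * t i.
pose k i := c * s i * t i + d * s i ^+ 3.
pose xi i := (phi (pt i).1 (pt i).2 - (r' i ^+ 2 * h i + r' i ^+ 3 * k i)) / r' i ^+ 4.
pose be i := (A (pt i).1 (pt i).2 - 2 * a * (r' i * s i)) / r' i ^+ 2.
pose F i := h i + r' i * k i + r' i ^+ 2 * xi i.
pose n0 i := s i ^+ 4 + t i ^+ 2.
pose P i := ppart (1 - n0 i).
pose n1 i := 4 * s i * t i * h i.
pose n2 i := 6 * s i ^+ 2 * h i ^+ 2 + 4 * s i * t i * k i.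
(* The exact remainders are nested: [korK / r^4 = n0 + r eta], [eta = n1 + r m], [m = n2 + r ze].
   Below, [ka] and [om'] are the errors of [bump_taylor] and [sqrt1p_approx] over r^3, and [Z] is
   the total remainder over r^3. *)
pose ze i := 4 * s i * t i * xi i + 6 * s i ^+ 2 * (k i + r' i * xi i) * (F i + h i) + r' i * F i ^+ 4.
pose m i := n2 i + r' i * ze i.
pose eta i := n1 i + r' i * m i.
pose bmp i := bump (n0 i + r' i * eta i).
pose ka i := (bmp i - (P i ^+ 3 - 3 * (r' i * eta i) * P i ^+ 2 + 3 * (r' i * eta i) ^+ 2 * P i)) / r' i ^+ 3.
pose al i := 2 * a * s i + r' i * be i.
pose om' i := (graph_w (pt i).1 (pt i).2 - 1 - (r' i * al i) ^+ 2 / 2) / r' i ^+ 3.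
pose om i := 2 * a * s i * be i + r' i * be i ^+ 2 / 2 + om' i.
pose Z1 i := - 3 * ze i * P i ^+ 2 + 3 * P i * (2 * n1 i * m i + r' i * m i ^+ 2) + ka i.
pose B1 i := - 3 * n1 i * P i ^+ 2.
pose B2 i := - 3 * n2 i * P i ^+ 2 + 3 * n1 i ^+ 2 * P i.
pose Z i := Z1 i + 2 * a ^+ 2 * s i ^+ 2 * (B1 i + r' i * B2 i + r' i ^+ 2 * Z1 i) + om i * bmp i.
have rp i : D i -> 0 < r' i by move=> [/andP[]].
have b_r : bddon D r'.
  exists 1 => i [/andP[i0 i1] _]; rewrite gtr0_norm//.
  by rewrite (le_trans i1)// small_radius_le1.
have b_s : bddon D s by exists N => i [_ /boxP[]].
have b_t : bddon D t by exists N => i [_ /boxP[]].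
have ptd i : D i -> box del (pt i).
  move=> [ri /boxP[h1 h2]].
  have b00 : box (del / 2) (0, 0).
    by apply/boxP; rewrite /= normr0; have := gd_del gd; split; lra.
  have := @near_box _ _ _ _ _ _ _ _ _ gd (0, 0) i.1 i.2.1 i.2.2 0 b00 ri h1 h2.
  rewrite /= graph_A0 normr0 => /(_ M0).
  by rewrite !(mulr0, mul0r, oppr0, add0r).
have b_h : bddon D h by rewrite /h; bddon.
have b_k : bddon D k by rewrite /k; bddon.
have b_xi : bddon D xi.
  have : bddon D (fun i => M * (s i ^+ 4 + t i ^+ 2)) by bddon.
  move/bddon_le; apply => i Di; have ri := rp i Di.
  have r4 : 0 < r' i ^+ 4 by rewrite exprn_gt0.
  rewrite /xi normrM normfV (gtr0_norm r4) ler_pdivrMr//.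
  have := gd_order3 gd (ptd i Di); rewrite /=.
  rewrite (_ : a * _ + _ + _ + _ = r' i ^+ 2 * h i + r' i ^+ 3 * k i); last by rewrite /h /k; ring.
  move/le_trans; apply; rewrite [`|M * _|]ger0_norm; last first.
    by rewrite mulr_ge0// addr_ge0 ?sqr_ge0// (exprM _ 2 2) sqr_ge0.
  by rewrite le_eqVlt; apply/orP; left; apply/eqP; ring.
have b_be : bddon D be.
  have : bddon D (fun i => M * (s i ^+ 2 + `|t i|)).
    apply: bddonM; first exact: bddon_cst.
    apply: bddonD; first exact: bddonX.
    by apply: (bddon_le b_t) => i _; rewrite normr_id.
  move/bddon_le; apply => i Di; have ri := rp i Di.
  have r2 : 0 < r' i ^+ 2 by rewrite exprn_gt0.
  rewrite /be normrM normfV (gtr0_norm r2) ler_pdivrMr//.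
  have := gd_Aorder gd (ptd i Di); rewrite /=.
  move/le_trans; apply; rewrite [`|M * _|]ger0_norm; last first.
    by rewrite mulr_ge0// addr_ge0 ?sqr_ge0.
  rewrite normrM (gtr0_norm r2).
  by rewrite le_eqVlt; apply/orP; left; apply/eqP; ring.
have b_F : bddon D F by rewrite /F; bddon.
have b_n0 : bddon D n0 by rewrite /n0; bddon.
have b_P : bddon D P by rewrite /P; bddon.
have b_n1 : bddon D n1 by rewrite /n1; bddon.
have b_n2 : bddon D n2 by rewrite /n2; bddon.
have b_ze : bddon D ze by rewrite /ze; bddon.
have b_m : bddon D m by rewrite /m; bddon.
have b_eta : bddon D eta by rewrite /eta; bddon.
have KE i : D i -> korK (graph_pt (0, 0)) (graph_pt (pt i)) / i.1 ^+ 4 = n0 i + r' i * eta i.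
  move=> Di; have ri := rp i Di.
  have phE : phi (pt i).1 (pt i).2 = r' i ^+ 2 * F i.
    rewrite /F (_ : phi _ _ = r' i ^+ 2 * h i + r' i ^+ 3 * k i + r' i ^+ 4 * xi i); first by ring.
    by rewrite /xi; field; rewrite gt_eqF.
  rewrite -/(r' i) /korK /graph_pt [X in X.1.1]/= [X in X.1.2]/= [X in X.2]/= phE graph_phi0 /=.
  rewrite !subr0 addr0.
  rewrite (_ : _ / _ = (r' i ^+ 2 * F i ^+ 2 + s i ^+ 2) ^+ 2 + (t i + 2 * r' i * s i * F i) ^+ 2); last first.
    by field; rewrite gt_eqF.
  by rewrite /eta /m /ze /n1 /n2 /n0 /F; ring.
have b_bmp : bddon D bmp.
  exists 1 => i Di; rewrite ger0_norm ?bump_ge0// bump_le1// -KE//.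
  by rewrite divr_ge0 ?korK_ge0// exprn_ge0// ltW// rp.
have b_ka : bddon D ka.
  have : bddon D (fun i => eta i ^+ 3) by bddon.
  move/bddon_le; apply => i Di; have ri := rp i Di.
  have r3 : 0 < r' i ^+ 3 by rewrite exprn_gt0.
  rewrite /ka normrM normfV (gtr0_norm r3) ler_pdivrMr//.
  have := bump_taylor (n0 i) (r' i * eta i).
  by move/le_trans; apply; rewrite normrM (gtr0_norm ri) exprMn normrX mulrC.
have b_al : bddon D al by rewrite /al; bddon.
have b_om' : bddon D om'.
  have : bddon D (fun i => r' i * al i ^+ 4) by bddon.
  move/bddon_le; apply => i Di; have ri := rp i Di.
  have r3 : 0 < r' i ^+ 3 by rewrite exprn_gt0.
  rewrite /om' normrM normfV (gtr0_norm r3) ler_pdivrMr//.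
  have AE : A (pt i).1 (pt i).2 = r' i * al i.
    by rewrite /al /be; field; rewrite gt_eqF.
  rewrite /graph_w AE; have := sqrt1p_approx (sqr_ge0 (r' i * al i)).
  move/le_trans; apply; rewrite ger0_norm; last first.
    by rewrite mulr_ge0 ?(ltW ri)// (exprM _ 2 2) sqr_ge0.
  by rewrite le_eqVlt; apply/orP; left; apply/eqP; ring.
have b_om : bddon D om by rewrite /om; bddon.
have b_Z1 : bddon D Z1 by rewrite /Z1; bddon.
have b_B1 : bddon D B1 by rewrite /B1; bddon.
have b_B2 : bddon D B2 by rewrite /B2; bddon.
have [C C0 ZC] : exists2 C, 0 < C & forall i, D i -> `|Z i| <= C.
  by apply: bddon_pos; rewrite /Z; bddon.
exists (C * (4 * N ^+ 2)) => [|r r0s]; first by rewrite !mulr_ge0 ?sqr_ge0// ltW.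
have /andP[rr0 rs] := r0s.
have be0 : 0 < r ^+ 2 by exact: exprn_gt0.
have Ept p : (0 + r * p.1, (fun _ => 0) p.1 + r ^+ 2 * p.2) = pt (r, p) by rewrite /pt /= !add0r.
pose G p := graph_w (pt (r, p)).1 (pt (r, p)).2 *
  bump (korK (graph_pt (0, 0)) (graph_pt (pt (r, p))) / r ^+ 4).
have mG : measurable_fun setT G.
  have mpt : measurable_fun setT (fun p : R * R => (r * p.1, r ^+ 2 * p.2)).
    by apply: measurable_fun_pair; exact: measurable_funM.
  exact: (measurableT_comp (measurable_weighted gd (graph_pt (0, 0)) r) mpt).
have nG : boxnice N G.
  split=> //; exists (1 + M) => p pN.
  have Di : D (r, p) by split.
  rewrite normrM -[leRHS]mulr1 ler_pM//.
    rewrite ger0_norm; first exact: (graph_w_le gd (ptd _ Di)).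
    by have := graph_w_ge1 A (pt (r, p)).1 (pt (r, p)).2; lra.
  rewrite ger0_norm ?bump_ge0// bump_le1// divr_ge0 ?korK_ge0//.
  by rewrite exprn_ge0// ltW.
have G0 p : ~ box N p -> G p = 0.
  move=> npN; rewrite /G [X in _ * X](_ : _ = 0) ?mulr0//.
  apply: contrapT => /eqP /bump_neq0 K1.
  apply: npN; move: K1; rewrite ler_pdivrMr ?exprn_gt0// mul1r.
  move=> /(korK_bounds (ltW rr0))[_]; rewrite /graph_pt/= graph_phi0 !subr0 mulr0 addr0.
  rewrite /r' /s /t /= (normrM r) (normrM (r ^+ 2)) (gtr0_norm rr0) (gtr0_norm be0).
  have rle (x : R) : r * x <= r -> x <= 1 by rewrite -{2}(mulr1 r) ler_pM2l.
  move=> /rle h1; rewrite [3 * _]mulrC ler_pM2l// => h2.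
  by have := M0; move=> m0; apply/boxP; split; rewrite /big_box; lra.
have GE p : box N p ->
    G p = bump (p.1 ^+ 4 + p.2 ^+ 2) + r * var1 a b p + r ^+ 2 * var2 a b c d p + r ^+ 3 * Z (r, p).
  move=> pN; have Di : D (r, p) by split.
  rewrite /G (KE _ Di) -/(bmp (r, p)).
  set i := (r, p) in Di *.
  have wE : graph_w (pt i).1 (pt i).2 = 1 + 2 * a ^+ 2 * s i ^+ 2 * r ^+ 2 + r ^+ 3 * om i.
    by rewrite /om /om' /al /=; field; rewrite gt_eqF.
  have bE : bmp i = P i ^+ 3 + r * B1 i + r ^+ 2 * B2 i + r ^+ 3 * Z1 i.
    have kE : bmp i = P i ^+ 3 - 3 * (r * eta i) * P i ^+ 2
        + 3 * (r * eta i) ^+ 2 * P i + r ^+ 3 * ka i.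
      by rewrite /ka /=; field; rewrite gt_eqF.
    have eE : eta i = n1 i + r * m i by [].
    have mE : m i = n2 i + r * ze i by [].
    have ZE : Z1 i = - 3 * ze i * P i ^+ 2
      + 3 * P i * (2 * n1 i * m i + r * m i ^+ 2) + ka i by [].
    by rewrite kE ZE eE mE /B1 /B2; ring.
  have -> : bump (p.1 ^+ 4 + p.2 ^+ 2) = P i ^+ 3 by [].
  have -> : var1 a b p = B1 i by rewrite /var1 /B1 /P /n0 /n1 /h /s /t /=; ring.
  have -> : var2 a b c d p = B2 i + 2 * a ^+ 2 * s i ^+ 2 * P i ^+ 3.
    by rewrite /var2 /B2 /P /n0 /n1 /n2 /h /k /s /t /=; ring.
  have ZE : Z i = Z1 i + 2 * a ^+ 2 * s i ^+ 2 *
      (B1 i + r * B2 i + r ^+ 2 * Z1 i) + om i * bmp i by [].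
  by rewrite wE ZE bE; ring.
exists (boxint N G).
  have r30 : 0 < r * r ^+ 2 by rewrite mulr_gt0.
  rewrite (@ge0_integral_shear _ 0 r (r ^+ 2) (fun _ => 0))//; last 2 first.
  - by apply/measurable_EFinP; exact: (measurable_weighted gd).
  - move=> p; rewrite lee_fin mulr_ge0 ?bump_ge0//.
    by have := graph_w_ge1 A p.1 p.2; lra.
  rewrite (_ : r ^+ 3 = r * r ^+ 2); last by ring.
  rewrite [RHS]EFinM -(integral_boxint N0 nG G0).
  by congr (_ * _)%E; apply: eq_integral => p _; rewrite /G -Ept.
have nb : boxnice N (fun p => bump (p.1 ^+ 4 + p.2 ^+ 2)) by boxnice.
have n1' : boxnice N (fun p => r * var1 a b p).
  by apply: boxniceM; [exact: boxnice_cst|exact: boxnice_var1].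
have n2' : boxnice N (fun p => r ^+ 2 * var2 a b c d p).
  by apply: boxniceM; [exact: boxnice_cst|exact: boxnice_var2].
rewrite /c0 -!boxintZ//; [|exact: boxnice_var2|exact: boxnice_var1].
rewrite -boxintD// -boxintD//; last exact: boxniceD.
rewrite (_ : C * _ * _ = (C * r ^+ 3) * (4 * N ^+ 2)); last by ring.
apply: boxint_close => //; first by do 2 apply: boxniceD => //.
move=> p pN; rewrite (GE p pN) addrAC subrr add0r normrM gtr0_norm ?exprn_gt0//.
by rewrite mulrC ler_wpM2r ?exprn_ge0 ?(ltW rr0)//; apply: ZC; split.
Qed.

End graph3.

Section boxint_positive.
Context {R : realType}.
Local Notation leb := (@lebesgue_measure R).
Local Notation leb2 := (leb \x leb)%E.

Lemma boxint_gt0 (N e : R) (F : R * R -> R) : 1 <= N -> 0 < e -> boxnice N F ->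
  (forall p, box N p -> 0 <= F p) ->
  (forall p, 1 / 4 <= p.1 <= 1 / 2 -> 1 / 4 <= p.2 <= 1 / 2 -> e <= F p) ->
  0 < boxint N F.
Proof.
move=> N1 e0 nF F0 Fe.
pose S : set (measurableTypeR R * measurableTypeR R) :=
  `[1/4, 1/2]%classic `*` `[1/4, 1/2]%classic.
have mS : measurable S by apply: measurableX; exact: measurable_itv.
have vS : leb2 S = (1 / 16)%:E.
  rewrite /S product_measure1E//= !lebesgue_measure_itv/= lte_fin ifT; last lra.
  by rewrite -!EFinB -EFinM; congr EFin; field.
have SN p : S p -> box N p.
  rewrite /S /= !in_itv/= => -[/andP[h1 h2] /andP[h3 h4]].
  by apply/boxP; rewrite !ger0_norm; lra.
have nS : boxnice N (fun p => e * \1_S p).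
  apply: boxniceM; first exact: boxnice_cst.
  split; first exact: measurable_indic.
  by exists 1 => p _; rewrite /indic; case: (_ \in _); rewrite ?normr1 ?normr0.
have -> : 0 = 0 * (e / 16) by rewrite mul0r.
apply: (@lt_le_trans _ _ (e / 16)); first by rewrite mul0r divr_gt0.
have <- : boxint N (fun p => e * \1_S p) = e / 16.
  apply: EFin_inj; rewrite -integral_boxint//; last 2 first.
  - lra.
  - by move=> p npN; rewrite /indic memNset ?mulr0// => /SN.
  have m1 : measurable_fun setT (\1_S : R * R -> R) by exact: measurable_indic.
  transitivity (e%:E * \int[leb2]_p (\1_S p)%:E)%E.
    apply: integral_EFin_scale => //; first exact: ltW.
  rewrite integral_indic// setIT; transitivity (e%:E * (1 / 16)%:E)%E.
    by congr (_ * _)%E; exact: vS.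
  by rewrite -EFinM; congr EFin; field.
apply: le_boxint => //; first lra.
move=> p pN; rewrite /indic; case: (boolP (p \in S)) => [|_]; last by rewrite mulr0 F0.
by rewrite inE /S /= !in_itv/= => -[h1 h2]; rewrite mulr1 Fe.
Qed.

End boxint_positive.

(** * Layer-cake formula for the kernel *)

Section layer_cake.
Context {R : realType}.
Local Notation leb := (@lebesgue_measure R).
Local Open Scope ereal_scope.

(** Minus the derivative of [bump], cut to [t <= s]. For nonnegative [t] the condition [0 < s]
    removes at most one point, and it keeps the radius s^(1/4) of the corresponding ball
    positive. *)
Definition bump_kernel (t s : R) : R :=
  (3 * ppart (1 - s) ^+ 2 * ((t <= s)%R && (0 < s)%R)%:R)%R.

Lemma bump_kernel_ge0 t s : (0 <= bump_kernel t s)%R.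
Proof. by rewrite /bump_kernel !mulr_ge0// ?ppart_ge0. Qed.

Lemma integral_bump_kernel (t : R) : (0 <= t)%R ->
  \int[leb]_s (bump_kernel t s)%:E = (bump t)%:E.
Proof.
move=> t0.
pose V (s : R) := (- ppart (1 - s) ^+ 3)%R.
pose dV (s : R) := (3 * ppart (1 - s) ^+ 2)%R.
have dVE (s : R) : is_derive s (1%R : R) V (dV s).
  have h1 : is_derive s (1%R : R) (fun x : R => 1 - x)%R (-1)%R.
    by apply: is_derive_eq; ring.
  have := @is_derive1_comp _ (fun t => ppart t ^+ 3)%R (fun t => 1 - t)%R s _ _
    (is_derive_ppart3 (1 - s)%R) h1.
  by move=> h; rewrite /V; apply: is_derive_eq; rewrite /dV; ring.
have cdV : continuous dV by rewrite /dV; contin.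
(* As [t + 1 >= 1], the segment from [t] to [t + 1] already carries all of the weight. *)
have tt : (t < t + 1)%R by lra.
have mdV : measurable_fun setT (fun s => (dV s)%:E).
  by apply/measurable_EFinP; exact: continuous_measurable_fun.
have FTC : \int[leb]_(s in `[t, (t + 1)%R]) (dV s)%:E = (bump t)%:E.
  have cV x : {for x, continuous V}.
    by apply/differentiable_continuous/derivable1_diffP; exact: ex_derive.
  rewrite (@continuous_FTC2 _ dV V)//.
  - rewrite /V /bump -EFinB; congr EFin.
    rewrite [ppart (1 - (t + 1))](_ : _ = 0)%R; first by rewrite expr0n/= oppr0 add0r opprK.
    by rewrite /ppart max_l//; lra.
  - exact: continuous_subspaceT.
  - split.
    + by move=> x _; exact: ex_derive.
    + exact/cvg_at_right_filter/cV.
    + exact/cvg_at_left_filter/cV.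
  - by move=> x _; rewrite derive1E derive_val.
have dV0 s : (1 <= s)%R -> dV s = 0%R.
  by move=> s1; rewrite /dV /ppart max_l ?expr0n ?mulr0//; lra.
have [tp|tn] := ltP 0%R t.
  rewrite -FTC [RHS]integral_mkcond; apply: eq_integral => s _.
  rewrite patchE /bump_kernel.
  case: (boolP (s \in _)); rewrite ?inE/= ?in_itv/=.
    by move=> /andP[h1 h2]; rewrite h1 (lt_le_trans tp h1) mulr1.
  move=> /negP; rewrite inE/= in_itv/= => h.
  case: (leP t s) => ts /=; last by rewrite mulr0.
  rewrite -/(dV s) dV0 ?mul0r//.
  by rewrite leNgt; apply/negP => s1; apply: h; rewrite ts/=; lra.
have {t0 tn tt}t0 : t = 0%R by apply/eqP; rewrite eq_le tn t0.
rewrite -FTC -integral_itv_obnd_cbnd; last exact: measurable_funTS.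
rewrite [RHS]integral_mkcond; apply: eq_integral => s _.
rewrite patchE /bump_kernel t0.
case: (boolP (s \in _)); rewrite ?inE/= ?in_itv/=.
  by move=> /andP[h1 h2]; rewrite h1 (ltW h1) mulr1.
move=> /negP; rewrite inE/= in_itv/= => h.
case: (ltP 0%R s) => ts /=; last by rewrite andbF mulr0.
rewrite -/(dV s) dV0 ?mul0r//.
by rewrite leNgt; apply/negP => s1; apply: h; rewrite ts/=; lra.
Qed.

End layer_cake.

(** * Uniform measures *)

Section ksupp.
Context {R : realType}.
Variable m : {measure set (R * R * R)%type -> \bar R}.

Definition kball (y : R * R * R) (r : R) : set (R * R * R) :=
  [set z | korK y z <= r ^+ 4].

Definition ksupp : set (R * R * R) :=
  [set y | forall r, 0 < r -> (0 < m (kball y r))%E].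

Definition kuniform (c : R) : Prop :=
  forall y r, ksupp y -> 0 < r -> m (kball y r) = (c * r ^+ 3)%:E.

End ksupp.

Section uniform.
Context {R : realType}.
Local Notation leb := (@lebesgue_measure R).
Variable m : {sigma_finite_measure set (R * R * R)%type -> \bar R}.

Lemma measurable_korK (y : R * R * R) : measurable_fun setT (korK y).
Proof.
rewrite /korK.
have m1 : measurable_fun setT (fun z : R * R * R => z.1.1) by exact: measurableT_comp.
have m2 : measurable_fun setT (fun z : R * R * R => z.1.2) by exact: measurableT_comp.
have m3 : measurable_fun setT (fun z : R * R * R => z.2) by exact: measurable_snd.
apply: measurable_funD; apply: measurable_funX.
  by apply: measurable_funD; apply: measurable_funX; exact: measurable_funB.
apply: measurable_funD; first exact: measurable_funB.
apply: measurable_funM; last exact: measurable_funD.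
by apply: measurable_funM => //; exact: measurable_funB.
Qed.

Lemma measurable_kball (y : R * R * R) (r : R) : measurable (kball y r).
Proof.
rewrite /kball (_ : [set z | _] = setT `&` (fun z => korK y z <= r ^+ 4) @^-1` [set true]).
  by apply: measurable_fun_ler => //; exact: measurable_korK.
by rewrite setTI; apply/seteqP; split => z /=.
Qed.

Lemma measurable_bump : measurable_fun setT (@bump R).
Proof.
apply: measurable_funX; apply: measurable_maxr; first exact: measurable_cst.
exact: measurable_funB.
Qed.

Lemma measurable_bumpK (y : R * R * R) (r : R) : measurable_fun setT (fun z => bump (korK y z / r ^+ 4)).
Proof.
apply: (measurableT_comp measurable_bump).
by apply: measurable_funM => //; exact: measurable_korK.
Qed.

Let root4 (s : R) : R := Num.sqrt (Num.sqrt s).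

Let root4_exp (s : R) : 0 < s -> root4 s ^+ 4 = s.
Proof. by move=> s0; rewrite (exprM _ 2 2) !sqr_sqrtr ?sqrtr_ge0// ltW. Qed.

Let root4_gt0 (s : R) : 0 < s -> 0 < root4 s.
Proof. by move=> s0; rewrite !sqrtr_gt0. Qed.

(** The integral of the unit kernel centred on the support, layer by layer: layer [s] is a ball of
    radius s^(1/4). It may be infinite a priori; [integral_bump_uniform] rules this out. *)
Definition profile (c : R) : \bar R :=
  (\int[leb]_s (3 * ppart (1 - s) ^+ 2 * ((0 : R) < s)%R%:R * (c * root4 s ^+ 3))%:E)%E.

(** By Tonelli the layers come outside. The set where [korK] is at most s r^4 is the ball of radius
    s^(1/4) r, of mass c (s^(1/4) r)^3 whatever its centre in the support. *)
Lemma integral_bump_profile (c : R) y r : 0 <= c -> kuniform m c -> ksupp m y -> 0 < r ->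
  (\int[m]_z (bump (korK y z / r ^+ 4))%:E = (r ^+ 3)%:E * profile c)%E.
Proof.
move=> c0 mu sy r0.
have r4 : 0 < r ^+ 4 by exact: exprn_gt0.
pose F (q : (R * R * R) * measurableTypeR R) : \bar R :=
  (bump_kernel (korK y q.1 / r ^+ 4) q.2)%:E.
have mF : measurable_fun setT F.
  apply/measurable_EFinP; apply: measurable_funM.
    apply: measurable_funM; first exact: measurable_cst.
    apply: measurable_funX; apply: measurable_maxr; first exact: measurable_cst.
    by apply: measurable_funB; [exact: measurable_cst|exact: measurable_snd].
  have mm : measurable_fun setT (fun b : bool => b%:R : R) by [].
  apply: (measurableT_comp mm); apply: measurable_and.
    apply: measurable_fun_ler; last exact: measurable_snd.
    apply: measurable_funM; last exact: measurable_cst.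
    by apply: (measurableT_comp (measurable_korK y)); exact: measurable_fst.
  by apply: measurable_fun_ltr; [exact: measurable_cst|exact: measurable_snd].
have F0 q : (0 <= F q)%E by rewrite lee_fin bump_kernel_ge0.
transitivity (\int[m]_z \int[leb]_s F (z, s))%E.
  apply: eq_integral => z _; rewrite /F /= integral_bump_kernel//.
  by rewrite divr_ge0 ?korK_ge0// ltW.
rewrite (@fubini_tonelli _ _ _ _ R m leb F mF F0).
have mX : measurable_fun setT (fun s : measurableTypeR R =>
    (3 * ppart (1 - s) ^+ 2 * ((0 : R) < s)%R%:R * (c * root4 s ^+ 3))%:E).
  apply/measurable_EFinP; apply: measurable_funM.
    apply: measurable_funM.
      apply: measurable_funM; first exact: measurable_cst.
      apply: measurable_funX; apply: measurable_maxr; first exact: measurable_cst.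
      exact: measurable_funB.
    have mm : measurable_fun setT (fun b : bool => b%:R : R) by [].
    by apply: (measurableT_comp mm); exact: measurable_fun_ltr.
  have ms : measurable_fun setT (@Num.sqrt R).
    by apply: continuous_measurable_fun; exact: sqrt_continuous.
  apply: measurable_funM; first exact: measurable_cst.
  apply: measurable_funX; exact: (measurableT_comp ms ms).
rewrite /profile -ge0_integralZl//; last 2 first.
- move=> s _; rewrite lee_fin !mulr_ge0// ?ppart_ge0// ?exprn_ge0 ?sqrtr_ge0//.
- by rewrite lee_fin exprn_ge0// ltW.
apply: eq_integral => s _; rewrite /F /bump_kernel /=.
have [s0|s0] := ltP 0 s; last first.
  rewrite integral0_eq; first by rewrite mulr0 mul0r mule0.
  by move=> z _; rewrite andbF mulr0.
have k0 : 0 <= 3 * ppart (1 - s) ^+ 2 by rewrite !mulr_ge0 ?ppart_ge0.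
transitivity (\int[m]_z ((3 * ppart (1 - s) ^+ 2) * \1_(kball y (root4 s * r)) z)%:E)%E.
  apply: eq_integral => z _; congr (_ * _)%:E; rewrite andbT /indic; congr ((nat_of_bool _)%:R).
  rewrite ler_pdivrMr//; apply/idP/idP; rewrite inE /kball /= exprMn root4_exp//.
rewrite integral_EFin_scale//; last 1 first.
- by apply: measurable_indic; exact: measurable_kball.
rewrite integral_indic ?setIT//; last exact: measurable_kball.
transitivity ((3 * ppart (1 - s) ^+ 2)%:E * (c * (root4 s * r) ^+ 3)%:E)%E.
  by congr (_ * _)%E; apply: mu => //; rewrite mulr_gt0// root4_gt0.
by rewrite -!EFinM; congr EFin; set P := ppart _; set q := root4 s; rewrite !mulr1n; ring.
Qed.

(** The constant is not evaluated, only located in ]0, +oo[: [bump] is at most the indicator of the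
    unit ball and, since (1/2)^4 is below 1/2, at least 1/8 of that of the ball of radius 1/2. *)
Lemma integral_bump_uniform (c : R) y0 : 0 < c -> kuniform m c -> ksupp m y0 ->
  exists2 C, 0 < C & forall y r, ksupp m y -> 0 < r ->
  (\int[m]_z (bump (korK y z / r ^+ 4))%:E = (C * r ^+ 3)%:E)%E.
Proof.
move=> c0 mu s0.
have E := integral_bump_profile (ltW c0) mu s0 ltr01.
rewrite (expr1n _ 3) mul1e in E.
have I1 r : 0 < r -> (\int[m]_z (\1_(kball y0 r) z)%:E = (c * r ^+ 3)%:E)%E.
  move=> r0; rewrite integral_indic ?setIT//; last exact: measurable_kball.
  exact: mu.
have up : (profile c <= c%:E)%E.
  rewrite -E; apply: (@le_trans _ _ (\int[m]_z (\1_(kball y0 1) z)%:E)%E).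
    apply: integral_EFin_le.
    - exact: measurable_bumpK.
    - by apply: measurable_indic; exact: measurable_kball.
    - by move=> z; exact: bump_ge0.
    - move=> z; rewrite expr1n divr1 /indic; case: (boolP (z \in _)) => [_|].
        by rewrite bump_le1// korK_ge0.
      rewrite notin_setE /kball /= expr1n => /negP; rewrite -ltNge => /ltW h.
      by rewrite bump_eq0.
  by rewrite I1// expr1n mulr1.
have lo : ((8^-1 * (c * (1 / 2) ^+ 3))%:E <= profile c)%E.
  rewrite -E EFinM -I1//.
  rewrite -integral_EFin_scale//; last by apply: measurable_indic; exact: measurable_kball.
  apply: integral_EFin_le.
  - by apply: measurable_funM => //; apply: measurable_indic; exact: measurable_kball.
  - exact: measurable_bumpK.
  - by move=> z; rewrite mulr_ge0.
  - move=> z; rewrite expr1n divr1 /indic; case: (boolP (z \in _)) => [|_]; last first.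
      by rewrite mulr0 bump_ge0.
    rewrite inE /kball /= => h; rewrite mulr1; apply: bump_half.
    by apply: (le_trans h); rewrite expr_div_n expr1n !exprS expr0; lra.
case P : (profile c) => [C| |]; move: up lo; rewrite P//.
rewrite !lee_fin => up lo; exists C.
  by apply: lt_le_trans lo; rewrite !mulr_gt0// exprn_gt0.
by move=> y r sy r0; rewrite (integral_bump_profile (ltW c0) mu sy r0) P -EFinM mulrC.
Qed.

End uniform.

Lemma measurable_korK_pair (R : realType) d (T : measurableType d)
    (f g : T -> R * R * R) : measurable_fun setT f -> measurable_fun setT g ->
  measurable_fun setT (fun x => korK (f x) (g x)).
Proof.
have m1 : measurable_fun setT (fun z : R * R * R => z.1.1) by exact: measurableT_comp.
have m2 : measurable_fun setT (fun z : R * R * R => z.1.2) by exact: measurableT_comp.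
have m3 : measurable_fun setT (fun z : R * R * R => z.2) by exact: measurable_snd.
move=> mf mg.
have f1 := measurableT_comp m1 mf; have f2 := measurableT_comp m2 mf.
have f3 := measurableT_comp m3 mf; have g1 := measurableT_comp m1 mg.
have g2 := measurableT_comp m2 mg; have g3 := measurableT_comp m3 mg.
rewrite /korK; apply: measurable_funD; apply: measurable_funX.
  by apply: measurable_funD; apply: measurable_funX; exact: measurable_funB.
apply: measurable_funD; first exact: measurable_funB.
apply: measurable_funM; last exact: measurable_funD.
by apply: measurable_funM => //; exact: measurable_funB.
Qed.

(** * Averages over the graph and Lipschitz test functions *)

Section graph4.
Context {R : realType}.
Local Notation leb := (@lebesgue_measure R).
Local Notation leb2 := (leb \x leb)%E.
Variables (phi A : R -> R -> R) (del M a b c d : R).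
Hypothesis gd : graph_data phi A del M a b c d.
Local Notation graph_pt := (graph_pt phi).
Local Notation graph_w := (graph_w A).
Local Notation r0 := (small_radius del M).
Implicit Types (z : R * R * R) (q p : R * R) (r rho : R).

Let M0 := gd_M gd.
Let d0 := gd_del gd.

Lemma measurable_graph_pt : measurable_fun setT graph_pt.
Proof.
apply: measurable_fun_pair; last exact: measurable_snd.
by apply: measurable_fun_pair; [exact: (gd_mphi gd)|exact: measurable_fst].
Qed.

Lemma measurable_bump_joint r : measurable_fun setT
  (fun x : (R * R * R) * (R * R) => bump (korK x.1 (graph_pt x.2) / r ^+ 4)).
Proof.
apply: (measurableT_comp (@measurable_bump R)).
apply: measurable_funM => //; apply: measurable_korK_pair; first exact: measurable_fst.
exact: (measurableT_comp measurable_graph_pt).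
Qed.

(** For an arbitrary point [z] only the linear shear along the horizontal line through [z] is
    available. It still confines the support to the box of half-width 3, of area 36. The bound is
    what dominates in [graph_identity]. *)
Lemma graph_average z r : 0 < r ->
  exists2 l, 0 <= l <= 36 &
    (\int[leb2]_p (bump (korK z (graph_pt p) / r ^+ 4))%:E = (r ^+ 3 * l)%:E)%E.
Proof.
move=> rp; have be0 : 0 < r ^+ 2 by exact: exprn_gt0.
pose k x := z.2 - 4 * (r * x) * z.1.1.
have mk : measurable_fun setT k.
  apply: measurable_funB => //; apply: measurable_funM => //.
  by apply: measurable_funM => //; exact: measurable_funM.
pose G p := bump (korK z (graph_pt (z.1.2 + r * p.1, k p.1 + r ^+ 2 * p.2)) / r ^+ 4).
have nG : boxnice 3 G.
  split; first by have [] := boxnice_graph gd z r r (r ^+ 2) z.1.2 mk.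
  exists 1 => p _; rewrite ger0_norm ?bump_ge0// bump_le1//.
  by rewrite divr_ge0 ?korK_ge0// exprn_ge0// ltW.
have G0 p : ~ box 3 p -> G p = 0.
  move=> npN; apply: contrapT => /eqP /bump_neq0 K1.
  apply: npN; move: K1; rewrite ler_pdivrMr ?exprn_gt0// mul1r.
  move=> /(korK_bounds (ltW rp))[_]; rewrite /graph_pt/=.
  rewrite (_ : z.1.2 + _ - z.1.2 = r * p.1); last by ring.
  rewrite (_ : _ - _ + _ = r ^+ 2 * p.2); last by rewrite /k; ring.
  rewrite (normrM r) (normrM (r ^+ 2)) (gtr0_norm rp) (gtr0_norm be0).
  have rle (x : R) : r * x <= r -> x <= 1 by rewrite -{2}(mulr1 r) ler_pM2l.
  move=> /rle h1; rewrite [3 * _]mulrC ler_pM2l// => h2.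
  by apply/boxP; split; lra.
exists (boxint 3 G).
  apply/andP; split; first by apply: boxint_ge0 => p _; exact: bump_ge0.
  have -> : (36 : R) = boxint 3 (fun _ => 1) by rewrite boxint_cst//; lra.
  apply: le_boxint => //; first exact: boxnice_cst.
  by move=> p _; rewrite bump_le1// divr_ge0 ?korK_ge0// exprn_ge0// ltW.
rewrite (ge0_integral_shear z.1.2 rp be0 mk); last 2 first.
- apply/measurable_EFinP; exact: (measurable_korK_graph gd).
- by move=> p; rewrite lee_fin bump_ge0.
rewrite (integral_boxint _ nG G0)// -EFinM; congr EFin; ring.
Qed.

Definition near_radius : R :=
  Num.min (Num.min r0 (1 / 2)) (del / 8 / (3 + 4 * M)).

Lemma near_radius_gt0 : 0 < near_radius.
Proof.
have h := small_radius_gt0 gd; have m0 := M0; have dd := d0.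
by rewrite /near_radius lt_min lt_min h/= !divr_gt0//; lra.
Qed.

Lemma near_radius_le r : r <= near_radius ->
  [/\ r <= r0, r <= 1 / 2 & (3 + 4 * M) * r <= del / 8].
Proof.
rewrite /near_radius le_min le_min => /andP[/andP[h1 h2] h3]; split=> //.
by rewrite mulrC -ler_pdivlMr//; have := M0; lra.
Qed.

Definition near_region z : Prop := box (del / 2) (z.1.2, z.2) /\ `|z.1.1| <= M.

Lemma korK_displacement z z' r : `|z.1.1| <= M -> 0 < r <= near_radius ->
  korK z z' <= r ^+ 4 ->
  [/\ `|z'.1.1 - z.1.1| <= r, `|z'.1.2 - z.1.2| <= r,
      `|z'.2 - z.2| <= (3 + 4 * M) * r, r <= del / 8 & (3 + 4 * M) * r <= del / 8].
Proof.
move=> zM /andP[rp /near_radius_le[rs r2 r3]] /(korK_bounds (ltW rp))[h1 h2 h3].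
have m0 := M0.
have rr : r <= (3 + 4 * M) * r by rewrite ler_peMl ?(ltW rp)//; lra.
split=> //; last lra.
rewrite (_ : z'.2 - z.2 = (z'.2 - z.2 + 4 * (z'.1.2 - z.1.2) * z.1.1)
    - 4 * ((z'.1.2 - z.1.2) * z.1.1)); last by ring.
apply: (le_trans (ler_normB _ _)); rewrite normrM (ger0_norm (_ : 0 <= 4))//.
have : `|(z'.1.2 - z.1.2) * z.1.1| <= r * M by rewrite normrM ler_pM.
have : r ^+ 2 <= r by rewrite expr2 ler_piMr ?(ltW rp)//; lra.
lra.
Qed.

(** Room is spent in two steps, one for each of the two kernels: (eta, tau) goes from [del / 4] to
    [3 * del / 8] and then to [del / 2], and phi from M - 1 to M - 1/2 and then to M. This fixes the
    terms of [near_radius]. *)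
Lemma near_region_graph q z rho : box (del / 4) q -> 0 < rho <= near_radius ->
  korK (graph_pt q) z <= rho ^+ 4 ->
  box (3 * del / 8) (z.1.2, z.2) /\ `|z.1.1| <= M - 1 / 2.
Proof.
move=> /boxP[q1 q2] rh hK.
have bq : box del q by have dd := d0; apply/boxP; split; lra.
have qM : `|phi q.1 q.2| + 1 <= M by exact: (gd_phiM gd bq).
have qM' : `|(graph_pt q).1.1| <= M by exact: (graph_phi_le gd bq).
have [/= h1 h2 h3 h4 h5] := korK_displacement qM' rh hK.
have /andP[_ /near_radius_le[_ rh2 _]] := rh.
split.
  apply/boxP => /=; split.
    rewrite (_ : z.1.2 = q.1 + (z.1.2 - q.1)); last by ring.
    by apply: (le_trans (ler_normD _ _)); lra.
  rewrite (_ : z.2 = q.2 + (z.2 - q.2)); last by ring.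
  by apply: (le_trans (ler_normD _ _)); lra.
rewrite (_ : z.1.1 = phi q.1 q.2 + (z.1.1 - phi q.1 q.2)); last by ring.
by apply: (le_trans (ler_normD _ _)); lra.
Qed.

Lemma near_region1 q z rho : box (del / 4) q -> 0 < rho <= near_radius ->
  korK (graph_pt q) z <= rho ^+ 4 -> near_region z.
Proof.
move=> bq rh /(near_region_graph bq rh)[/boxP[/= h1 h2] h3].
by have dd := d0; split; [apply/boxP; split|]; rewrite /=; lra.
Qed.

Lemma near_region2 q z z' rho r : box (del / 4) q -> 0 < rho <= near_radius ->
  0 < r <= near_radius ->
  korK (graph_pt q) z <= rho ^+ 4 -> korK z z' <= r ^+ 4 -> near_region z'.
Proof.
move=> bq rh rr hq hz; have [/boxP[/= h1 h2] h3] := near_region_graph bq rh hq.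
have zM : `|z.1.1| <= M by lra.
have [g1 g2 g3 g4 g5] := korK_displacement zM rr hz.
have /andP[_ /near_radius_le[_ r2 _]] := rr.
split; [apply/boxP; split => /=|].
- rewrite (_ : z'.1.2 = z.1.2 + (z'.1.2 - z.1.2)); last by ring.
  by apply: (le_trans (ler_normD _ _)); lra.
- rewrite (_ : z'.2 = z.2 + (z'.2 - z.2)); last by ring.
  by apply: (le_trans (ler_normD _ _)); lra.
- rewrite (_ : z'.1.1 = z.1.1 + (z'.1.1 - z.1.1)); last by ring.
  by apply: (le_trans (ler_normD _ _)); lra.
Qed.

(** The weight w, extended constantly in phi, cancels the denominator of the limit c0 / w of the
    graph averages. *)
Definition test_fun y rho z : R := graph_w z.1.2 z.2 * bump (korK y z / rho ^+ 4).

Lemma test_fun_ge0 y rho z : 0 <= test_fun y rho z.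
Proof.
by rewrite /test_fun mulr_ge0 ?bump_ge0//; have := graph_w_ge1 A z.1.2 z.2; lra.
Qed.

Lemma test_fun_neq0 y rho z : 0 < rho -> test_fun y rho z != 0 -> korK y z <= rho ^+ 4.
Proof.
move=> rh; rewrite mulf_eq0 negb_or => /andP[_ /bump_neq0].
by rewrite ler_pdivrMr ?exprn_gt0// mul1r.
Qed.

Lemma measurable_test_fun y rho : measurable_fun setT (test_fun y rho).
Proof.
apply: measurable_funM; last exact: measurable_bumpK.
have mp : measurable_fun setT (fun z : R * R * R => (z.1.2, z.2)).
  by apply: measurable_fun_pair; [exact: measurableT_comp|exact: measurable_snd].
exact: (measurableT_comp (measurable_graph_w gd) mp).
Qed.

Lemma test_fun_lip y rho : 0 < rho -> exists2 L, 0 <= L &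
  forall r z z', 0 < r <= near_radius -> korK z z' <= r ^+ 4 ->
    near_region z -> near_region z' ->
    `|test_fun y rho z - test_fun y rho z'| <= L * r.
Proof.
move=> rh.
pose I := ((R * R * R) * (R * R * R) * R)%type.
pose D : set I := [set i | 0 < i.2 <= near_radius /\ korK i.1.1 i.1.2 <= i.2 ^+ 4
  /\ near_region i.1.1 /\ near_region i.1.2].
pose x1 (i : I) := i.1.1.1.1; pose x2 (i : I) := i.1.1.1.2; pose x3 (i : I) := i.1.1.2.
pose y1 (i : I) := i.1.2.1.1; pose y2 (i : I) := i.1.2.1.2; pose y3 (i : I) := i.1.2.2.
pose e1 i := (y1 i - x1 i) / i.2.
pose e2 i := (y2 i - x2 i) / i.2.
pose e3 i := (y3 i - x3 i) / i.2.
have dd := d0; have m0 := M0.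
have b_x1 : bddon D x1 by exists M => i [_ [_ [[_ ?] _]]].
have b_x2 : bddon D x2 by exists (del / 2) => i [_ [_ [[/boxP[? ?] _] _]]].
have b_x3 : bddon D x3 by exists (del / 2) => i [_ [_ [[/boxP[? ?] _] _]]].
have b_y1 : bddon D y1 by exists M => i [_ [_ [_ [_ ?]]]].
have b_y2 : bddon D y2 by exists (del / 2) => i [_ [_ [_ [/boxP[? ?] _]]]].
have b_y3 : bddon D y3 by exists (del / 2) => i [_ [_ [_ [/boxP[? ?] _]]]].
have disp i : D i -> [/\ 0 < i.2, `|y1 i - x1 i| <= i.2, `|y2 i - x2 i| <= i.2
    & `|y3 i - x3 i| <= (3 + 4 * M) * i.2].
  move=> [ri [Ki [[_ xM] _]]]; have [h1 h2 h3 _ _] := korK_displacement xM ri Ki.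
  by have /andP[] := ri.
have b_e1 : bddon D e1.
  exists 1 => i /disp[ri h _ _]; rewrite /e1 normrM normfV (gtr0_norm ri).
  by rewrite ler_pdivrMr// mul1r.
have b_e2 : bddon D e2.
  exists 1 => i /disp[ri _ h _]; rewrite /e2 normrM normfV (gtr0_norm ri).
  by rewrite ler_pdivrMr// mul1r.
have b_e3 : bddon D e3.
  exists (3 + 4 * M) => i /disp[ri _ _ h]; rewrite /e3 normrM normfV (gtr0_norm ri).
  by rewrite ler_pdivrMr.
pose U i := (x1 i - y.1.1) ^+ 2 + (x2 i - y.1.2) ^+ 2.
pose U' i := (y1 i - y.1.1) ^+ 2 + (y2 i - y.1.2) ^+ 2.
pose V i := x3 i - y.2 + 2 * (x2 i - y.1.2) * (x1 i + y.1.1).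
pose V' i := y3 i - y.2 + 2 * (y2 i - y.1.2) * (y1 i + y.1.1).
(* The difference quotient of the polynomial [korK y]; [e1], [e2], [e3] are the displacements over
   r, bounded by [korK_displacement]. *)
pose Q i := (e1 i * (y1 i + x1 i - 2 * y.1.1) + e2 i * (y2 i + x2 i - 2 * y.1.2)) * (U' i + U i)
  + (e3 i + 2 * (e2 i * (y1 i + y.1.1) + (x2 i - y.1.2) * e1 i)) * (V' i + V i).
have [C C0 QC] : exists2 C, 0 < C & forall i, D i -> `|Q i| <= C.
  by apply: bddon_pos; rewrite /Q /U /U' /V /V'; bddon.
have rh4 : 0 < rho ^+ 4 by exact: exprn_gt0.
exists (M * (4 + 4 * M) + (1 + M) * (3 * (C / rho ^+ 4))) => [|r z z' rr Kz nz nz'].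
  have h1 : 0 <= C / rho ^+ 4 by rewrite divr_ge0 ?ltW.
  by apply: addr_ge0; apply: mulr_ge0 => //; lra.
have Di : D (z, z', r) by [].
have [rp h1 h2 h3] := disp _ Di; rewrite /= in rp.
have QE : korK y z' - korK y z = r * Q (z, z', r).
  rewrite /Q /e1 /e2 /e3 /U /U' /V /V' /korK /x1 /x2 /x3 /y1 /y2 /y3 /=.
  by field; rewrite gt_eqF.
have bz : box del (z.1.2, z.2).
  by case: nz => /boxP[/= g1 g2] _; apply/boxP; split => /=; lra.
have bz' : box del (z'.1.2, z'.2).
  by case: nz' => /boxP[/= g1 g2] _; apply/boxP; split => /=; lra.
rewrite /test_fun.
set w := graph_w z.1.2 z.2; set w' := graph_w z'.1.2 z'.2.
set B := bump _; set B' := bump _.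
rewrite (_ : _ - _ = (w - w') * B + w' * (B - B')); last by ring.
apply: (le_trans (ler_normD _ _)); rewrite [leRHS]mulrDl lerD//.
  rewrite normrM -[leRHS]mulr1 ler_pM//; last first.
    by rewrite ger0_norm ?bump_ge0// bump_le1// divr_ge0 ?korK_ge0// ltW.
  have := graph_w_lip gd bz bz'; rewrite /= -/w -/w' => /le_trans; apply.
  rewrite -mulrA ler_wpM2l//.
  by rewrite distrC [X in _ + X]distrC; move: h2 h3; rewrite /x2 /y2 /x3 /y3 /=; lra.
rewrite normrM -[leRHS]mulrA ler_pM//.
  rewrite ger0_norm; first exact: (graph_w_le gd bz').
  by have := graph_w_ge1 A z'.1.2 z'.2; rewrite -/w'; lra.
apply: (le_trans (bump_lip _ _)).
- by rewrite divr_ge0 ?korK_ge0// ltW.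
- by rewrite divr_ge0 ?korK_ge0// ltW.
rewrite -mulrA ler_wpM2l// -mulrBl normrM normfV (gtr0_norm rh4) -[leRHS]mulrA.
rewrite [_^-1 * r]mulrC mulrA ler_wpM2r ?invr_ge0 ?(ltW rh4)//.
rewrite distrC QE normrM (gtr0_norm rp) mulrC ler_wpM2r ?(ltW rp)//.
exact: QC.
Qed.

End graph4.

(** * Identification of the measure on the graph *)

Section identity.
Context {R : realType}.
Local Notation leb := (@lebesgue_measure R).
Local Notation leb2 := (leb \x leb)%E.
Variables (phi A : R -> R -> R) (del M a b c d : R).
Hypothesis gd : graph_data phi A del M a b c d.
Local Notation graph_pt := (graph_pt phi).
Local Notation graph_w := (graph_w A).
Local Notation near_radius := (near_radius del M).
Local Notation near_region := (near_region del M).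
Local Notation test_fun := (test_fun A).
Local Notation c0 := (c0 M).
Variable m : {sigma_finite_measure set (R * R * R)%type -> \bar R}.
Variable C : R.
Hypothesis C0 : 0 < C.
Hypothesis HC : forall y r, ksupp m y -> 0 < r ->
  (\int[m]_z (bump (korK y z / r ^+ 4))%:E = (C * r ^+ 3)%:E)%E.
Hypothesis gsupp : forall p, box del p -> ksupp m (graph_pt p).
Implicit Types (z : R * R * R) (q p : R * R) (r rho : R).

Let M0 := gd_M gd.
Let d0 := gd_del gd.

Definition on_graph : set (R * R * R) := [set z | z.1.1 = phi z.1.2 z.2].

Lemma measurable_on_graph : measurable on_graph.
Proof.
rewrite /on_graph (_ : [set z | _] =
    setT `&` (fun z => z.1.1 == phi z.1.2 z.2) @^-1` [set true]); last first.
  by rewrite setTI; apply/seteqP; split => z /= /eqP.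
apply: measurable_fun_eqr => //; first exact: measurableT_comp.
have mp : measurable_fun setT (fun z : R * R * R => (z.1.2, z.2)).
  by apply: measurable_fun_pair; [exact: measurableT_comp|exact: measurable_snd].
exact: (measurableT_comp (gd_mphi gd) mp).
Qed.

Definition average r z : R :=
  fine (\int[leb2]_p (bump (korK z (graph_pt p) / r ^+ 4))%:E)%E / r ^+ 3.

Lemma averageE r z : 0 < r ->
  (\int[leb2]_p (bump (korK z (graph_pt p) / r ^+ 4))%:E = (r ^+ 3 * average r z)%:E)%E.
Proof.
move=> rp; rewrite /average; have [l _ ->] := graph_average gd z rp.
by rewrite /=; congr EFin; field; rewrite gt_eqF.
Qed.

Lemma average_bounds r z : 0 < r -> 0 <= average r z <= 36.
Proof.
move=> rp; rewrite /average; have [l lb ->] := graph_average gd z rp.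
by rewrite /= mulrC mulKf// gt_eqF// exprn_gt0.
Qed.

Lemma measurable_average r : measurable_fun setT (average r).
Proof.
apply: measurable_funM => //; apply: (measurableT_comp (fine_measurable measurableT)).
pose F (x : (R * R * R) * (measurableTypeR R * measurableTypeR R)) : \bar R :=
  (bump (korK x.1 (graph_pt x.2) / r ^+ 4))%:E.
have mF : measurable_fun setT F.
  by apply/measurable_EFinP; exact: (measurable_bump_joint gd).
have F0 x : (0 <= F x)%E by rewrite lee_fin bump_ge0.
exact: (@measurable_fun_fubini_tonelli_F _ _ _ _ R (@plane_measure R) F mF F0).
Qed.

(** By [gd_order1], phi at a graph point within distance r of [z] differs by O(r) from phi at the
    projection of [z]. Such a point thus puts [z.1.1] within [K * r] of the graph. *)
Lemma off_graph_gap z : near_region z -> ~ on_graph z ->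
  exists2 e, 0 < e & forall r p, 0 < r <= near_radius -> r < e ->
    ~ korK z (graph_pt p) <= r ^+ 4.
Proof.
move=> [bz zM] nz; have m0 := M0; have dd := d0.
pose K := 1 + M + M * (1 + (3 + 4 * M) + 4 * M).
have K1 : 0 < K.
  have : 0 <= M * (1 + (3 + 4 * M) + 4 * M) by apply: mulr_ge0 => //; lra.
  by rewrite /K; lra.
have gap : 0 < `|z.1.1 - phi z.1.2 z.2| by rewrite normr_gt0 subr_eq0; apply/eqP.
exists (`|z.1.1 - phi z.1.2 z.2| / K) => [|r p rr re hK]; first exact: divr_gt0.
have /andP[rp rn] := rr.
have [rs r2 _] := near_radius_le gd rn.
have rs' : 0 < r <= small_radius del M by rewrite rp.
have [bp h1 h2 h3 h4] := support_near gd bz zM rs' hK.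
have bz' : box del (z.1.2, z.2).
  by case/boxP: bz => /= ? ?; apply/boxP; rewrite /=; lra.
have := gd_order1 gd bp bz'; rewrite /= => h5.
have Az := gd_AM gd bz'; rewrite /= in Az.
have fz := graph_phi_le gd bz'; rewrite /= in fz.
have h6 : `|A z.1.2 z.2 * (p.1 - z.1.2)| <= M * r by rewrite normrM ler_pM.
have h7 : `|p.2 - z.2 + 4 * (p.1 - z.1.2) * phi z.1.2 z.2| <= (3 + 4 * M) * r + 4 * (r * M).
  apply: (le_trans (ler_normD _ _)); rewrite lerD// -mulrA normrM ger0_norm//.
  by rewrite ler_wpM2l// normrM ler_pM.
have h8 : (p.1 - z.1.2) ^+ 2 <= r.
  rewrite -real_normK ?num_real// expr2 (@le_trans _ _ (r * 1))//; last lra.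
  by rewrite ler_pM//; lra.
have h9 : `|phi p.1 p.2 - phi z.1.2 z.2| <= M * r + M * (r + ((3 + 4 * M) * r + 4 * (r * M))).
  rewrite (_ : _ - _ = (phi p.1 p.2 - phi z.1.2 z.2 - A z.1.2 z.2 * (p.1 - z.1.2))
     + A z.1.2 z.2 * (p.1 - z.1.2)); last by ring.
  apply: (le_trans (ler_normD _ _)); rewrite addrC lerD// (le_trans h5)//.
  by rewrite ler_wpM2l// lerD.
have : `|z.1.1 - phi z.1.2 z.2| <= K * r.
  rewrite (_ : z.1.1 - _ = - (phi p.1 p.2 - z.1.1) + (phi p.1 p.2 - phi z.1.2 z.2)); last by ring.
  apply: (le_trans (ler_normD _ _)); rewrite normrN.
  by apply: (le_trans (lerD h3 h9)); rewrite /K; lra.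
by move: re; rewrite ltr_pdivlMr// mulrC => /lt_le_trans h /h; rewrite ltxx.
Qed.

Lemma average_off_graph z : near_region z -> ~ on_graph z ->
  exists2 e, 0 < e & forall r, 0 < r <= near_radius -> r < e -> average r z = 0.
Proof.
move=> nz zg; have [e e0 He] := off_graph_gap nz zg; exists e => // r rr re.
rewrite /average integral0_eq ?mul0r// => p _; congr EFin.
apply: contrapT => /eqP /bump_neq0.
have /andP[rp _] := rr; rewrite ler_pdivrMr ?exprn_gt0// mul1r.
exact: (He _ _ rr re).
Qed.

Section fixed_center.
Variables (q : R * R) (rho : R).
Hypothesis bq : box (del / 4) q.
Hypothesis rhob : 0 < rho <= near_radius.
Let y := graph_pt q.
Let f := test_fun y rho.
Let rhop : 0 < rho. Proof. by case/andP: rhob. Qed.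

Let bqd : box del q.
Proof. by have dd := d0; case/boxP: bq => ? ?; apply/boxP; split; lra. Qed.

(** On the graph the weight turns the limit c0 / w into c0; off it the average is eventually 0. The
    rate depends on [z], which dominated convergence tolerates. *)
Lemma average_pointwise z : exists K, forall r, 0 < r <= near_radius ->
  `|f z * average r z - c0 * (bump (korK y z / rho ^+ 4) * \1_on_graph z)| <= K * r.
Proof.
have [fz0|fz0] := eqVneq (f z) 0.
  exists 0 => r _; rewrite fz0 !mul0r.
  have /eqP := fz0; rewrite /f /test_fun mulf_eq0 => /orP[/eqP w0|/eqP ->].
    by have := graph_w_ge1 A z.1.2 z.2; rewrite w0; lra.
  by rewrite mul0r mulr0 subr0 normr0.
have nz : near_region z by apply: (near_region1 gd bq rhob); exact: (test_fun_neq0 rhop fz0).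
have f0 : 0 <= f z by exact: test_fun_ge0.
have [zg|zg] := pselect (on_graph z); last first.
  have [e e0 He] := average_off_graph nz zg.
  (* Below [e] the average is 0; from [e] on, the bound 36 is at most (36 / e) r. *)
  exists (f z * (36 / e)) => r rr; rewrite /indic memNset// !mulr0 subr0.
  rewrite normrM (ger0_norm f0) -mulrA ler_wpM2l//.
  have /andP[rp _] := rr; have /andP[l0 l1] := average_bounds z rp.
  rewrite ger0_norm//; have [re|re] := ltP r e.
    by rewrite He// mulr_ge0 ?divr_ge0 ?ltW.
  apply: (le_trans l1); rewrite mulrAC -mulrA ler_peMr//.
  by rewrite ler_pdivlMr// mul1r.
have [K K0 HK] := graph_first_order gd.
exists (f z * K) => r rr.
have /andP[rp /(near_radius_le gd)[rs _ _]] := rr.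
have rs' : 0 < r <= small_radius del M by rewrite rp.
have bz : box (del / 2) (z.1.2, z.2) by case: nz.
have zE : z = graph_pt (z.1.2, z.2).
  by rewrite /graph_pt/= -zg; case: (z) => -[].
have [l lE lb] := HK _ _ bz rs'.
have lE' : average r z = l.
  have := averageE z rp; rewrite {1}zE lE => -[] h.
  have r3 : r ^+ 3 != 0 by rewrite gt_eqF// exprn_gt0.
  by apply: (mulfI r3); rewrite -h.
rewrite lE' /indic mem_set// mulr1.
have w1 := graph_w_ge1 A z.1.2 z.2.
rewrite (_ : _ - _ = f z * (l - c0 / graph_w z.1.2 z.2)); last first.
  by rewrite /f /test_fun; field; rewrite gt_eqF//; lra.
by rewrite normrM (ger0_norm f0) -mulrA ler_wpM2l.
Qed.

(** Tonelli moves the integral over [m] inside. There, for [p] in the box, the kernel is centred at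
    a point of the support and integrates to C r^3, while on its support [f] differs from
    [f (graph_pt p)] by at most L r. *)
Lemma test_integral_bound : exists2 K, 0 <= K & forall r W, 0 < r <= near_radius ->
  (\int[leb2]_p (f (graph_pt p))%:E = W%:E)%E ->
  exists2 I, (\int[m]_z (f z * average r z)%:E = I%:E)%E & `|I - C * W| <= K * r.
Proof.
have [L L0 HL] := test_fun_lip gd y rhop.
exists (L * C * (4 * del ^+ 2)) => [|r W rr WE].
  by rewrite mulr_ge0 ?mulr_ge0 ?(ltW C0) ?(ltW d0).
have /andP[rp _] := rr; have r3 : 0 < r ^+ 3 by exact: exprn_gt0.
pose B z p := bump (korK z (graph_pt p) / r ^+ 4).
have B0 z p : 0 <= B z p by exact: bump_ge0.
have f0 z : 0 <= f z by exact: test_fun_ge0.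
have mf : measurable_fun setT f by exact: (measurable_test_fun gd).
have mBz p : measurable_fun setT (B ^~ p).
  apply: (measurableT_comp (@measurable_bump R)); apply: measurable_funM => //.
  by apply: measurable_korK_pair => //; exact: measurable_cst.
pose F (x : (R * R * R) * (measurableTypeR R * measurableTypeR R)) : \bar R :=
  (f x.1 * B x.1 x.2)%:E.
have mF : measurable_fun setT F.
  apply/measurable_EFinP; apply: measurable_funM; last exact: (measurable_bump_joint gd).
  by apply: (measurableT_comp mf); exact: measurable_fst.
have F0 x : (0 <= F x)%E by rewrite lee_fin mulr_ge0.
have fB0 z p : 0 <= f z * B z p := mulr_ge0 (f0 z) (B0 z p).
have mfB p : measurable_fun setT (fun z => f z * B z p) by exact: measurable_funM.
have mcB x p : measurable_fun setT (fun z => x * B z p) by exact: measurable_funM.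
have cB0 x z p : 0 <= x -> 0 <= x * B z p by move=> x0; exact: (mulr_ge0 x0 (B0 z p)).
have Bneq z p : B z p != 0 -> korK z (graph_pt p) <= r ^+ 4.
  by move=> /bump_neq0; rewrite ler_pdivrMr ?exprn_gt0// mul1r.
have intB p : box del p -> (\int[m]_z (B z p)%:E = (C * r ^+ 3)%:E)%E.
  move=> bp; rewrite -(HC (gsupp bp) rp); apply: eq_integral => z _.
  by rewrite /B korK_sym.
(* Confines the error L r to the box, where [intB] holds. Outside the box the supports of [f] and of
   the kernel are disjoint and the inner integral is 0. *)
pose S p : R := \1_(box del : set (measurableTypeR R * measurableTypeR R)) p.
have mS : measurable_fun setT S by apply: measurable_indic; exact: measurable_box.
have S0 p : 0 <= S p by rewrite /S /indic.
pose T := (\int[leb2]_p \int[m]_z F (z, p))%E.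
have TE : (\int[m]_z (f z * average r z)%:E = ((r ^+ 3)^-1)%:E * T)%E.
  rewrite /T -(@fubini_tonelli _ _ _ _ R m (@plane_measure R) F mF F0).
  rewrite -ge0_integralZl//; last 3 first.
  - exact: (@measurable_fun_fubini_tonelli_F _ _ _ _ R (@plane_measure R) F mF F0).
  - by move=> z _; apply: integral_ge0 => p _; exact: F0.
  - by rewrite lee_fin invr_ge0 ltW.
  apply: eq_integral => z _; rewrite /F /=.
  transitivity (((r ^+ 3)^-1)%:E * ((f z)%:E * \int[leb2]_p (B z p)%:E))%E.
    by rewrite averageE// -!EFinM; congr EFin; field; rewrite gt_eqF.
  congr (_ * _)%E; apply/esym; apply: integral_EFin_scale => //.
  by apply: (measurable_korK_graph gd).
have rn3 : 0 <= C * r ^+ 3 by rewrite mulr_ge0 ?(ltW C0) ?(ltW r3).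
have Lr : 0 <= L * r by rewrite mulr_ge0 ?(ltW rp).
have up p : (\int[m]_z F (z, p) <= ((f (graph_pt p) + L * r * S p) * (C * r ^+ 3))%:E)%E.
  have [bp|bp] := pselect (box del p); last first.
    rewrite integral0_eq.
      rewrite lee_fin; exact: (mulr_ge0 (addr_ge0 (f0 _) (mulr_ge0 Lr (S0 p))) rn3).
    move=> z _.
    rewrite /F /=; have [->|Bn] := eqVneq (B z p) 0; first by rewrite mulr0.
    have [->|fn] := eqVneq (f z) 0; first by rewrite mul0r.
    exfalso; apply: bp.
    have [/boxP[/= ? ?] _] := near_region2 gd bq rhob rr (test_fun_neq0 rhop fn) (Bneq _ _ Bn).
    by have dd := d0; apply/boxP; split; lra.
  rewrite /S /indic mem_set// mulr1 EFinM -(intB p bp) -integral_EFin_scale//; last first.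
    by rewrite addr_ge0.
  apply: integral_EFin_le.
  - exact: mfB.
  - exact: mcB.
  - by move=> z; exact: fB0.
  move=> z /=; have [->|Bn] := eqVneq (B z p) 0; first by rewrite !mulr0.
  rewrite ler_wpM2r//; have [->|fn] := eqVneq (f z) 0; first by rewrite addr_ge0.
  have n1 := near_region1 gd bq rhob (test_fun_neq0 rhop fn).
  have n2 := near_region2 gd bq rhob rr (test_fun_neq0 rhop fn) (Bneq _ _ Bn).
  by have := HL r z (graph_pt p) rr (Bneq _ _ Bn) n1 n2; rewrite -/f ler_norml => /andP[]; lra.
have lo p : ((f (graph_pt p) * (C * r ^+ 3))%:E <=
    \int[m]_z F (z, p) + (L * r * S p * (C * r ^+ 3))%:E)%E.
  have [fn|fn] := eqVneq (f (graph_pt p)) 0.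
    rewrite fn mul0r adde_ge0//; last first.
      rewrite lee_fin; exact: (mulr_ge0 (mulr_ge0 Lr (S0 p)) rn3).
    by apply: integral_ge0 => z _; exact: F0.
  have np := near_region1 gd bq rhob (test_fun_neq0 rhop fn).
  have bp : box del p.
    by case: np => /boxP[/= ? ?] _; have dd := d0; apply/boxP; split; lra.
  have E1 x : 0 <= x -> ((x * (C * r ^+ 3))%:E = \int[m]_z (x * B z p)%:E)%E.
    by move=> x0; rewrite integral_EFin_scale// intB.
  rewrite /S /indic mem_set// mulr1 (E1 (f (graph_pt p)))// (E1 (L * r))//.
  rewrite /F -integral_EFin_add//; last 2 first.
  - exact: mfB.
  - by move=> z; exact: cB0.
  apply: integral_EFin_le.
  - exact: mcB.
  - by apply: measurable_funD; [exact: mfB|exact: mcB].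
  - by move=> z; exact: cB0.
  move=> z /=; have [->|Bn] := eqVneq (B z p) 0; first by rewrite !mulr0 addr0.
  rewrite -mulrDl ler_wpM2r//.
  have hz : korK (graph_pt p) z <= r ^+ 4 by rewrite korK_sym; exact: Bneq.
  have n2 := near_region2 gd bq rhob rr (test_fun_neq0 rhop fn) hz.
  by have := HL r (graph_pt p) z rr hz np n2; rewrite -/f ler_norml => /andP[]; lra.
have mfg : measurable_fun setT (fun p => f (graph_pt p)).
  exact: (measurableT_comp mf (measurable_graph_pt gd)).
have intS : (\int[leb2]_p (S p)%:E = (4 * del ^+ 2)%:E)%E.
  rewrite integral_indic ?setIT//; last exact: measurable_box.
  by apply: box_volume; exact: ltW d0.
have mT : measurable_fun setT (fun p : measurableTypeR R * measurableTypeR R =>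
    \int[m]_z F (z, p))%E.
  exact: (@measurable_fun_fubini_tonelli_G _ _ _ _ R m F mF F0).
have T0 p : (0 <= \int[m]_z F (z, p))%E by apply: integral_ge0 => z _; exact: F0.
have mSL : measurable_fun setT (fun p => L * r * S p) by apply: measurable_funM.
have LS0 p : 0 <= L * r * S p := mulr_ge0 Lr (S0 p).
have f0' p : 0 <= f (graph_pt p) := f0 _.
have upT : (T <= ((W + L * r * (4 * del ^+ 2)) * (C * r ^+ 3))%:E)%E.
  apply: (@le_trans _ _ (\int[leb2]_p
      ((C * r ^+ 3) * (f (graph_pt p) + L * r * S p))%:E)%E).
    apply: ge0_le_integral => //.
    - apply/measurable_EFinP; apply: measurable_funM => //.
      exact: measurable_funD.
    - by move=> p _; rewrite [_ * (_ + _)]mulrC; exact: up.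
  rewrite integral_EFin_scale//; last 2 first.
  - exact: measurable_funD.
  - by move=> p; exact: (addr_ge0 (f0' p) (LS0 p)).
  rewrite integral_EFin_add//.
  rewrite (@integral_EFin_scale _ (measurableTypeR R * measurableTypeR R)%type R _ (L * r) S mS Lr S0) intS WE.
  by rewrite -[((L * r)%:E * _)%E]EFinM -EFinD -EFinM mulrC.
have loT : ((W * (C * r ^+ 3))%:E <= T + (L * r * (4 * del ^+ 2) * (C * r ^+ 3))%:E)%E.
  have -> : ((L * r * (4 * del ^+ 2) * (C * r ^+ 3))%:E =
      \int[leb2]_p ((C * r ^+ 3) * (L * r * S p))%:E)%E.
    rewrite (@integral_EFin_scale _ (measurableTypeR R * measurableTypeR R)%type R _ (C * r ^+ 3) _ mSL rn3 LS0).
    rewrite (@integral_EFin_scale _ (measurableTypeR R * measurableTypeR R)%type R _ (L * r) S mS Lr S0) intS.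
    by rewrite -!EFinM mulrC.
  have -> : ((W * (C * r ^+ 3))%:E = \int[leb2]_p ((C * r ^+ 3) * f (graph_pt p))%:E)%E.
    rewrite (@integral_EFin_scale _ (measurableTypeR R * measurableTypeR R)%type R _ (C * r ^+ 3) _ mfg rn3 f0') WE.
    by rewrite -EFinM mulrC.
  rewrite /T -ge0_integralD//; last 2 first.
  - by move=> p _; rewrite lee_fin; exact: (mulr_ge0 rn3 (LS0 p)).
  - by apply/measurable_EFinP; apply: measurable_funM.
  apply: ge0_le_integral => //.
  - by move=> p _; rewrite lee_fin; exact: (mulr_ge0 rn3 (f0' p)).
  - by apply/measurable_EFinP; apply: measurable_funM.
  - apply: emeasurable_funD => //.
    by apply/measurable_EFinP; apply: measurable_funM.
  - by move=> p _; rewrite mulrC [(_ * _) * (_ * _ * _)]mulrC; exact: lo.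
have T00 : (0 <= T)%E by apply: integral_ge0 => p _; exact: T0.
move: TE upT loT T00; case: T => [t| |]//; rewrite -EFinM -EFinD !lee_fin => TE upT loT t0.
exists ((r ^+ 3)^-1 * t) => //.
set X := (r ^+ 3)^-1 * t.
have tE : t = X * r ^+ 3 by rewrite /X; field; rewrite gt_eqF.
have h1 : X <= (W + L * r * (4 * del ^+ 2)) * C.
  by rewrite -(ler_pM2r r3) -tE; lra.
have h2 : (W - L * r * (4 * del ^+ 2)) * C <= X.
  by rewrite -(ler_pM2r r3) -tE; lra.
by rewrite ler_norml; apply/andP; split; lra.
Qed.

(** One limit computed twice: pointwise by dominated convergence, and through [test_integral_bound].
    The dominating function [36 * f] is integrable because [f] is at most 1 + M times a kernel of
    integral C rho^3. *)
Theorem graph_identity W :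
  (\int[leb2]_p (f (graph_pt p))%:E = W%:E)%E ->
  (\int[m]_z (c0 * (bump (korK y z / rho ^+ 4) * \1_on_graph z))%:E = (C * W)%:E)%E.
Proof.
move=> WE.
have n0 : 0 < near_radius := near_radius_gt0 gd.
pose r_ (n : nat) : R := near_radius / n.+1%:R.
have r_b n : 0 < r_ n <= near_radius.
  rewrite /r_ divr_gt0//= ler_pdivrMr// ler_peMr ?(ltW n0)//.
  by rewrite ler1n.
have r_cvg (K : R) : K * r_ n @[n --> \oo] --> (0 : R).
  rewrite -(mulr0 K); apply: cvgM; first exact: cvg_cst.
  rewrite -(mulr0 near_radius); apply: cvgM; first exact: cvg_cst.
  exact: cvg_harmonic.
have squeeze (u : nat -> R) (l K : R) : (forall n, `|u n - l| <= K * r_ n) ->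
    u n @[n --> \oo] --> l.
  move=> h; apply/cvgrPdist_le => e e0; near=> n.
  rewrite distrC (le_trans (h n))//; near: n.
  have := r_cvg K => /cvgrPdist_le/(_ e e0).
  by apply: filterS => n; rewrite sub0r normrN => /ler_normlW.
have f0 z : 0 <= f z by exact: test_fun_ge0.
have mf : measurable_fun setT f by exact: (measurable_test_fun gd).
have sy : ksupp m y by apply: gsupp; exact: bqd.
have [K K0 HK] := test_integral_bound.
pose g n z : \bar R := (f z * average (r_ n) z)%:E.
pose h z : \bar R := (c0 * (bump (korK y z / rho ^+ 4) * \1_on_graph z))%:E.
have mg n : measurable_fun setT (g n).
  by apply/measurable_EFinP; apply: measurable_funM => //; exact: measurable_average.
have mh : measurable_fun setT h.
  apply/measurable_EFinP; apply: measurable_funM => //; apply: measurable_funM.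
    exact: measurable_bumpK.
  by apply: measurable_indic; exact: measurable_on_graph.
have gh z : g n z @[n --> \oo] --> h z.
  have [Kz HKz] := average_pointwise z.
  apply: cvg_EFin; first by near=> n.
  by apply: (squeeze _ _ Kz) => n; exact: HKz.
have fle z : f z <= (1 + M) * bump (korK y z / rho ^+ 4).
  have b0 := bump_ge0 (korK y z / rho ^+ 4).
  rewrite /f /test_fun; have [->|bn] := eqVneq (bump (korK y z / rho ^+ 4)) 0.
    by rewrite !mulr0.
  rewrite ler_wpM2r//.
  have hK : korK y z <= rho ^+ 4.
    by have := bump_neq0 bn; rewrite ler_pdivrMr ?exprn_gt0// mul1r.
  have [/boxP[/= h1 h2] _] := near_region1 gd bq rhob hK.
  have dd := d0; apply: (graph_w_le gd (p := (z.1.2, z.2))).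
  by apply/boxP; rewrite /=; lra.
have m1 : 0 <= 1 + M by have := M0; lra.
have If : (\int[m]_z (36 * f z)%:E < +oo)%E.
  rewrite integral_EFin_scale//.
  apply: (@le_lt_trans _ _ (36%:E * ((1 + M)%:E * (C * rho ^+ 3)%:E))%E).
    rewrite lee_wpmul2l ?lee_fin//.
    rewrite -(HC sy rhop) -integral_EFin_scale//; last 2 first.
    + exact: measurable_bumpK.
    + by move=> z; exact: bump_ge0.
    apply: integral_EFin_le => //.
    by apply: measurable_funM => //; exact: measurable_bumpK.
  by rewrite -!EFinM ltry.
have ig : m.-integrable setT (fun z => (36 * f z)%:E).
  apply/integrableP; split; first by apply/measurable_EFinP; apply: measurable_funM.
  rewrite (eq_integral (fun z => (36 * f z)%:E))// => z _.
  by rewrite gee0_abs// lee_fin mulr_ge0.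
have absg n z : (`|g n z| <= (36 * f z)%:E)%E.
  have /andP[l0 l1] := average_bounds z (proj1 (andP (r_b n))).
  rewrite /g gee0_abs ?lee_fin; last exact: (mulr_ge0 (f0 z) l0).
  by rewrite mulrC ler_wpM2r.
have ae1 : {ae m, forall z, setT z -> g ^~ z @ \oo --> h z}.
  by apply: aeW => z _; exact: gh.
have ae2 : {ae m, forall z n, setT z -> (`|g n z| <= (36 * f z)%:E)%E}.
  by apply: aeW => z n _; exact: absg.
have [_ _ D] := dominated_convergence measurableT mg mh ae1 ig ae2.
have D2 : (\int[m]_z g n z)%E @[n --> \oo] --> (C * W)%:E.
  have [I_ HI] : exists I_ : nat -> R, forall n, (\int[m]_z g n z = (I_ n)%:E)%E /\
      `|I_ n - C * W| <= K * r_ n.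
    suff : forall n, exists I0 : R, (\int[m]_z g n z = I0%:E)%E /\
      `|I0 - C * W| <= K * r_ n by move=> /choice[I_ HI]; exists I_.
    by move=> n; have [I0 E1 E2] := HK (r_ n) W (r_b n) WE; exists I0.
  rewrite (_ : (fun n => _) = EFin \o I_); last by apply/funext => n; rewrite (proj1 (HI n)).
  apply: cvg_EFin; first by near=> n.
  by apply: (squeeze _ _ K) => n; have [] := HI n.
exact: (cvg_unique _ D D2).
Unshelve. all: by end_near. Qed.

End fixed_center.
End identity.

(** * The complement of the support is negligible *)

Section support_conegligible.
Context {R : realType}.
Variable m : {measure set (R * R * R)%type -> \bar R}.
Implicit Types z : R * R * R.

Lemma korK_small z (r : R) : 0 < r -> exists2 e, 0 < e & forall z',
  `|z'.1.1 - z.1.1| <= e -> `|z'.1.2 - z.1.2| <= e -> `|z'.2 - z.2| <= e ->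
  korK z z' <= r ^+ 4.
Proof.
move=> r0; pose K := 4 + (3 + 4 * `|z.1.1|) ^+ 2.
have K0 : 0 < K by rewrite ltr_pwDl// sqr_ge0.
have r4 : 0 < r ^+ 4 by exact: exprn_gt0.
exists (Num.min 1 (r ^+ 4 / K)); first by rewrite lt_min ltr01 divr_gt0.
move=> z'; rewrite !le_min => /andP[x1 x2] /andP[y1 y2] /andP[t1 t2].
pose e := Num.min 1 (r ^+ 4 / K).
have e1 : e <= 1 by rewrite ge_min lexx.
have e2 : e * K <= r ^+ 4 by rewrite -ler_pdivlMr// ge_min lexx orbT.
have e0 : 0 <= e by rewrite le_min ler01 divr_ge0 ?ltW.
have xe : `|z'.1.1 - z.1.1| <= e by rewrite le_min x1 x2.
have ye : `|z'.1.2 - z.1.2| <= e by rewrite le_min y1 y2.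
have te : `|z'.2 - z.2| <= e by rewrite le_min t1 t2.
apply: le_trans e2.
have sq (x u : R) : `|x| <= u -> x ^+ 2 <= u ^+ 2.
  move=> xu; rewrite -real_normK ?num_real// lerXn2r ?nnegrE//.
  exact: le_trans (normr_ge0 x) xu.
rewrite /korK; apply: (@le_trans _ _ ((2 * e ^+ 2) ^+ 2 + (e * (3 + 4 * `|z.1.1|)) ^+ 2)).
  rewrite lerD//; apply: (sq _ _).
    rewrite ger0_norm ?addr_ge0 ?sqr_ge0//.
    by have := sq _ _ xe; have := sq _ _ ye; lra.
  rewrite (_ : z'.1.1 + z.1.1 = (z'.1.1 - z.1.1) + 2 * z.1.1); last by ring.
  apply: (le_trans (ler_normD _ _)).
  have : `|2 * (z'.1.2 - z.1.2) * (z'.1.1 - z.1.1 + 2 * z.1.1)| <= 2 * e * (1 + 2 * `|z.1.1|).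
    rewrite normrM ler_pM//; first by rewrite normrM ger0_norm// ler_wpM2l.
    apply: (le_trans (ler_normD _ _)); rewrite lerD// normrM ger0_norm//.
  by lra.
rewrite /K (_ : (2 * e ^+ 2) ^+ 2 = 4 * e ^+ 2 * e ^+ 2); last by ring.
rewrite exprMn.
have ee : e ^+ 2 <= e by rewrite expr2 ler_piMl.
have ee1 : 4 * e ^+ 2 * e ^+ 2 <= 4 * e.
  rewrite -mulrA ler_wpM2l// (le_trans _ ee)// ler_piMl ?sqr_ge0//.
  exact: (le_trans ee).
rewrite mulrDr lerD//; first by rewrite [leRHS]mulrC.
by rewrite ler_wpM2r ?sqr_ge0.
Qed.

Let qbox (i : rat * rat * rat * nat) : set (R * R * R) :=
  [set z | [/\ `|z.1.1 - ratr i.1.1.1| <= i.2.+1%:R^-1,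
               `|z.1.2 - ratr i.1.1.2| <= i.2.+1%:R^-1 &
               `|z.2 - ratr i.1.2| <= i.2.+1%:R^-1]].

Let measurable_qbox i : measurable (qbox i).
Proof.
have mabs (f : R * R * R -> R) (q k : R) : measurable_fun setT f ->
    measurable [set z | `|f z - q| <= k].
  move=> mf; rewrite (_ : [set z | _] = setT `&` (fun z => `|f z - q| <= k) @^-1` [set true]).
    apply: measurable_fun_ler => //; apply: measurableT_comp => //.
    exact: measurable_funB.
  by rewrite setTI; apply/seteqP; split => z /=.
rewrite (_ : qbox i = [set z | `|z.1.1 - ratr i.1.1.1| <= i.2.+1%:R^-1] `&`
    [set z | `|z.1.2 - ratr i.1.1.2| <= i.2.+1%:R^-1] `&`
    [set z | `|z.2 - ratr i.1.2| <= i.2.+1%:R^-1]); last first.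
  by apply/seteqP; split => z [h1]; [move=> h2 h3|case: h1].
apply: measurableI; first apply: measurableI; apply: mabs.
- exact: (measurableT_comp measurable_fst).
- exact: (measurableT_comp measurable_snd).
- exact: measurable_snd.
Qed.

Let rat_near (x e : R) : 0 < e -> exists q : rat, `|x - ratr q| <= e.
Proof.
move=> e0; have xe : x - e < x + e by lra.
have [q] := rat_in_itvoo xe; rewrite in_itv/= => /andP[h1 h2].
by exists q; rewrite ler_norml; apply/andP; split; lra.
Qed.

(** Rational boxes form a countable family, so the null ones have a null union; every point off the
    support lies in one of them. *)
Lemma ksupp_conegligible : m.-negligible (~` ksupp m).
Proof.
(* Enumeration through [unpickle]; integers coding no box, and boxes of positive mass, are sent to
   the empty set. *)
pose F n : set (R * R * R) := if unpickle n is Some i then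
  (if m (qbox i) == 0%E then qbox i else set0) else set0.
have nF n : m.-negligible (F n).
  rewrite /F; case: (unpickle n) => [i|]; last exact: negligible_set0.
  by case: ifPn => [/eqP i0|_]; [exact/(negligibleP _ (measurable_qbox i))|exact: negligible_set0].
apply: negligibleS (negligible_bigcup nF) => z /= zs.
have [r r0 mr] : exists2 r, 0 < r & m (kball z r) = 0%E.
  apply: contrapT => h; apply: zs => r r0; rewrite lt_neqAle measure_ge0 andbT.
  by apply/eqP => /esym mr; apply: h; exists r.
have [e e0 He] := korK_small z r0.
have [n ne] : exists n : nat, n.+1%:R^-1 <= e / 2 :> R.
  exists (Num.bound (e / 2)^-1); rewrite invf_ple ?posrE ?divr_gt0//.
  have : (e / 2)^-1 < (Num.bound (e / 2)^-1)%:R.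
    by apply: archi_boundP; rewrite invr_ge0 divr_ge0 ?ltW.
  by move=> /ltW /le_trans; apply; rewrite ler_nat.
have n0 : 0 < n.+1%:R^-1 :> R by rewrite invr_gt0.
have [q1 h1] := rat_near z.1.1 n0; have [q2 h2] := rat_near z.1.2 n0.
have [q3 h3] := rat_near z.2 n0.
pose i : rat * rat * rat * nat := (q1, q2, q3, n).
have mi : m (qbox i) = 0%E.
  apply/eqP; rewrite -measure_le0 -mr le_measure ?inE//; first exact: measurable_kball.
  move=> z' [/= g1 g2 g3].
  have tri (x y u : R) : `|x - u| <= n.+1%:R^-1 -> `|y - u| <= n.+1%:R^-1 -> `|y - x| <= e.
    move=> hx hy; rewrite (_ : y - x = (y - u) - (x - u)); last by ring.
    apply: (le_trans (ler_normB _ _)); rewrite [e]splitr lerD//.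
      exact: le_trans hy ne.
    exact: le_trans hx ne.
  by apply: He; [exact: tri h1 g1|exact: tri h2 g2|exact: tri h3 g3].
have zi : qbox i z by split.
move: (i) mi zi => {}i mi zi.
by exists (pickle i); [exact: I|rewrite /F pickleK mi eqxx].
Qed.

End support_conegligible.

(** * Exclusion of mass off the graph and vanishing of the second variation *)

Section core.
Context {R : realType}.
Local Notation leb := (@lebesgue_measure R).
Local Notation leb2 := (leb \x leb)%E.
Variables (phi A : R -> R -> R) (del M a b c d : R).
Hypothesis gd : graph_data phi A del M a b c d.
Local Notation graph_pt := (graph_pt phi).
Local Notation near_radius := (near_radius del M).
Local Notation c0 := (c0 M).
Local Notation on_graph := (on_graph phi).
Variable m : {sigma_finite_measure set (R * R * R)%type -> \bar R}.
Variable cc : R.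
Hypothesis cc0 : 0 < cc.
Hypothesis munif : kuniform m cc.
Hypothesis gsupp : forall p, box del p -> ksupp m (graph_pt p).
Implicit Types (z : R * R * R) (q p : R * R) (r rho : R).

Let M0 := gd_M gd.
Let d0 := gd_del gd.
Let N1 : 1 <= big_box M. Proof. by have := M0; rewrite /big_box; lra. Qed.

Let box00 (e : R) : 0 <= e -> box e (0, 0).
Proof. by move=> e0; apply/boxP; rewrite /= normr0. Qed.

Lemma bump_quartic_lb p : 1 / 4 <= p.1 <= 1 / 2 -> 1 / 4 <= p.2 <= 1 / 2 ->
  p.1 ^+ 4 + p.2 ^+ 2 <= 1 / 2.
Proof.
move=> /andP[h1 h2] /andP[h3 h4].
have h5 : p.1 ^+ 2 <= 1 / 4 by nra.
have h6 : p.2 ^+ 2 <= 1 / 4 by nra.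
have h7 : 0 <= p.1 ^+ 2 by exact: sqr_ge0.
rewrite (exprM _ 2 2); nra.
Qed.

Lemma c0_gt0 : 0 < c0.
Proof.
apply: (boxint_gt0 (e := 8^-1)) => //.
- by boxnice.
- by move=> p _; exact: bump_ge0.
- move=> p h1 h2; apply: bump_half; have := bump_quartic_lb h1 h2; lra.
Qed.

Lemma second_moment_gt0 :
  0 < boxint (big_box M) (fun p => p.1 ^+ 2 * ppart (1 - (p.1 ^+ 4 + p.2 ^+ 2)) ^+ 3).
Proof.
apply: (boxint_gt0 (e := 16^-1 * 8^-1)) => //.
- by boxnice.
- by move=> p _; rewrite mulr_ge0 ?sqr_ge0// exprn_ge0 ?ppart_ge0.
- move=> p h1 h2; apply: ler_pM; rewrite ?invr_ge0//.
    by case/andP: h1 => *; nra.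
  by apply: bump_half; have := bump_quartic_lb h1 h2; lra.
Qed.

(** The on-graph share comes from [graph_identity], the total from uniformity. As [W] is c0 rho^3 up
    to O(rho^4), the off-graph share is O(rho^4), one order below the mass of a ball centred on the
    support. *)
Lemma mass_split : exists2 C, 0 < C & exists2 K, 0 <= K &
  forall q rho, box (del / 4) q -> 0 < rho <= near_radius -> exists W,
   [/\ (\int[leb2]_p (graph_w A p.1 p.2 *
          bump (korK (graph_pt q) (graph_pt p) / rho ^+ 4))%:E = W%:E)%E,
       (\int[m]_z (bump (korK (graph_pt q) z / rho ^+ 4) * \1_(~` on_graph) z)%:E
          = (C * rho ^+ 3 - C / c0 * W)%:E)%E &
       C * rho ^+ 3 - C / c0 * W <= K * rho ^+ 4].
Proof.
have dd := d0.
have s0 : ksupp m (graph_pt (0, 0)) by apply: gsupp; apply: box00; lra.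
have [C C0 HC] := integral_bump_uniform cc0 munif s0.
have [K1 K10 HW] := graph_first_order_weighted gd.
have c00 := c0_gt0.
exists C => //; exists (C / c0 * K1); first by rewrite mulr_ge0// divr_ge0// ltW.
move=> q rho bq rhob.
have /andP[rhop /(near_radius_le gd)[rs _ _]] := rhob.
have rs' : 0 < rho <= small_radius del M by rewrite rhop.
have bq2 : box (del / 2) q by case/boxP: bq => ? ?; apply/boxP; split; lra.
have bqd : box del q by case/boxP: bq => ? ?; apply/boxP; split; lra.
have [l WE lb] := HW q rho bq2 rs'.
pose W := rho ^+ 3 * l; exists W.
have GI := graph_identity gd C0 HC gsupp bq rhob WE.
have mG : measurable on_graph := measurable_on_graph gd.
set B := fun z => bump (korK (graph_pt q) z / rho ^+ 4).
have mB : measurable_fun setT B by exact: measurable_bumpK.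
have B0 z : 0 <= B z by exact: bump_ge0.
have m1 : measurable_fun setT (fun z => B z * \1_on_graph z).
  by apply: measurable_funM => //; exact: measurable_indic.
have m2 : measurable_fun setT (fun z => B z * \1_(~` on_graph) z).
  by apply: measurable_funM => //; apply: measurable_indic; exact: measurableC.
have p1 z : 0 <= B z * \1_on_graph z by rewrite mulr_ge0.
have p2 z : 0 <= B z * \1_(~` on_graph) z by rewrite mulr_ge0.
have I1 : (\int[m]_z (B z * \1_on_graph z)%:E = (C / c0 * W)%:E)%E.
  have E : (c0%:E * \int[m]_z (B z * \1_on_graph z)%:E = (C * W)%:E)%E.
    by rewrite -integral_EFin_scale// ltW.
  have : (0 <= \int[m]_z (B z * \1_on_graph z)%:E)%E by exact: integral_EFin_ge0.
  move: E; case: (\int[m]_z (B z * \1_on_graph z)%:E)%E => [x| |]//.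
    by rewrite -EFinM => -[h] _; congr EFin; rewrite mulrAC -h mulrC mulKf// gt_eqF.
  by rewrite gt0_muley// lte_fin.
have I : ((C * rho ^+ 3)%:E = (C / c0 * W)%:E +
    \int[m]_z (B z * \1_(~` on_graph) z)%:E)%E.
  rewrite -(HC _ _ (gsupp bqd) rhop) -I1 -integral_EFin_add//.
  apply: eq_integral => z _; congr EFin; rewrite -mulrDr /indic in_setC.
  by rewrite /B; case: (z \in _); rewrite /= ?addr0 ?add0r mulr1.
split => //.
  move: I; case: (\int[m]_z (B z * \1_(~` on_graph) z)%:E)%E => [x| |]//.
  by rewrite -EFinD => -[->]; congr EFin; ring.
have r3 : 0 < rho ^+ 3 by exact: exprn_gt0.
have -> : C * rho ^+ 3 - C / c0 * W = C / c0 * (- (l - c0)) * rho ^+ 3.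
  by rewrite /W; field; rewrite gt_eqF.
rewrite (_ : C / c0 * K1 * rho ^+ 4 = C / c0 * (K1 * rho) * rho ^+ 3); last by ring.
rewrite ler_wpM2r ?(ltW r3)// ler_wpM2l ?divr_ge0 ?(ltW C0) ?(ltW c00)//.
by move: lb; rewrite ler_norml => /andP[]; lra.
Qed.

(** Around an off-graph support point [y], take the last dyadic radius r at which a graph point [p]
    is within reach. The ball of radius r / 2 about [y] misses the graph and has mass of order r^3,
    yet it lies well inside the ball of radius 4 r about [p], whose off-graph mass is O(r^4). This
    is impossible for small r. *)
Lemma no_support_off_graph : exists2 e, 0 < e & forall z,
  `|z.1.1| <= e -> `|z.1.2| <= e -> `|z.2| <= e -> ksupp m z -> on_graph z.
Proof.
have m0 := M0; have dd := d0; have nr := near_radius_gt0 gd.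
have [C C0 [K K0 HK]] := mass_split.
(* Forces the final contradiction, where (cc / 64) r^3 is compared with K (4 r)^4 = 256 K r^4; the
   first bound keeps 4 r admissible in [mass_split]. *)
pose R0 := Num.min (near_radius / 4) (cc / (2 * (64 * (256 * (K + 1))))).
have K1 : 0 < 2 * (64 * (256 * (K + 1))) by lra.
have R00 : 0 < R0 by rewrite lt_min !divr_gt0.
have R0n : 4 * R0 <= near_radius.
  by rewrite mulrC -ler_pdivlMr// ge_min lexx.
have R0K : 64 * (256 * (K * R0)) < cc.
  have : R0 * (2 * (64 * (256 * (K + 1)))) <= cc.
    by rewrite -ler_pdivlMr// ge_min lexx orbT.
  have : 0 <= K * R0 by rewrite mulr_ge0 ?(ltW R00).
  by have := cc0; lra.
have [rs1 rs2 rs3] := near_radius_le gd (lexx near_radius).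
have R01 : R0 <= 1 / 8 by lra.
have R0d : (3 + 4 * M) * R0 <= del / 8.
  by apply: le_trans rs3; apply: ler_wpM2l; lra.
pose e := Num.min (Num.min (1 / 2) (del / 8)) (R0 / (1 + 2 * M)).
have e0 : 0 < e by rewrite !lt_min !divr_gt0//=; lra.
have [e1 e2 e3] : [/\ e <= 1 / 2, e <= del / 8 & e * (1 + 2 * M) <= R0].
  have h3 : e <= R0 / (1 + 2 * M) by rewrite ge_min lexx orbT.
  have h12 : e <= Num.min (1 / 2) (del / 8) by rewrite ge_min lexx.
  split; [move: h12|move: h12|by rewrite -ler_pdivlMr//; lra];
    by rewrite le_min => /andP[].
exists e => // y y1 y2 y3 sy; apply: contrapT => ny.
have by0 : box del (y.1.2, y.2) by apply/boxP; rewrite /=; split; lra.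
have b00 : box del (0, 0) by apply: box00; lra.
have phiy : `|phi y.1.2 y.2| <= 2 * M * e.
  have := gd_order1 gd by0 b00.
  rewrite /= (graph_phi0 gd) (graph_A0 gd) mul0r !subr0 mulr0 addr0.
  move/le_trans; apply; rewrite [2 * M]mulrC -mulrA ler_wpM2l//.
  have : y.1.2 ^+ 2 <= e.
    rewrite -real_normK ?num_real// expr2 (@le_trans _ _ (e * 1))//; last lra.
    by rewrite ler_pM//; lra.
  lra.
have yM : `|y.1.1| <= M.
  by have := gd_phiM gd b00; rewrite /= (graph_phi0 gd) normr0; lra.
have ny' : near_region del M y.
  by split=> //; apply/boxP; rewrite /=; split; lra.
have [g g0 Hg] := off_graph_gap gd ny' ny.
pose rn (n : nat) := R0 / 2 ^+ n.
have rn0 n : 0 < rn n by rewrite divr_gt0// exprn_gt0.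
have rnR n : rn n <= R0.
  by rewrite ler_pdivrMr ?exprn_gt0// ler_peMr ?(ltW R00)// exprn_ege1// ler1n.
have rnb n : 0 < rn n <= near_radius by rewrite rn0/= (le_trans (rnR n))//; lra.
have rnS n : rn n.+1 = rn n / 2 by rewrite /rn exprS invfM mulrCA mulrC mulrAC mulrC mulrA [_ * R0]mulrC.
pose P n := exists p, korK y (graph_pt p) <= rn n ^+ 4.
(* The projection of [y] along phi is a graph point at distance [|phi y.1.2 y.2 - y.1.1|], at most e
   (1 + 2 M), hence at most R0. *)
have P0 : P 0%N.
  exists (y.1.2, y.2); rewrite /rn expr0 divr1 /korK /graph_pt /=.
  rewrite !subrr expr0n/= addr0 mulr0 mul0r addr0 expr0n/= addr0 -exprM.
  have h : `|phi y.1.2 y.2 - y.1.1| <= R0.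
    by apply: (le_trans (ler_normB _ _)); lra.
  rewrite (exprM _ 2 2) (exprM _ 2 2) -(real_normK (num_real (_ - _))) -!exprM.
  by rewrite lerXn2r ?nnegrE ?(ltW R00).
have [n [Pn nPn]] : exists n, P n /\ ~ P n.+1.
  apply: contrapT => h.
  have Pall n : P n.
    elim: n => // n Pn; apply: contrapT => nP; apply: h; by exists n.
  have [n ng] : exists n, rn n < g.
    exists (Num.bound (R0 / g)); rewrite /rn ltr_pdivrMr ?exprn_gt0//.
    rewrite mulrC -ltr_pdivrMr//.
    have : R0 / g < (Num.bound (R0 / g))%:R by apply: archi_boundP; rewrite divr_ge0 ?ltW.
    move=> /lt_le_trans; apply; rewrite -natrX ler_nat ltnW//; exact: ltn_expl.
  have [p hp] := Pall n.
  exact: (Hg _ p (rnb n) ng hp).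
have [p hp] := Pn.
set r := rn n in hp.
have r0 : 0 < r := rn0 n.
have rR : r <= R0 := rnR n.
have [h1 h2 h3 h4 h5] := korK_displacement gd yM (rnb n) hp.
have bp : box (del / 4) p.
  apply/boxP; split.
    rewrite (_ : p.1 = y.1.2 + (p.1 - y.1.2)); last by ring.
    by apply: (le_trans (ler_normD _ _)); rewrite /= in h2; rewrite -/r in h2 h4; lra.
  rewrite (_ : p.2 = y.2 + (p.2 - y.2)); last by ring.
  by apply: (le_trans (ler_normD _ _)); rewrite /= in h3; rewrite -/r in h3 h5; lra.
have r4b : 0 < 4 * r <= near_radius by rewrite mulr_gt0//=; lra.
have [W [_ E1 E2]] := HK p (4 * r) bp r4b.
have mk : measurable (kball y (r / 2)) by exact: measurable_kball.
have lower : ((8^-1 * (cc * (r / 2) ^+ 3))%:E <=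
   \int[m]_z (bump (korK (graph_pt p) z / (4 * r) ^+ 4) * \1_(~` on_graph) z)%:E)%E.
  have I1 : (\int[m]_z (\1_(kball y (r / 2)) z)%:E = (cc * (r / 2) ^+ 3)%:E)%E.
    by rewrite integral_indic ?setIT//; apply: munif => //; rewrite divr_gt0.
  rewrite EFinM -I1 -integral_EFin_scale//.
  apply: integral_EFin_le.
  - by apply: measurable_funM => //; apply: measurable_indic.
  - apply: measurable_funM; first exact: measurable_bumpK.
    by apply: measurable_indic; apply: measurableC; exact: measurable_on_graph gd.
  - by move=> z; rewrite mulr_ge0.
  move=> z; rewrite {1}/indic; case: (boolP (z \in _)) => [|_]; last first.
    by rewrite mulr0 mulr_ge0 ?bump_ge0.
  rewrite inE /kball /= => hz.
  have zg : ~ on_graph z.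
    move=> zg; apply: nPn; exists (z.1.2, z.2); rewrite rnS -/r.
    rewrite (_ : graph_pt _ = z)//.
    by rewrite /graph_pt /= -zg; case: (z) => -[].
  rewrite /indic mem_set// !mulr1; apply: bump_half.
  rewrite ler_pdivrMr; last by rewrite exprn_gt0// mulr_gt0.
  (* The bound 16 (r^4 + (r / 2)^4) = 17 r^4 is below half of (4 r)^4 = 256 r^4, so [bump_half]
     applies. *)
  apply: (le_trans (korK_triangle (graph_pt p) y z)).
  rewrite korK_sym exprMn; move: hz; rewrite expr_div_n => hz.
  have : 0 < r ^+ 4 by exact: exprn_gt0.
  have e16 : (2 : R) ^+ 4 = 16 by rewrite !exprS expr0; ring.
  have e256 : (4 : R) ^+ 4 = 256 by rewrite !exprS expr0; ring.
  by move: hz; rewrite e16 e256; lra.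
have := le_trans lower; rewrite E1 => /(_ _ (lexx _)); rewrite lee_fin => /le_trans /(_ E2).
have -> : 8^-1 * (cc * (r / 2) ^+ 3) = cc / 64 * r ^+ 3 by rewrite expr_div_n; field.
have -> : K * (4 * r) ^+ 4 = (256 * K * r) * r ^+ 3 by ring.
rewrite ler_pM2r ?exprn_gt0// => h6.
have : K * r <= K * R0 by rewrite ler_wpM2l.
lra.
Qed.

(** Without off-graph mass [W] is exactly c0 r^3, so the coefficients of r and then of r^2 in
    [graph_second_order] vanish. [boxint_var2] writes the second as the wanted expression times a
    positive moment. *)
Theorem graph_second_variation : a ^+ 2 / 2 + 3 * b ^+ 2 - 2 * c = 0.
Proof.
have m0 := M0; have dd := d0; have nr := near_radius_gt0 gd.
have [C C0 [K K0 HK]] := mass_split.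
have [e e0 He] := no_support_off_graph.
have [L L0 HL] := graph_second_order gd.
pose rs := Num.min near_radius (e / 3).
have rs0 : 0 < rs by rewrite lt_min nr divr_gt0.
have b4 : box (del / 4) (0, 0) by apply: box00; lra.
have c00 := c0_gt0.
have [rs1 rs2 rs3] := near_radius_le gd (lexx near_radius).
have key r : 0 < r <= rs ->
  `|r * boxint (big_box M) (var1 a b) + r ^+ 2 * boxint (big_box M) (var2 a b c d)| <= L * r ^+ 3.
  move=> /andP[r0 rr].
  have [rn re] : r <= near_radius /\ r <= e / 3.
    by move: rr; rewrite le_min => /andP[].
  have rnb : 0 < r <= near_radius by rewrite r0.
  have [W [WE offE _]] := HK (0, 0) r b4 rnb.
  (* A point where the integrand is nonzero is off the graph and within the reach of
     [no_support_off_graph], hence off the support. The radius [e / 3] absorbs the factor 3 of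
     [korK_bounds]. *)
  have off0 : (\int[m]_z (bump (korK (graph_pt (0%R, 0%R)) z / r ^+ 4) * \1_(~` on_graph) z)%:E = 0)%E.
    transitivity (\int[m]_z (cst 0%E z))%E; last exact: integral0.
    apply: ge0_ae_eq_integral => //.
    - apply/measurable_EFinP; apply: measurable_funM; first exact: measurable_bumpK.
      by apply: measurable_indic; apply: measurableC; exact: measurable_on_graph gd.
    - by move=> z _; rewrite lee_fin mulr_ge0 ?bump_ge0.
    apply: negligibleS (ksupp_conegligible m) => z /= h sz; apply: h => _ /=.
    congr EFin.
    have [->|bn] := eqVneq (bump (korK (graph_pt (0, 0)) z / r ^+ 4)) 0; first by rewrite mul0r.
    have hK : korK (graph_pt (0, 0)) z <= r ^+ 4.
      by have := bump_neq0 bn; rewrite ler_pdivrMr ?exprn_gt0// mul1r.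
    have := korK_bounds (ltW r0) hK.
    rewrite /graph_pt /= (graph_phi0 gd) !subr0 mulr0 addr0 => -[k1 k2 k3].
    have r1 : r <= 1 by lra.
    have rr1 : r ^+ 2 <= r by rewrite expr2 ler_piMr// ltW.
    have zg : on_graph z by apply: He => //; lra.
    by rewrite /indic memNset ?mulr0//= => /(_ zg).
  have Wc : W = c0 * r ^+ 3.
    have : C * r ^+ 3 - C / c0 * W = 0 by apply: EFin_inj; rewrite -offE.
    move=> h; have : C / c0 * (c0 * r ^+ 3 - W) = 0.
      by rewrite -h; field; rewrite gt_eqF.
    move/eqP; rewrite mulf_eq0 gt_eqF ?divr_gt0//= subr_eq0 => /eqP <-.
    by [].
  have r0s : 0 < r <= small_radius del M by rewrite r0/=; lra.
  have [l lE lb] := HL r r0s.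
  have lc : l = c0.
    have : (r ^+ 3 * l)%:E = W%:E by rewrite -WE -lE.
    move=> [h]; have r3 : r ^+ 3 != 0 by rewrite gt_eqF// exprn_gt0.
    by apply: (mulfI r3); rewrite h Wc mulrC.
  move: lb; rewrite lc.
  by rewrite (_ : c0 - _ = - (r * boxint (big_box M) (var1 a b) + r ^+ 2 * boxint (big_box M) (var2 a b c d))) ?normrN//; ring.
have small0 (x k : R) : 0 <= k -> (forall r, 0 < r <= rs -> `|x| <= k * r) -> x = 0.
  move=> k0 h; apply/eqP; rewrite -normr_le0 leNgt; apply/negP => x0.
  pose r := Num.min rs (`|x| / (2 * (k + 1))).
  have k1 : 0 < 2 * (k + 1) by lra.
  have r0 : 0 < r by rewrite lt_min rs0 divr_gt0.
  have rr : 0 < r <= rs by rewrite r0 ge_min lexx.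
  have := h r rr.
  have : r * (2 * (k + 1)) <= `|x| by rewrite -ler_pdivlMr// ge_min lexx orbT.
  have : 0 <= k * r by rewrite mulr_ge0// ltW.
  lra.
set E1 := boxint _ (var1 a b) in key; set E2 := boxint _ (var2 a b c d) in key.
have rs_le1 : rs <= 1 by rewrite ge_min; apply/orP; left; lra.
have E10 : E1 = 0.
  apply: (small0 _ (L + `|E2|)); first by rewrite addr_ge0.
  move=> r rr; have := key r rr; have /andP[r0 rr1] := rr.
  have -> : r * E1 + r ^+ 2 * E2 = r * (E1 + r * E2) by ring.
  rewrite normrM (gtr0_norm r0) (_ : L * r ^+ 3 = r * (L * r ^+ 2)); last by ring.
  rewrite ler_pM2l// => h.
  rewrite (_ : E1 = (E1 + r * E2) - r * E2); last by ring.
  apply: (le_trans (ler_normB _ _)); rewrite mulrDl lerD//.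
    apply: (le_trans h); rewrite ler_wpM2l// expr2 ler_piMr ?(ltW r0)//; lra.
  by rewrite normrM (gtr0_norm r0) mulrC.
have E20 : E2 = 0.
  apply: (small0 _ L) => // r rr; have := key r rr; have /andP[r0 rr1] := rr.
  rewrite E10 mulr0 add0r normrM ger0_norm ?sqr_ge0//.
  rewrite (_ : L * r ^+ 3 = r ^+ 2 * (L * r)); last by ring.
  by rewrite ler_pM2l// exprn_gt0.
have := boxint_var2 a b c d N1; rewrite -/E2 E20 => /esym/eqP.
by rewrite mulf_eq0 [X in _ || X]gt_eqF ?second_moment_gt0// orbF => /eqP.
Qed.

End core.

(** * Level sets as graphs *)

Section domin.
Context {R : realType} {I : Type}.
Implicit Types (D : set I) (X Y W : I -> R).

(** X = O(W) uniformly on [D], the weighted form of [bddon]. In a product the tactic [domin] seeks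
    one dominated factor and one bounded factor. *)
Definition domin D W X := exists C, forall i, D i -> `|X i| <= C * W i.

Lemma domin_ge0 D W X : (forall i, D i -> 0 <= W i) -> domin D W X ->
  exists2 C, 0 <= C & forall i, D i -> `|X i| <= C * W i.
Proof.
move=> W0 [C XC]; exists `|C| => // i Di; apply: (le_trans (XC i Di)).
by rewrite ler_wpM2r ?W0// ler_norm.
Qed.

Lemma dominD D W X Y : domin D W X -> domin D W Y -> domin D W (fun i => X i + Y i).
Proof.
move=> [C XC] [C' YC]; exists (C + C') => i Di; rewrite mulrDl.
by rewrite (le_trans (ler_normD _ _))// lerD ?XC ?YC.
Qed.

Lemma dominN D W X : domin D W X -> domin D W (fun i => - X i).
Proof. by move=> [C XC]; exists C => i Di; rewrite normrN XC. Qed.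

Lemma dominMl D W X Y : bddon D X -> domin D W Y -> domin D W (fun i => X i * Y i).
Proof.
move=> [C XC] [C' YC]; exists (C * C') => i Di.
by rewrite normrM -mulrA ler_pM ?XC ?YC.
Qed.

Lemma dominMr D W X Y : domin D W X -> bddon D Y -> domin D W (fun i => X i * Y i).
Proof.
move=> XW /dominMl /(_ XW) [C H]; exists C => i Di.
by rewrite mulrC H.
Qed.

Lemma domin_le D W X : (forall i, D i -> `|X i| <= W i) -> domin D W X.
Proof. by move=> H; exists 1 => i Di; rewrite mul1r H. Qed.

Lemma domin_trans D W W' X : (forall i, D i -> 0 <= W i) ->
  domin D W X -> domin D W' W -> domin D W' X.
Proof.
move=> W0 /(domin_ge0 W0) [C C0 XC] [C' WC]; exists (C * C') => i Di.
apply: (le_trans (XC i Di)); rewrite -mulrA ler_wpM2l//.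
by rewrite (le_trans _ (WC i Di))// ler_norm.
Qed.

Lemma domin_eq D W X Y : (forall i, D i -> X i = Y i) -> domin D W Y -> domin D W X.
Proof. by move=> XY [C YC]; exists C => i Di; rewrite XY// YC. Qed.

End domin.

Ltac domin := lazymatch goal with
  | |- domin _ _ (fun p => @?F p + @?G p) => apply: (@dominD _ _ _ _ F G); domin
  | |- domin _ _ (fun p => - @?F p) => apply: (@dominN _ _ _ _ F); domin
  | |- domin _ _ (fun p => @?F p * @?G p) =>
     first [assumption
           |apply: (@dominMl _ _ _ _ F G); [solve [bddon]|solve [domin]]
           |apply: (@dominMr _ _ _ _ F G); [solve [domin]|solve [bddon]]]
  | _ => try assumption
  end.

(** Measurability is for the product sigma-algebra. The function is the infimum of the cones [h a b]
    with rational apex, so its strict sublevel sets are countable unions of theirs, and a cone is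
    assembled from one-coordinate functions. *)
Lemma measurable_lipschitz2 (R : realType) (f : R * R -> R) (L : R) :
  (forall p q, `|f p - f q| <= L * (`|p.1 - q.1| + `|p.2 - q.2|)) ->
  measurable_fun setT f.
Proof.
move=> fL; have L0 : 0 <= L.
  have := fL (0, 0) (1, 0); rewrite /= sub0r normrN1 subrr normr0 addr0 mulr1.
  by apply: le_trans.
apply: (measurability _ (RGenInftyO.measurableE R)) => //.
move=> _ [_ [y ->] <-]; rewrite setTI.
pose h (a b : rat) (p : R * R) := f (ratr a, ratr b) + L * (`|p.1 - ratr a| + `|p.2 - ratr b|).
have -> : f @^-1` `]-oo, y[ = \bigcup_(a : rat) \bigcup_(b : rat) (h a b @^-1` `]-oo, y[).
  apply/seteqP; split => p /=; rewrite in_itv/= => H; last first.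
    move: H => [a _ [b _]]; rewrite /= in_itv/=; apply: le_lt_trans.
    have := fL p (ratr a, ratr b); rewrite /h => /(le_trans (ler_norm _)) /=; lra.
  pose e := (y - f p) / (4 * L + 1).
  have L1 : 0 < 4 * L + 1 by lra.
  have e0 : 0 < e by rewrite divr_gt0// subr_gt0.
  have [a]: exists a : rat, ratr a \in `]p.1 - e, p.1 + e[ by apply: rat_in_itvoo; lra.
  rewrite in_itv/= => /andP[a1 a2].
  have [b]: exists b : rat, ratr b \in `]p.2 - e, p.2 + e[ by apply: rat_in_itvoo; lra.
  rewrite in_itv/= => /andP[b1 b2].
  exists a => //; exists b => //; rewrite /= in_itv/= /h.
  have ha : `|p.1 - ratr a| <= e by rewrite ler_norml; apply/andP; split; lra.
  have hb : `|p.2 - ratr b| <= e by rewrite ler_norml; apply/andP; split; lra.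
  have eE : e * (4 * L + 1) = y - f p by rewrite /e divfK// gt_eqF.
  have h1 : L * (`|p.1 - ratr a| + `|p.2 - ratr b|) <= L * (e + e) by rewrite ler_wpM2l// lerD.
  have := fL (ratr a, ratr b) p; rewrite /= (distrC (ratr a)) (distrC (ratr b)).
  by move=> /(le_trans (ler_norm _)); nra.
apply: bigcupT_measurable_rat => a; apply: bigcupT_measurable_rat => b.
rewrite -[X in measurable X]setTI; apply: (_ : measurable_fun setT (h a b)) => //.
apply: measurable_funD; first exact: measurable_cst.
apply: measurable_funM; first exact: measurable_cst.
apply: measurable_funD; apply: measurableT_comp => //; apply: measurable_funB => //.
Qed.

Section bounded_lipschitz.
Context {R : realType} {T : Type}.
Variables (D : set T) (ds : T -> T -> R).
Hypothesis ds0 : forall p q, 0 <= ds p q.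
Implicit Types F G : T -> R.

(** Bound and Lipschitz estimate go together because products and inverses need both; a single
    constant serves for the two. *)
Definition lipb F := exists2 L, 0 <= L & forall p, D p -> `|F p| <= L /\
  forall q, D q -> `|F p - F q| <= L * ds p q.

Lemma lipb_cst (k : R) : lipb (fun _ => k).
Proof. by exists `|k| => // p _; split => // q _; rewrite subrr normr0 mulr_ge0. Qed.

Lemma lipbD F G : lipb F -> lipb G -> lipb (fun p => F p + G p).
Proof.
move=> [L L0 LF] [M M0 MG]; exists (L + M) => [|p Dp]; first exact: addr_ge0.
have [LF1 LF2] := LF p Dp; have [MG1 MG2] := MG p Dp.
split => [|q Dq]; first by rewrite (le_trans (ler_normD _ _))// lerD.
by rewrite opprD addrACA mulrDl (le_trans (ler_normD _ _))// lerD ?LF2 ?MG2.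
Qed.

Lemma lipbN F : lipb F -> lipb (fun p => - F p).
Proof.
move=> [L L0 LF]; exists L => // p Dp; have [LF1 LF2] := LF p Dp.
by rewrite normrN; split => // q Dq; rewrite -opprD normrN LF2.
Qed.

Lemma lipbM F G : lipb F -> lipb G -> lipb (fun p => F p * G p).
Proof.
move=> [L L0 LF] [M M0 MG]; exists (2 * (L * M) + L * M) => [|p Dp].
  by have : 0 <= L * M by [exact: mulr_ge0]; lra.
have [LF1 LF2] := LF p Dp; have [MG1 MG2] := MG p Dp.
have LM : 0 <= L * M by exact: mulr_ge0.
split => [|q Dq].
  have : `|F p * G p| <= L * M by rewrite normrM ler_pM.
  by lra.
have [MGq _] := MG q Dq.
have d0 := ds0 p q.
rewrite (_ : _ - _ = F p * (G p - G q) + (F p - F q) * G q); last by ring.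
apply: (le_trans (ler_normD _ _)); rewrite !normrM.
apply: (@le_trans _ _ (L * (M * ds p q) +
   L * ds p q * M)).
  by rewrite lerD// ler_pM// ?LF2 ?MG2.
have : 0 <= L * M * ds p q by exact: mulr_ge0.
nra.
Qed.

Lemma lipbV F (k : R) : 0 < k -> (forall p, D p -> k <= F p) -> lipb F ->
  lipb (fun p => (F p)^-1).
Proof.
move=> k0 kF [L L0 LF].
have F0 p : D p -> 0 < F p by move=> /kF; exact: lt_le_trans.
have Fk p : D p -> (F p)^-1 <= k^-1 by move=> Dp; rewrite lef_pV2 ?posrE ?kF ?F0.
have ki : 0 <= k^-1 by rewrite invr_ge0 ltW.
exists (k^-1 + k^-1 * k^-1 * L) => [|p Dp]; first by rewrite addr_ge0// !mulr_ge0.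
have nF p' : D p' -> `|(F p')^-1| <= k^-1.
  by move=> Dp'; rewrite ger0_norm ?Fk// invr_ge0 ltW// F0.
split => [|q Dq]; first by rewrite (le_trans (nF p Dp))// lerDl !mulr_ge0.
have d0 := ds0 p q.
rewrite (_ : _ - _ = (F p)^-1 * (F q)^-1 * (F q - F p)); last first.
  by field; rewrite !gt_eqF ?F0.
rewrite !normrM (distrC (F q)).
apply: (@le_trans _ _ (k^-1 * k^-1 * (L * ds p q))).
  have [_ LF2] := LF p Dp.
  by apply: ler_pM; [exact: mulr_ge0|by []|apply: ler_pM; rewrite ?nF|exact: LF2].
by rewrite mulrDl mulrA lerDr mulr_ge0.
Qed.

End bounded_lipschitz.

Section clamp.
Context {R : realType}.
Variable k : R.
Hypothesis k0 : 0 <= k.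

(** The 1-Lipschitz retraction onto [-k, k], by which the implicit function is extended from a box
    to the whole plane. *)
Definition clamp (x : R) := Num.max (- k) (Num.min x k).

Lemma clamp_le x : `|clamp x| <= k.
Proof.
rewrite /clamp ler_norml; apply/andP; split; first by rewrite le_max lexx.
by rewrite ge_max ge_min lexx orbT andbT; have := k0; lra.
Qed.

Lemma clamp_id x : `|x| <= k -> clamp x = x.
Proof.
rewrite ler_norml => /andP[h1 h2]; rewrite /clamp (min_idPl h2).
exact/max_idPr.
Qed.

Lemma clamp_lip x y : `|clamp x - clamp y| <= `|x - y|.
Proof.
wlog : x y / x <= y => [H|xy].
  have [/H//|/ltW /H] := leP x y.
  by rewrite distrC (distrC y).
have kk := k0.
rewrite distrC (distrC x) ger0_norm ?subr_ge0; last first.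
  by rewrite /clamp /Num.max /Num.min; repeat case: ifPn; rewrite -?leNgt; lra.
rewrite ger0_norm ?subr_ge0// /clamp.
by rewrite /Num.max /Num.min; repeat case: ifPn; rewrite -?leNgt; lra.
Qed.

End clamp.

Definition cube (R : realType) (k : R) : set (R * R * R) :=
  [set z | [/\ `|z.1.1| <= k, `|z.1.2| <= k & `|z.2| <= k]].

(** [g1], [g2], [g3] stand for the partial derivatives of [g]. On the graph phi and tau both have
    weight 2, so errors quadratic in them have weight 4: to weight 3 the graph sees only the
    eta-axis expansions of [g] and its partials. [ld_axis] has no linear term since the eta-axis is
    tangent to the level set at 0. *)
Record level_data (R : realType) (g g1 g2 g3 : R * R * R -> R)
    (dl C n0 n1 m0 m1 B2 B3 : R) : Prop := {
  ld_dl : 0 < dl;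
  ld_C : 0 <= C;
  ld_n0 : 0 < n0;
  ld_taylor : forall z z', cube dl z -> cube dl z' ->
    `|g z' - g z - ((z'.1.1 - z.1.1) * g1 z + (z'.1.2 - z.1.2) * g2 z + (z'.2 - z.2) * g3 z)| <=
    C * ((z'.1.1 - z.1.1) ^+ 2 + (z'.1.2 - z.1.2) ^+ 2 + (z'.2 - z.2) ^+ 2);
  ld_lip : forall z z', cube dl z -> cube dl z' -> forall gi, [\/ gi = g1, gi = g2 | gi = g3] ->
    `|gi z' - gi z| <= C * (`|z'.1.1 - z.1.1| + `|z'.1.2 - z.1.2| + `|z'.2 - z.2|);
  ld_axis : forall e, `|e| <= dl -> `|g (0, e, 0) - (B2 * e ^+ 2 + B3 * e ^+ 3)| <= C * e ^+ 4;
  ld_axis1 : forall e, `|e| <= dl -> `|g1 (0, e, 0) - (n0 + n1 * e)| <= C * e ^+ 2;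
  ld_axis2 : forall e, `|e| <= dl -> `|g2 (0, e, 0) - 2 * B2 * e| <= C * e ^+ 2;
  ld_axis3 : forall e, `|e| <= dl -> `|g3 (0, e, 0) - (m0 + m1 * e)| <= C * e ^+ 2 }.

(** * A quantitative implicit function theorem *)

Section implicit_function.
Context {R : realType}.
Variables (g g1 g2 g3 : R * R * R -> R) (dl C n0 n1 m0 m1 B2 B3 : R).
Hypothesis ld : level_data g g1 g2 g3 dl C n0 n1 m0 m1 B2 B3.

Let dl0 := ld_dl ld.
Let C0 := ld_C ld.
Let n00 := ld_n0 ld.

(** With [12 * (C * e1) <= n0], [g1] varies by at most n0 / 4 on the cube, and the quadratic error
    costs at most n0 / 6 of slope in [g_mono]. *)
Let e1 : R := Num.min dl (Num.min 1 (n0 / (12 * (C + 1)))).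

Let e1P : [/\ 0 < e1, e1 <= dl, e1 <= 1 & 12 * (C * e1) <= n0].
Proof.
have C1 : 0 < 12 * (C + 1) by have := C0; lra.
have e10 : 0 < e1 by rewrite !lt_min dl0 ltr01 divr_gt0.
split => //; first by rewrite ge_min lexx.
  by rewrite !ge_min lexx !orbT.
have : e1 * (12 * (C + 1)) <= n0 by rewrite -ler_pdivlMr// !ge_min lexx !orbT.
lra.
Qed.

Let cubeW z : cube e1 z -> cube dl z.
Proof. by have [_ h _ _] := e1P; move=> [h1 h2 h3]; split; lra. Qed.

Let Bd := `|g1 (0, 0, 0)| + `|g2 (0, 0, 0)| + `|g3 (0, 0, 0)| + 3 * C.

Let cube00 : cube e1 (0, 0, 0).
Proof. by have [h _ _ _] := e1P; split; rewrite normr0 ltW. Qed.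

Let gi_near z gi : cube e1 z -> [\/ gi = g1, gi = g2 | gi = g3] ->
  `|gi z - gi (0, 0, 0)| <= C * (3 * e1).
Proof.
move=> cz gigi.
have := ld_lip ld (cubeW cube00) (cubeW cz) gigi; rewrite !subr0 => /le_trans; apply.
by rewrite ler_wpM2l ?C0//; have [h1 h2 h3] := cz; lra.
Qed.

Let gi_le z gi : cube e1 z -> [\/ gi = g1, gi = g2 | gi = g3] -> `|gi z| <= Bd.
Proof.
move=> cz gigi; have := gi_near cz gigi; have [h1 _ h2 _] := e1P.
have Ce : C * (3 * e1) <= 3 * C by rewrite mulrCA ler_wpM2l// ler_piMr ?C0.
move=> h; rewrite -(subrK (gi (0, 0, 0)) (gi z)); apply: (le_trans (ler_normD _ _)).
have : `|gi (0, 0, 0)| <= `|g1 (0, 0, 0)| + `|g2 (0, 0, 0)| + `|g3 (0, 0, 0)|.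
  have h4 := normr_ge0 (g1 (0, 0, 0)); have h5 := normr_ge0 (g2 (0, 0, 0)).
  have h6 := normr_ge0 (g3 (0, 0, 0)).
  by case: gigi => ->; lra.
rewrite /Bd; lra.
Qed.

Let g1_ge z : cube e1 z -> n0 / 2 <= g1 z.
Proof.
move=> cz; have := gi_near cz (Or31 _ _ erefl); have [h1 h2 _ h3] := e1P.
have := ld_axis1 ld (_ : `|0| <= dl); rewrite normr0 expr0n !mulr0 addr0 => /(_ (ltW dl0)).
rewrite !ler_norml => /andP[h4 h5] /andP[h6 h7].
by have := n00; lra.
Qed.

Let Bd0 : 0 <= Bd. Proof. by rewrite !addr_ge0// mulr_ge0. Qed.

Let dist (z z' : R * R * R) := `|z'.1.1 - z.1.1| + `|z'.1.2 - z.1.2| + `|z'.2 - z.2|.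
Let K := Bd + 2 * C.

Let K0 : 0 <= K. Proof. by rewrite /K; have := Bd0; have := C0; lra. Qed.

Let g_lip z z' : cube e1 z -> cube e1 z' -> `|g z' - g z| <= K * dist z z'.
Proof.
move=> cz cz'; have := ld_taylor ld (cubeW cz) (cubeW cz').
have := gi_le cz (Or31 _ _ erefl); have := gi_le cz (Or32 _ _ erefl).
have := gi_le cz (Or33 _ _ erefl); rewrite /K /dist.
have [h1 h2 h3] := cz; have [h4 h5 h6] := cz'; have [e10 _ e11 _] := e1P.
have dd (a b : R) : `|a| <= e1 -> `|b| <= e1 -> (b - a) ^+ 2 <= 2 * `|b - a|.
  move=> ha hb; rewrite -real_normK ?num_real// expr2 ler_wpM2r//.
  by apply: (le_trans (ler_normB _ _)); lra.
move: (dd _ _ h1 h4) (dd _ _ h2 h5) (dd _ _ h3 h6).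
set x := z'.1.1 - z.1.1; set y := z'.1.2 - z.1.2; set t := z'.2 - z.2.
move=> dx dy dt k3 k2 k1 T.
rewrite -(subrK (x * g1 z + y * g2 z + t * g3 z) (g z' - g z)).
apply: (le_trans (ler_normD _ _)); rewrite (mulrDl Bd) [leLHS]addrC lerD//; last first.
  by apply: (le_trans T); rewrite (mulrC 2 C) -mulrA ler_wpM2l ?C0//; lra.
have mB (p q : R) : `|q| <= Bd -> `|p * q| <= Bd * `|p|.
  by move=> h; rewrite normrM mulrC ler_wpM2r.
apply: (le_trans (ler_normD _ _)); rewrite (mulrDr Bd) (mulrDr Bd) lerD ?mB//.
by apply: (le_trans (ler_normD _ _)); rewrite lerD// mB.
Qed.

Let g_mono f f' e t : cube e1 (f, e, t) -> cube e1 (f', e, t) -> f <= f' ->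
  n0 / 4 * (f' - f) <= g (f', e, t) - g (f, e, t).
Proof.
move=> cz cz' ff; have := ld_taylor ld (cubeW cz) (cubeW cz'); rewrite /= !subrr.
rewrite !mul0r expr0n !addr0 ler_norml => /andP[h _].
have := g1_ge cz; have [e10 _ _ Ce] := e1P => g1k.
have ff' : f' - f <= 2 * e1.
  have [+ _ _] := cz; have [+ _ _] := cz'; rewrite /= !ler_norml => /andP[? ?] /andP[? ?]; lra.
have : (f' - f) * (n0 / 2) <= (f' - f) * g1 (f, e, t) by rewrite ler_wpM2l// subr_ge0.
have : C * (f' - f) ^+ 2 <= (f' - f) * (n0 / 6).
  rewrite expr2 mulrCA ler_wpM2l ?subr_ge0//.
  by apply: (@le_trans _ _ (C * (2 * e1))); [exact: ler_wpM2l|lra].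
have : 0 <= (f' - f) * n0 by rewrite mulr_ge0 ?subr_ge0// ltW.
lra.
Qed.

Let g_inj f f' e t : cube e1 (f, e, t) -> cube e1 (f', e, t) ->
  n0 / 4 * `|f' - f| <= `|g (f', e, t) - g (f, e, t)|.
Proof.
move=> cz cz'; have [ff|/ltW ff] := leP f f'.
  by rewrite ger0_norm ?subr_ge0// (le_trans (g_mono cz cz' ff))// ler_norm.
rewrite distrC (distrC (g (f', e, t))) ger0_norm ?subr_ge0//.
by rewrite (le_trans (g_mono cz' cz ff))// ler_norm.
Qed.

(** In this box [|g (0, eta, tau)|] is at most n0 e1 / 4, which is less than or equal to the change
    of [g] when phi moves by e1 either way; hence the change of sign. *)
Let del := Num.min e1 (n0 * e1 / (8 * (K + 1))).

Let delP : [/\ 0 < del, del <= e1 & 8 * (K * del) <= n0 * e1].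
Proof.
have [e10 _ _ _] := e1P; have kk := K0.
have C1 : 0 < 8 * (K + 1) by lra.
have d0 : 0 < del by rewrite lt_min e10 divr_gt0// mulr_gt0.
split => //; first by rewrite ge_min lexx.
have : del * (8 * (K + 1)) <= n0 * e1 by rewrite -ler_pdivlMr// ge_min lexx orbT.
by lra.
Qed.

(** Intermediate value theorem in phi. Clamping (eta, tau) makes the solution total, so that its
    Lipschitz bound, and with it measurability, holds on the whole plane. *)
Let sol_exists (p : R * R) : exists f, `|f| <= e1 /\ g (f, clamp del p.1, clamp del p.2) = 0.
Proof.
have [e10 _ _ _] := e1P; have [d0 de Kd] := delP.
set e := clamp del p.1; set t := clamp del p.2.
have he : `|e| <= del := clamp_le (ltW d0) _.
have ht : `|t| <= del := clamp_le (ltW d0) _.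
have cz f : `|f| <= e1 -> cube e1 (f, e, t) by move=> h; split => //=; lra.
have g0 : `|g (0, e, t)| <= n0 / 4 * e1.
  have := ld_axis ld (_ : `|0| <= dl); rewrite normr0 !expr0n/= !mulr0 addr0 subr0.
  move=> /(_ (ltW dl0)); rewrite normr_le0 => /eqP g00.
  have := g_lip cube00 (cz 0 _); rewrite normr0 => /(_ (ltW e10)).
  rewrite g00 !subr0 /dist/= !subr0 normr0 add0r => /le_trans; apply.
  apply: (@le_trans _ _ (K * (del + del))); first by rewrite ler_wpM2l ?K0// lerD.
  lra.
have ce f : cube e1 (clamp e1 f, e, t) by apply: cz; exact: (clamp_le (ltW e10)).
have cont : {within `[- e1, e1], continuous (fun f => g (clamp e1 f, e, t))}.
  apply: continuous_subspaceT => f; apply/cvgrPdist_le => eps eps0; near=> f'.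
  apply: (le_trans (g_lip (ce f') (ce f))).
  rewrite /dist/= !subrr normr0 !addr0.
  apply: (@le_trans _ _ (K * `|f - f'|)); first by rewrite ler_wpM2l ?K0// clamp_lip// ltW.
  apply: (@le_trans _ _ ((K + 1) * `|f - f'|)); first by rewrite ler_wpM2r// lerDl.
  rewrite mulrC -ler_pdivlMr; last by have := K0; lra.
  near: f'; apply: cvgr_dist_le; first exact: cvg_id.
  by rewrite divr_gt0//; have := K0; lra.
have e1e1 : - e1 <= e1 by lra.
have ne1 : `|- e1| <= e1 by rewrite normrN gtr0_norm.
have pe1 : `|e1| <= e1 by rewrite gtr0_norm.
have z0 : `|0 : R| <= e1 by rewrite normr0 ltW.
have k1 : - e1 <= 0 by lra.
have M1 := g_mono (cz _ ne1) (cz _ z0) k1.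
have M2 := g_mono (cz _ z0) (cz _ pe1) (ltW e10).
move: g0; rewrite ler_norml => /andP[g01 g02].
have [|f fi gf] := IVT e1e1 cont (v := 0).
  rewrite !clamp_id// ge_min le_max; apply/andP; split; apply/orP; [left|right]; lra.
exists (clamp e1 f); split => //.
exact: (clamp_le (ltW e10)).
Unshelve. all: by end_near. Qed.

Let sol : {s : R * R -> R | forall p, `|s p| <= e1 /\ g (s p, clamp del p.1, clamp del p.2) = 0}.
Proof. by apply: cid; have [s sP] := choice sol_exists; exists s. Qed.

Let phi e t := sval sol (e, t).
Let pt (p : R * R) : R * R * R := (phi p.1 p.2, clamp del p.1, clamp del p.2).

Let pt_cube p : cube e1 (pt p).
Proof.
have [d0 de _] := delP.
split => /=; first by have := (svalP sol p).1; rewrite {1}(surjective_pairing p).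
  by rewrite (le_trans (clamp_le (ltW d0) _)).
by rewrite (le_trans (clamp_le (ltW d0) _)).
Qed.

Let g_pt p : g (pt p) = 0.
Proof. by have := (svalP sol p).2; rewrite {1}(surjective_pairing p). Qed.

(** Implicit differentiation: d_eta phi = - g2 / g1 and d_tau phi = - g3 / g1, combined as d_eta phi
    - 4 phi d_tau phi. *)
Let A e t := - ((g2 (pt (e, t)) - 4 * phi e t * g3 (pt (e, t))) / g1 (pt (e, t))).

Let ds (p q : R * R) := `|p.1 - q.1| + `|p.2 - q.2|.
Let ds0 p q : 0 <= ds p q. Proof. by rewrite addr_ge0. Qed.
Local Notation lip := (lipb setT ds).

Let measurable_lip F : lip F -> measurable_fun setT F.
Proof. by move=> [L _ LF]; apply: (@measurable_lipschitz2 _ _ L) => p q; exact: (LF p I).2. Qed.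

Let phi_lip p q :
  `|phi p.1 p.2 - phi q.1 q.2| <= 4 * K / n0 * (`|p.1 - q.1| + `|p.2 - q.2|).
Proof.
have n0k : 0 < n0 / 4 by have := n00; lra.
have d0 : 0 <= del by have [/ltW] := delP.
have [_ cq1 cq2] := pt_cube q; have [cp1 _ _] := pt_cube p.
have c1 : cube e1 (phi p.1 p.2, clamp del q.1, clamp del q.2) by split.
have := g_inj (pt_cube q) c1; rewrite -/(pt q) g_pt -(g_pt p).
move=> h; have := le_trans h (g_lip (pt_cube p) c1).
rewrite /dist /= subrr normr0 add0r -ler_pdivlMl//; move/le_trans; apply.
rewrite mulrA (_ : (n0 / 4)^-1 * K = 4 * K / n0); last by field; rewrite gt_eqF// ?n00.
rewrite ler_wpM2l//; first by rewrite divr_ge0 ?mulr_ge0 ?K0// ltW ?n00.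
by rewrite lerD// distrC clamp_lip.
Qed.

Let lipb_phi : lip (fun p => phi p.1 p.2).
Proof.
have kn : 0 <= 4 * K / n0 by rewrite divr_ge0 ?mulr_ge0 ?K0// ltW ?n00.
have [e10 _ _ _] := e1P.
exists (e1 + 4 * K / n0); first by rewrite addr_ge0// ltW.
move=> p _; split; first by have [h _ _] := pt_cube p; rewrite (le_trans h)// lerDl.
move=> q _; apply: (le_trans (phi_lip p q)); rewrite ler_wpM2r ?addr_ge0//.
by rewrite lerDr ltW.
Qed.

Let lipb_gi gi : [\/ gi = g1, gi = g2 | gi = g3] -> lip (fun p => gi (pt p)).
Proof.
move=> gigi; have kn : 0 <= 4 * K / n0 by rewrite divr_ge0 ?mulr_ge0 ?K0// ltW ?n00.
have d0 : 0 <= del by have [/ltW] := delP.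
exists (Bd + C * (4 * K / n0 + 1)) => [|p _].
  by rewrite addr_ge0 ?Bd0// mulr_ge0 ?C0// addr_ge0.
split=> [|q _].
  by rewrite (le_trans (gi_le (pt_cube p) gigi))// lerDl mulr_ge0 ?C0// addr_ge0.
apply: (le_trans (ld_lip ld (cubeW (pt_cube q)) (cubeW (pt_cube p)) gigi)).
apply: (@le_trans _ _ (C * (4 * K / n0 + 1) * (`|p.1 - q.1| + `|p.2 - q.2|))); last first.
  by rewrite ler_wpM2r ?addr_ge0// lerDr Bd0.
rewrite -mulrA ler_wpM2l ?C0// mulrDl mul1r -addrA lerD//; first exact: phi_lip.
by rewrite lerD// clamp_lip.
Qed.

Let lipb_A : lip (fun p => A p.1 p.2).
Proof.
have n02 : 0 < n0 / 2 by rewrite divr_gt0 ?n00.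
have E : (fun p => A p.1 p.2) = (fun p => - ((g2 (pt p) + - (4 * phi p.1 p.2 * g3 (pt p))) * (g1 (pt p))^-1)).
  by apply/funext => -[].
rewrite E; apply: lipbN; apply: (@lipbM _ _ _ _ ds0 (fun p => g2 (pt p) + - (4 * phi p.1 p.2 * g3 (pt p))) (fun p => (g1 (pt p))^-1)).
  apply: lipbD; first by apply: lipb_gi; exact: Or32.
  apply: lipbN; apply: (@lipbM _ _ _ _ ds0 (fun p => 4 * phi p.1 p.2) (fun p => g3 (pt p))).
    by apply: (@lipbM _ _ _ _ ds0 (fun p => 4) (fun p => phi p.1 p.2)) => //; exact: lipb_cst.
  by apply: lipb_gi; exact: Or33.
apply: (@lipbV _ _ _ _ ds0 (fun p => g1 (pt p)) _ n02) => [p _|]; first by apply: g1_ge; exact: pt_cube.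
by apply: lipb_gi; exact: Or31.
Qed.

(** The four coefficients cancel the terms of weight 2 and 3 in B2 e^2 + B3 e^3 + phi (n0 + n1 e) +
    t (m0 + m1 e). *)
Let a := - B2 / n0.
Let b := - m0 / n0.
Let c := - (m1 + n1 * b) / n0.
Let d := - (B3 + n1 * a) / n0.

Let ptE p : box del p -> pt p = (phi p.1 p.2, p.1, p.2).
Proof. by move=> /boxP[h1 h2]; rewrite /pt !clamp_id. Qed.

Let pt_coord p : box del p ->
  [/\ (pt p).1.1 = phi p.1 p.2, (pt p).1.2 = p.1 & (pt p).2 = p.2].
Proof. by move=> /ptE ->. Qed.

Let box_del1 p : box del p -> `|p.1| <= 1 /\ `|p.2| <= 1.
Proof.
have [_ h1 _] := delP; have [_ _ h2 _] := e1P.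
by move=> /boxP[h3 h4]; split; lra.
Qed.

Let phi_le1 p : `|phi p.1 p.2| <= 1.
Proof. by have [h _ _] := pt_cube p; have [_ _ h1 _] := e1P; apply: le_trans h1. Qed.

Let bddon_g1V (I : Type) (D : set I) (f : I -> R * R * R) : (forall i, D i -> cube e1 (f i)) ->
  bddon D (fun i => (g1 (f i))^-1).
Proof.
move=> Df; exists (n0 / 2)^-1 => i /Df /g1_ge h.
have n02 : 0 < n0 / 2 by rewrite divr_gt0 ?n00.
have g0 : 0 < g1 (f i) by exact: lt_le_trans h.
by rewrite ger0_norm ?invr_ge0 ?(ltW g0)// lef_pV2// posrE.
Qed.

Let bddon_gi (I : Type) (D : set I) (f : I -> R * R * R) gi : (forall i, D i -> cube e1 (f i)) ->
  [\/ gi = g1, gi = g2 | gi = g3] -> bddon D (fun i => gi (f i)).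
Proof. by move=> Df gigi; exists Bd => i /Df /gi_le; apply. Qed.

(** Both points satisfy g = 0, so [E] is a pure Taylor remainder and F - A S = (E - T g3) / g1. [E]
    is quadratic in the displacements; their squares are dominated by the weight because [Dt] is T -
    4 S ph with T bounded, and [F] is Lipschitz. *)
Let order1 : exists M, forall p q, box del p -> box del q ->
    `|phi p.1 p.2 - phi q.1 q.2 - A q.1 q.2 * (p.1 - q.1)| <=
    M * ((p.1 - q.1) ^+ 2 + `|p.2 - q.2 + 4 * (p.1 - q.1) * phi q.1 q.2|).
Proof.
pose I := ((R * R) * (R * R))%type.
pose D : set I := [set i | box del i.1 /\ box del i.2].
pose Dt (i : I) := i.1.2 - i.2.2.
pose S (i : I) := i.1.1 - i.2.1.
pose ph (i : I) := phi i.2.1 i.2.2.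
pose T (i : I) := Dt i + 4 * S i * ph i.
pose W (i : I) := S i ^+ 2 + `|T i|.
pose F (i : I) := phi i.1.1 i.1.2 - ph i.
pose zq (i : I) := pt i.2.
have b_S : bddon D S.
  exists 2 => i [/box_del1[h1 h2] /box_del1[h3 h4]].
  by rewrite (le_trans (ler_normB _ _))//; lra.
have b_ph : bddon D ph by exists 1 => i _; exact: phi_le1.
have b_t : bddon D Dt.
  exists 2 => i [/box_del1[h1 h2] /box_del1[h3 h4]].
  by rewrite (le_trans (ler_normB _ _))//; lra.
have b_T : bddon D T by rewrite /T; bddon.
have W0 i : 0 <= W i by rewrite addr_ge0// sqr_ge0.
have d_S : domin D W (fun i => S i ^+ 2).
  by apply: domin_le => i _; rewrite ger0_norm ?sqr_ge0// lerDl.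
have d_T : domin D W T by apply: domin_le => i _; rewrite lerDr sqr_ge0.
have d_t : domin D W (fun i => Dt i ^+ 2).
  apply: (domin_eq (Y := fun i => T i * T i - T i * (8 * S i * ph i) + S i ^+ 2 * (16 * ph i ^+ 2))).
    by move=> i _; rewrite /T; ring.
  by domin.
pose K' := 4 * K / n0.
have d_F : domin D W (fun i => F i ^+ 2).
  apply: (domin_trans (W := fun i => 2 * K' ^+ 2 * (S i ^+ 2 + Dt i ^+ 2))).
  - move=> i _; apply: mulr_ge0; last by rewrite addr_ge0 ?sqr_ge0.
    exact: mulr_ge0 (ler0n _ _) (sqr_ge0 _).
  - apply: domin_le => i _; rewrite ger0_norm ?sqr_ge0// -real_normK ?num_real//.
    have := phi_lip i.1 i.2; rewrite -/(ph i) -/(F i) -/K' -/(S i) -/(Dt i) => h.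
    apply: (@le_trans _ _ ((K' * (`|S i| + `|Dt i|)) ^+ 2)).
      by apply: lerXn2r => //; rewrite nnegrE ?(le_trans _ h).
    rewrite -(real_normK (num_real (S i))) -(real_normK (num_real (Dt i))) -subr_ge0.
    rewrite (_ : _ - _ = K' ^+ 2 * (`|S i| - `|Dt i|) ^+ 2); last by ring.
    exact: mulr_ge0 (sqr_ge0 _) (sqr_ge0 _).
  - apply: dominMl; first exact: bddon_cst.
    exact: dominD.
pose E (i : I) := F i * g1 (zq i) + S i * g2 (zq i) + Dt i * g3 (zq i).
have d_E : domin D W E.
  apply: (domin_trans (W := fun i => C * (F i ^+ 2 + S i ^+ 2 + Dt i ^+ 2))).
  - by move=> i _; apply: (mulr_ge0 C0); apply: addr_ge0 (sqr_ge0 _); apply: addr_ge0 (sqr_ge0 _) (sqr_ge0 _).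
  - apply: domin_le => i [bp bq].
    have := ld_taylor ld (cubeW (pt_cube i.2)) (cubeW (pt_cube i.1)).
    have [-> -> ->] := pt_coord bp; have [-> -> ->] := pt_coord bq.
    by rewrite !g_pt subrr sub0r normrN.
  - apply: dominMl; first exact: bddon_cst.
    by apply: dominD => //; exact: dominD.
have czq i : D i -> cube e1 (zq i) by move=> _; exact: pt_cube.
have b_V : bddon D (fun i => (g1 (zq i))^-1) by exact: bddon_g1V.
have b_g3 : bddon D (fun i => g3 (zq i)) by apply: bddon_gi => //; exact: Or33.
have [M HM] : domin D W (fun i => F i - A i.2.1 i.2.2 * S i).
  apply: (domin_eq (Y := fun i => (E i - T i * g3 (zq i)) * (g1 (zq i))^-1)); last by domin.
  move=> i Di; have := g1_ge (czq i Di); have nn := n00 => h.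
  rewrite /E /A -surjective_pairing -/(zq i) -/(ph i) /T.
  by field; rewrite gt_eqF//; lra.
by exists M => p q bp bq; have := HM (p, q) (conj bp bq).
Qed.

Let D : set (R * R) := box del.
(** [W1] and [W2] measure weights 2 and 4; [domin11] multiplies two quantities of weight 2. *)
Let W1 (p : R * R) := p.1 ^+ 2 + `|p.2|.
Let W2 (p : R * R) := p.1 ^+ 4 + p.2 ^+ 2.
Let z0 (p : R * R) : R * R * R := (0, p.1, 0).
Let ph (p : R * R) := phi p.1 p.2.

Let axis0 : [/\ g (0, 0, 0) = 0, g1 (0, 0, 0) = n0 & g2 (0, 0, 0) = 0].
Proof.
have l0 : `|0 : R| <= dl by rewrite normr0 ltW// dl0.
have := ld_axis ld l0; have := ld_axis1 ld l0; have := ld_axis2 ld l0.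
rewrite !expr0n/= !mulr0 !addr0 !subr0 !normr_le0 subr_eq0.
by move=> /eqP -> /eqP -> /eqP ->.
Qed.

Let D00 : D (0, 0).
Proof. by have [d0 _ _] := delP; apply/boxP; rewrite /= normr0 ltW. Qed.

Let phi0 : phi 0 0 = 0.
Proof.
have E := ptE D00; rewrite /= in E.
have cz := pt_cube (0, 0); have gz := g_pt (0, 0); rewrite E in cz gz.
have := g_inj cube00 cz; rewrite gz; have [-> _ _] := axis0.
rewrite !subr0 normr0 => h.
have n4 : 0 < n0 / 4 by rewrite divr_gt0// n00.
by apply/eqP; rewrite -normr_le0 -(pmulr_rle0 _ n4).
Qed.

Let A0 : A 0 0 = 0.
Proof.
rewrite /A (ptE D00) /= phi0; have [_ _ ->] := axis0.
by rewrite mulr0 mul0r subrr mul0r oppr0.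
Qed.

Let W10 p : D p -> 0 <= W1 p. Proof. by move=> _; rewrite addr_ge0// sqr_ge0. Qed.

Let d_e2 : domin D W1 (fun p => p.1 ^+ 2).
Proof. by apply: domin_le => p _; rewrite ger0_norm ?sqr_ge0// lerDl. Qed.

Let d_t : domin D W1 (fun p => p.2).
Proof. by apply: domin_le => p _; rewrite lerDr sqr_ge0. Qed.

Let d_ph : domin D W1 ph.
Proof.
have [M HM] := order1; exists M => p Dp.
by have := HM p (0, 0) Dp D00; rewrite /= phi0 A0 mul0r mulr0 !subr0 addr0.
Qed.

Let domin11 X Y : domin D W1 X -> domin D W1 Y -> domin D W2 (fun p => X p * Y p).
Proof.
move=> /(domin_ge0 W10)[M M0 XM] /(domin_ge0 W10)[N N0 YN].
exists (M * N * 2) => p Dp; rewrite normrM.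
apply: (@le_trans _ _ ((M * W1 p) * (N * W1 p))); first by rewrite ler_pM ?XM ?YN.
rewrite mulrACA -[leRHS]mulrA ler_wpM2l ?mulr_ge0// /W1 /W2.
rewrite -(real_normK (num_real p.2)) -subr_ge0 (_ : _ - _ = (p.1 ^+ 2 - `|p.2|) ^+ 2) ?sqr_ge0//.
ring.
Qed.

Let b_e : bddon D (fun p => p.1). Proof. by exists 1 => p /box_del1[]. Qed.
Let b_t : bddon D (fun p => p.2). Proof. by exists 1 => p /box_del1[]. Qed.
Let b_ph : bddon D ph. Proof. by exists 1 => p _; exact: phi_le1. Qed.

Let cz0 p : D p -> cube e1 (z0 p).
Proof.
have [h _ _ _] := e1P; have [_ h1 _] := delP.
by move=> /boxP[h2 h3]; split; rewrite /= ?normr0 ?(ltW h)//; lra.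
Qed.

Let e_dl p : D p -> `|p.1| <= dl.
Proof. by move=> /cz0/cubeW[_ + _]. Qed.

(** Expanding [g] at the axis point [(0, e, 0)] rather than at the origin leaves a remainder
    quadratic in phi and tau only, hence of weight 4. The difference to the model [P] is then a
    combination of such errors divided by [g1] at that point. *)
Let order3 : exists M, forall p, box del p ->
    `|phi p.1 p.2 - (a * p.1 ^+ 2 + b * p.2 + c * p.1 * p.2 + d * p.1 ^+ 3)| <=
    M * (p.1 ^+ 4 + p.2 ^+ 2).
Proof.
pose e (p : R * R) := p.1; pose t (p : R * R) := p.2.
pose E1 p := g (z0 p) + (ph p * g1 (z0 p) + t p * g3 (z0 p)).
have d_E1 : domin D W2 E1.
  apply: (domin_trans (W := fun p => C * (ph p * ph p + t p * t p))).
  - by move=> p _; apply: (mulr_ge0 C0); rewrite -!expr2 addr_ge0 ?sqr_ge0.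
  - apply: domin_le => p Dp.
    have := ld_taylor ld (cubeW (cz0 Dp)) (cubeW (pt_cube p)); rewrite g_pt.
    have [-> -> ->] := pt_coord Dp; rewrite !subr0 subrr mul0r addr0 sub0r -opprD normrN.
    by rewrite expr0n addr0.
  - by apply: dominMl; [exact: bddon_cst|apply: dominD; exact: domin11].
pose E2 p := g (z0 p) - (B2 * e p ^+ 2 + B3 * e p ^+ 3).
have d_E2 : domin D W2 E2.
  exists C => p Dp; apply: (le_trans (ld_axis ld (e_dl Dp))).
  by rewrite ler_wpM2l ?C0// lerDl sqr_ge0.
pose E3 p := g1 (z0 p) - (n0 + n1 * e p).
have d_E3 : domin D W1 E3.
  exists C => p Dp; apply: (le_trans (ld_axis1 ld (e_dl Dp))).
  by rewrite ler_wpM2l ?C0// lerDl.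
pose E4 p := g3 (z0 p) - (m0 + m1 * e p).
have d_E4 : domin D W1 E4.
  exists C => p Dp; apply: (le_trans (ld_axis3 ld (e_dl Dp))).
  by rewrite ler_wpM2l ?C0// lerDl.
pose P p := a * e p ^+ 2 + b * t p + c * e p * t p + d * e p ^+ 3.
have d_P : domin D W1 P.
  apply: (domin_eq (Y := fun p => (a + d * e p) * e p ^+ 2 + (b + c * e p) * t p)).
    by move=> p _; rewrite /P; ring.
  by domin.
have d_tE4 : domin D W2 (fun p => t p * E4 p) by exact: domin11.
have d_PE3 : domin D W2 (fun p => P p * E3 p) by exact: domin11.
have d_e2t : domin D W2 (fun p => e p ^+ 2 * t p) by exact: domin11.
have d_e4 : domin D W2 (fun p => e p ^+ 2 * e p ^+ 2) by exact: domin11.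
have b_V : bddon D (fun p => (g1 (z0 p))^-1) by exact: bddon_g1V.
have : domin D W2 (fun p => ph p - P p).
  apply: (domin_eq (Y := fun p => (E1 p - E2 p - t p * E4 p - P p * E3 p
     - n1 * (c * (e p ^+ 2 * t p)) - n1 * (d * (e p ^+ 2 * e p ^+ 2))) * (g1 (z0 p))^-1)).
    move=> p Dp; have := g1_ge (cz0 Dp); have nn := n00 => h.
    rewrite /E1 /E2 /E3 /E4 /P /d /c /a /b.
    by field; rewrite !gt_eqF//; lra.
  by domin.
by move=> [M HM]; exists M => p Dp; exact: HM.
Qed.

Let Aorder : exists M, forall p, box del p ->
    `|A p.1 p.2 - 2 * a * p.1| <= M * (p.1 ^+ 2 + `|p.2|).
Proof.
pose e (p : R * R) := p.1.
have near0 gi : [\/ gi = g1, gi = g2 | gi = g3] ->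
    domin D W1 (fun p => gi (pt p) - gi (z0 p)).
  move=> gigi; apply: (domin_trans (W := fun p => C * (`|ph p| + `|p.2|))).
  - by move=> p _; apply: (mulr_ge0 C0); rewrite addr_ge0.
  - apply: domin_le => p Dp.
    have := ld_lip ld (cubeW (cz0 Dp)) (cubeW (pt_cube p)) gigi.
    by have [-> -> ->] := pt_coord Dp; rewrite !subr0 subrr normr0 addr0.
  - apply: dominMl; first exact: bddon_cst.
    apply: dominD; [have [M HM] := d_ph|have [M HM] := d_t]; exists M => p Dp;
    by rewrite normr_id; exact: HM.
pose E5 p := g2 (pt p) - g2 (z0 p).
have d_E5 : domin D W1 E5 by apply: near0; exact: Or32.
pose E6 p := g2 (z0 p) - 2 * B2 * e p.
have d_E6 : domin D W1 E6.
  exists C => p Dp; apply: (le_trans (ld_axis2 ld (e_dl Dp))).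
  by rewrite ler_wpM2l ?C0// lerDl.
pose E7 p := g1 (pt p) - g1 (z0 p).
have d_E7 : domin D W1 E7 by apply: near0; exact: Or31.
pose E8 p := g1 (z0 p) - (n0 + n1 * e p).
have d_E8 : domin D W1 E8.
  exists C => p Dp; apply: (le_trans (ld_axis1 ld (e_dl Dp))).
  by rewrite ler_wpM2l ?C0// lerDl.
have b_V : bddon D (fun p => (g1 (pt p))^-1) by apply: bddon_g1V => p _; exact: pt_cube.
have b_g3 : bddon D (fun p => g3 (pt p)).
  by apply: bddon_gi; [move=> p _; exact: pt_cube|exact: Or33].
have : domin D W1 (fun p => A p.1 p.2 - 2 * a * e p).
  apply: (domin_eq (Y := fun p => (- E5 p - E6 p + 4 * g3 (pt p) * ph p
     - (2 * a * e p) * (E7 p + E8 p) - (2 * a * n1) * e p ^+ 2) * (g1 (pt p))^-1)).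
    move=> p Dp; have := g1_ge (pt_cube p); have nn := n00 => h.
    rewrite /A -surjective_pairing -/(ph p) /E5 /E6 /E7 /E8 /a.
    by field; rewrite !gt_eqF//; lra.
  by domin.
by move=> [M HM]; exists M => p Dp; exact: HM.
Qed.

Lemma level_graph : exists phi A del M,
  graph_data phi A del M (- B2 / n0) (- m0 / n0)
    (- (m1 + n1 * (- m0 / n0)) / n0) (- (B3 + n1 * (- B2 / n0)) / n0) /\
  forall p, box del p -> cube dl (graph_pt phi p) /\ g (graph_pt phi p) = 0.
Proof.
have [M1 H1] := order1; have [M3 H3] := order3; have [M2 H2] := Aorder.
have [L L0 LA] := lipb_A.
have [d0 _ _] := delP.
pose M := 2 + L + `|M1| + `|M2| + `|M3|.
have n1' := normr_ge0 M1; have n2' := normr_ge0 M2; have n3' := normr_ge0 M3.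
exists phi, A, del, M; split; last first.
  by move=> p Dp; rewrite /graph_pt -(ptE Dp) g_pt; split => //; apply: cubeW; exact: pt_cube.
have up (x y z : R) : 0 <= z -> x <= y * z -> `|y| <= M -> x <= M * z.
  move=> z0' xy yM; apply: (le_trans xy); rewrite ler_wpM2r//.
  exact: le_trans (ler_norm _) yM.
split => //.
- by rewrite /M; lra.
- exact: measurable_lip lipb_phi.
- exact: measurable_lip lipb_A.
- by move=> p _; have := phi_le1 p; rewrite /M; lra.
- by move=> p _; rewrite (le_trans (LA p I).1)// /M; lra.
- move=> p q _ _; apply: (up _ L); rewrite ?addr_ge0//; first exact: (LA p I).2.
  by rewrite ger0_norm// /M; lra.
- move=> p q bp bq; apply: (up _ M1); rewrite ?addr_ge0 ?sqr_ge0//; first exact: H1.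
  by rewrite /M; lra.
- move=> p bp; apply: (up _ M3).
  + by rewrite addr_ge0 ?sqr_ge0// (exprM _ 2 2) sqr_ge0.
  + exact: H3.
  + by rewrite /M; lra.
- move=> p bp; apply: (up _ M2); rewrite ?addr_ge0 ?sqr_ge0//; first exact: H2.
  by rewrite /M; lra.
Qed.

End implicit_function.

(** * Taylor expansions along lines *)

Section partials.
Context {R : realType}.
Local Notation V := 'rV[R]_3.
Implicit Types (f : V -> R) (x y v w : V).

Definition partial (i : 'I_3) f : V -> R := 'D_(basis_vec R i) f.

(** A linear combination of partial derivatives rather than ['D_w f y]: iterating it with frozen
    vectors presents higher derivatives as explicit sums, accessible to [ring]. *)
Definition along w f y : R :=
  w 0 0 * partial 0 f y + w 0 1 * partial 1 f y + w 0 2 * partial 2 f y.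

Lemma ord3P (P : 'I_3 -> Prop) : P 0 -> P 1 -> P 2 -> forall i, P i.
Proof.
move=> P0 P1 P2 -[[|[|[|//]]] Hi].
- by rewrite (_ : Ordinal Hi = 0)//; apply/val_inj.
- by rewrite (_ : Ordinal Hi = 1)//; apply/val_inj.
- by rewrite (_ : Ordinal Hi = 2)//; apply/val_inj.
Qed.

Lemma row3E (a b c : R) :
  [/\ row3 a b c 0 0 = a, row3 a b c 0 1 = b & row3 a b c 0 2 = c].
Proof. by rewrite /row3 !mxE. Qed.

Lemma eq_row3 v w : v 0 0 = w 0 0 -> v 0 1 = w 0 1 -> v 0 2 = w 0 2 -> v = w.
Proof. by move=> h0 h1 h2; apply/rowP; apply: ord3P. Qed.

Lemma sum3 (W : zmodType) (F : 'I_3 -> W) : \sum_i F i = F 0 + F 1 + F 2.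
Proof.
rewrite !big_ord_recl big_ord0 addr0 addrA.
by congr (_ + F _ + F _); apply/val_inj.
Qed.

Lemma mx3_norm_le w (k : R) : 0 <= k -> (forall i, `|w 0 i| <= k) -> `|w| <= k.
Proof.
move=> k0 H; rewrite {1}/Num.norm/= mx_normrE; apply: bigmax_le => // -[i j] _ /=.
by rewrite (ord1 i); exact: H.
Qed.

Lemma derive_along f y w : differentiable f y -> 'D_w f y = along w f y.
Proof.
move=> df; rewrite /along /partial !deriveE//.
rewrite {1}(row_sum_delta w) sum3 linearD linearD !linearZ.
by [].
Qed.

Lemma is_derive_line f x w (s : R) (d : R) : is_derive (x + s *: w) w f d ->
  is_derive s (1 : R) (fun t => f (x + t *: w)) d.
Proof.
move=> [df <-].
have E : (fun h => h^-1 *: (((fun t => f (x + t *: w)) \o shift s) (h *: (1 : R)) - f (x + s *: w))) =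
  (fun h => h^-1 *: ((f \o shift (x + s *: w)) (h *: w) - f (x + s *: w))).
  apply/funext => h /=; congr (_ *: (f _ - _)).
  by rewrite scaler1 scalerDl addrCA.
by split; rewrite /derivable /derive E.
Qed.

Lemma is_derive_of_line f x w (d : R) :
  is_derive (0 : R) (1 : R) (fun t => f (x + t *: w)) d -> is_derive x w f d.
Proof.
have E : (fun h => h^-1 *: (((fun t => f (x + t *: w)) \o shift 0) (h *: (1 : R)) - f (x + 0 *: w))) =
  (fun h => h^-1 *: ((f \o shift x) (h *: w) - f x)).
  apply/funext => h /=; rewrite scale0r !addr0; congr (_ *: (f _ - _)).
  by rewrite scaler1 addrC.
by move=> [df <-]; move: df; split; rewrite /derivable /derive -E.
Qed.

Lemma is_derive_along f x w : differentiable f x -> is_derive x w f (along w f x).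
Proof.
by move=> df; split; [exact: diff_derivable|exact: derive_along].
Qed.

End partials.

Section taylor.
Context {R : realType}.
Local Notation V := 'rV[R]_3.
Implicit Types (f : V -> R) (x y z v w : V) (K : set V).

Definition cball x (k : R) : set V := [set z | `|z - x| <= k].

Lemma cball_segment x k y y' (t : R) : cball x k y -> cball x k y' -> 0 <= t <= 1 ->
  cball x k (y + t *: (y' - y)).
Proof.
rewrite /cball /= => hy hy' /andP[t0 t1].
rewrite (_ : _ - _ = (1 - t) *: (y - x) + t *: (y' - x)); last first.
  by apply/rowP => i; rewrite !mxE; ring.
apply: (le_trans (ler_normD _ _)); rewrite !normrZ ger0_norm ?subr_ge0// (ger0_norm t0).
rewrite (_ : k = (1 - t) * k + t * k); last by ring.
rewrite lerD// ler_wpM2l//.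
by rewrite subr_ge0.
Qed.

Lemma cball_center x k : 0 <= k -> cball x k x.
Proof. by move=> k0; rewrite /cball /= subrr normr0. Qed.

Lemma cball_line x k v (s t : R) : 0 <= k -> cball x k (x + s *: v) -> 0 <= t <= 1 ->
  cball x k (x + (t * s) *: v).
Proof.
move=> k0 h t01; have := cball_segment (cball_center x k0) h t01.
by rewrite addrAC subrr add0r scalerA.
Qed.

(** Differentiability to order n with all derivatives bounded on [K]; the Taylor constants are made
    from these bounds. *)
Fixpoint bdiff n K f : Prop :=
  (exists M, forall z, K z -> `|f z| <= M) /\
  match n with
  | 0 => True
  | n'.+1 => (forall z, K z -> differentiable f z) /\
             forall i, bdiff n' K (partial i f)
  end.

Lemma bdiffS n K f : bdiff n.+1 K f -> forall i, bdiff n K (partial i f).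
Proof. by move=> [_ []]. Qed.

Lemma bdiffW n K f : bdiff n.+1 K f -> bdiff n K f.
Proof.
elim: n f => [|n IH] f [bf [df pf]]; split => //; split => // i.
exact: IH.
Qed.

Lemma bdiff_sub n K K' f : K' `<=` K -> bdiff n K f -> bdiff n K' f.
Proof.
move=> KK'; elim: n f => [|n IH] f [[M bf] df].
  by split => //; exists M => z /KK' /bf.
move: df => [df pf]; split; first by exists M => z /KK' /bf.
by split => [z /KK' zK|i]; [exact: df|exact: IH (pf i)].
Qed.

Lemma nbhs_cball x U : open U -> U x -> exists2 k : R, 0 < k & cball x k `<=` U.
Proof.
move=> oU Ux; have /nbhs_ballP[e /= e0 eU] : nbhs x U by apply: open_nbhs_nbhs.
exists (e / 2); first exact: divr_gt0.
move=> z zx; apply: eU; rewrite -ball_normE/= distrC.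
by apply: (le_lt_trans zx); rewrite /= in e0; lra.
Qed.

Lemma cball_le x (k k' : R) : k <= k' -> cball x k `<=` cball x k'.
Proof. by move=> kk z; rewrite /cball /= => /le_trans; apply. Qed.

(** Each derivative is bounded near [x] by continuity at [x]; shrinking the ball finitely often
    stands in for compactness. *)
Lemma Ck_bdiff n U f x : open U -> U x -> Ck_on n U f ->
  exists2 k : R, 0 < k & cball x k `<=` U /\ bdiff n (cball x k) f.
Proof.
move=> oU Ux.
have bnd (h : V -> R) : {for x, continuous h} -> exists2 k : R, 0 < k & cball x k `<=` U /\
    exists M, forall z, cball x k z -> `|h z| <= M.
  move=> ch; have : nbhs x (h @^-1` [set y | `|h x - y| <= 1]).
    have F := (@cvgrPdist_le _ _ _ _ (nbhs_filter x) h (h x)).1 ch.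
    by apply: F; exact: ltr01.
  rewrite nbhsE => -[W [oW Wx] WS].
  have [k k0 kW] := nbhs_cball (openI oW oU) (conj Wx Ux).
  exists k => //; split; first by move=> z /kW[].
  exists (`|h x| + 1) => z /kW[/WS /= hz _].
  rewrite (_ : h z = h x - (h x - h z)); last by rewrite opprB addrC subrK.
  by rewrite (le_trans (ler_normB _ _))// lerD2l.
elim: n f => [|n IH] f.
  by move=> /(_ x Ux) /bnd[k k0 [kU bf]]; exists k.
move=> [df pf].
have [k k0 [kU bf]] := bnd f (differentiable_continuous (df x Ux)).
have [ki /all_and2[ki0 kiP]] := choice (fun i => let: ex_intro2 k a b := IH _ (pf i) in ex_intro _ k (conj a b)).
pose m := Num.min k (Num.min (ki 0) (Num.min (ki 1) (ki 2))).
have mk : m <= k by rewrite ge_min lexx.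
have mi i : m <= ki i by move: i; apply: ord3P; rewrite !ge_min lexx ?orbT.
exists m; first by rewrite !lt_min k0 !ki0.
split; first exact: (subset_trans (cball_le mk)).
split; first by have [M HM] := bf; exists M => z /(cball_le mk)/HM.
split; first by move=> z /(cball_le mk)/kU/df.
by move=> i; apply: bdiff_sub (kiP i).2; exact: cball_le.
Qed.

(** Raises the order of a Taylor estimate by one, integrating a bound on the derivative through the
    mean value theorem. The parameter [t] runs over [0, 1] so that both signs of [s] are treated at
    once. *)
Lemma cubic_step (h h' : R -> R) (C a0 a1 a2 s : R) n : 0 <= C ->
  (forall t : R, 0 <= t <= 1 -> is_derive (t * s) (1 : R) h (h' (t * s))) ->
  (forall t : R, 0 <= t <= 1 -> `|h' (t * s) - (a0 + a1 * (t * s) + a2 * (t * s) ^+ 2)| <= C * `|s| ^+ n) ->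
  `|h s - h 0 - (a0 * s + a1 / 2 * s ^+ 2 + a2 / 3 * s ^+ 3)| <= C * `|s| ^+ n.+1.
Proof.
move=> C0 dh bh.
pose F t := h (t * s) - (a0 * (t * s) + a1 / 2 * (t * s) ^+ 2 + a2 / 3 * (t * s) ^+ 3).
pose F' t := (h' (t * s) - (a0 + a1 * (t * s) + a2 * (t * s) ^+ 2)) * s.
have dF (t : R) : 0 <= t <= 1 -> is_derive t (1 : R) F (F' t).
  move=> t01; have dhs := dh t t01.
  have ds : is_derive t (1 : R) (fun t => t * s) s.
    by apply: is_derive_eq; rewrite /GRing.scale/=; ring.
  have := @is_derive1_comp _ h (fun t => t * s) t _ _ dhs ds => dht.
  by rewrite /F; apply: is_derive_eq; rewrite /F' /GRing.scale/=; field.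
have [||t t01] := @MVT_segment R F F' 0 1 ler01.
- by move=> t; rewrite in_itv/= => /andP[t0 t1]; apply: dF; rewrite !ltW.
- apply: derivable_within_continuous => t; rewrite in_itv/= => /dF[] //.
rewrite /F mul0r mul1r !expr0n !mulr0 !addr0 !subr0 mulr1 => E.
rewrite addrAC E /F' normrM (exprSr `|s|) (mulrA C) ler_wpM2r// bh//.
Qed.

Definition norm1 w : R := `|w 0 0| + `|w 0 1| + `|w 0 2|.

Lemma norm1_ge0 w : 0 <= norm1 w. Proof. by rewrite !addr_ge0. Qed.

Lemma along_le w f y (M : R) : (forall i, `|partial i f y| <= M) -> `|along w f y| <= M * norm1 w.
Proof.
move=> H; rewrite /along /norm1 !mulrDr.
have k i : `|w 0 i * partial i f y| <= M * `|w 0 i| by rewrite normrM mulrC ler_wpM2r.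
apply: (le_trans (ler_normD _ _)); rewrite lerD//.
by apply: (le_trans (ler_normD _ _)); rewrite lerD.
Qed.

Lemma bdiff_partials K f : bdiff 1 K f -> exists2 M, 0 <= M & forall z i, K z -> `|partial i f z| <= M.
Proof.
move=> /bdiffS pf.
have [M HM] := choice (fun i => (pf i).1).
exists (`|M 0| + `|M 1| + `|M 2|); first by rewrite !addr_ge0.
move=> z + Kz; apply: ord3P; apply: (le_trans (HM _ z Kz)); apply: (le_trans (ler_norm _)).
- by rewrite -addrA lerDl addr_ge0.
- by rewrite addrAC lerDr addr_ge0.
- by rewrite lerDr addr_ge0.
Qed.

Lemma along_sub v f y (X0 X1 X2 : R) :
  along v f y - (v 0 0 * X0 + v 0 1 * X1 + v 0 2 * X2) =
  v 0 0 * (partial 0 f y - X0) + v 0 1 * (partial 1 f y - X1) + v 0 2 * (partial 2 f y - X2).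
Proof.
rewrite /along; move: (partial 0 f y) (partial 1 f y) (partial 2 f y) => p0 p1 p2.
ring.
Qed.

Lemma lincomb2 (v0 v1 v2 p0 p1 p2 q0 q1 q2 r : R) :
  v0 * (p0 + q0 * r) + v1 * (p1 + q1 * r) + v2 * (p2 + q2 * r) =
  v0 * p0 + v1 * p1 + v2 * p2 + (v0 * q0 + v1 * q1 + v2 * q2) * r.
Proof. ring. Qed.

Lemma lincomb3 (v0 v1 v2 p0 p1 p2 q0 q1 q2 r0 r1 r2 r : R) :
  v0 * (p0 + q0 * r + r0 / 2 * r ^+ 2) + v1 * (p1 + q1 * r + r1 / 2 * r ^+ 2)
    + v2 * (p2 + q2 * r + r2 / 2 * r ^+ 2) =
  v0 * p0 + v1 * p1 + v2 * p2 + (v0 * q0 + v1 * q1 + v2 * q2) * r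
    + (v0 * r0 + v1 * r1 + v2 * r2) / 2 * r ^+ 2.
Proof. by field. Qed.

Section ball.
Variables (x : V) (k : R).
Hypothesis k0 : 0 <= k.
Local Notation K := (cball x k).

Lemma is_derive_path f y w (s : R) : bdiff 1 K f -> K (y + s *: w) ->
  is_derive s (1 : R) (fun t => f (y + t *: w)) (along w f (y + s *: w)).
Proof. by move=> [_ [df _]] Ks; apply: is_derive_line; apply: is_derive_along; exact: df. Qed.

Lemma bdiff_lip f : bdiff 1 K f -> exists2 M, 0 <= M &
  forall y y', K y -> K y' -> `|f y' - f y| <= M * norm1 (y' - y).
Proof.
move=> bf; have [M M0 HM] := bdiff_partials bf; exists M => // y y' Ky Ky'.
have := @cubic_step (fun t => f (y + t *: (y' - y))) (fun t => along (y' - y) f (y + t *: (y' - y)))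
  (M * norm1 (y' - y)) 0 0 0 1 0.
rewrite !mul0r !addr0 subr0 scale1r scale0r addr0 normr1 expr1n mulr1.
rewrite (addrC y) subrK; apply.
- by rewrite mulr_ge0// norm1_ge0.
- by move=> t t01; rewrite mulr1; apply: is_derive_path => //; exact: cball_segment.
- move=> t t01; rewrite !mulr1 !mul0r !addr0 subr0; apply: along_le => i; apply: HM.
  exact: cball_segment.
Qed.

Lemma bdiff_taylor2 f : bdiff 2 K f -> exists2 M, 0 <= M &
  forall y y', K y -> K y' -> `|f y' - f y - along (y' - y) f y| <= M * norm1 (y' - y) ^+ 2.
Proof.
move=> bf.
have /choice[M HM] i : exists M, 0 <= M /\ forall y y', K y -> K y' ->
    `|partial i f y' - partial i f y| <= M * norm1 (y' - y).
  by have [M M0 HM] := bdiff_lip (bdiffS bf i); exists M.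
exists (M 0 + M 1 + M 2); first by rewrite !addr_ge0//; exact: (HM _).1.
move=> y y' Ky Ky'; set w := y' - y.
have := @cubic_step (fun t => f (y + t *: w)) (fun t => along w f (y + t *: w))
  ((M 0 + M 1 + M 2) * norm1 w ^+ 2) (along w f y) 0 0 1 0.
rewrite !mul0r !addr0 scale1r scale0r addr0 normr1 expr1n !mulr1.
rewrite [y + w]addrC subrK; apply.
- by rewrite mulr_ge0 ?sqr_ge0// !addr_ge0//; exact: (HM _).1.
- move=> t t01; rewrite mulr1; apply: is_derive_path; first exact: bdiffW.
  exact: cball_segment.
- move=> t t01; rewrite !mulr1 !mul0r !addr0.
  have Kt := cball_segment Ky Ky' t01.
  have kt i : `|partial i f (y + t *: w) - partial i f y| <= M i * norm1 w.
    have [Mi0 /(_ y _ Ky Kt)] := HM i.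
    move=> /le_trans; apply; rewrite ler_wpM2l// addrAC subrr add0r.
    rewrite /norm1 !mxE !normrM -!mulrDr -[leRHS]mul1r ler_wpM2r ?norm1_ge0//.
    by rewrite ger0_norm//; case/andP: t01.
  have kw i : `|w 0 i * (partial i f (y + t *: w) - partial i f y)| <= M i * norm1 w ^+ 2.
    rewrite normrM expr2 mulrA mulrC ler_pM// /norm1.
    by move: i {kt}; apply: ord3P; [rewrite -addrA lerDl addr_ge0|
      rewrite addrAC lerDr addr_ge0|rewrite lerDr addr_ge0].
  rewrite [along w f y]/along along_sub.
  rewrite mulrDl mulrDl; apply: (le_trans (ler_normD _ _)); rewrite lerD//.
  by apply: (le_trans (ler_normD _ _)); rewrite lerD.
Qed.

Definition along2 v w f y : R :=
  v 0 0 * along w (partial 0 f) y + v 0 1 * along w (partial 1 f) y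
  + v 0 2 * along w (partial 2 f) y.

Definition along3 v f y : R :=
  v 0 0 * along2 v v (partial 0 f) y + v 0 1 * along2 v v (partial 1 f) y
  + v 0 2 * along2 v v (partial 2 f) y.

Lemma taylor_axis2 f v : bdiff 2 K f -> exists2 C, 0 <= C &
  forall s : R, K (x + s *: v) -> `|f (x + s *: v) - (f x + along v f x * s)| <= C * `|s| ^+ 2.
Proof.
move=> /bdiff_taylor2[M M0 HM]; exists (M * norm1 v ^+ 2).
  by rewrite mulr_ge0 ?sqr_ge0.
move=> s Ks; have := HM x _ (cball_center x k0) Ks.
rewrite (_ : x + s *: v - x = s *: v); last by rewrite addrAC subrr add0r.
have -> : along (s *: v) f x = along v f x * s by rewrite /along !mxE -!mulrA -!mulrDr mulrC.
have -> : norm1 (s *: v) = norm1 v * `|s| by rewrite /norm1 !mxE !normrM; ring.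
by rewrite exprMn mulrA opprD addrA.
Qed.

Lemma sum_bound v (X : 'I_3 -> R) (C : 'I_3 -> R) (b : R) : 0 <= b ->
  (forall i, `|X i| <= C i * b) ->
  `|v 0 0 * X 0 + v 0 1 * X 1 + v 0 2 * X 2| <=
   (`|v 0 0| * C 0 + `|v 0 1| * C 1 + `|v 0 2| * C 2) * b.
Proof.
move=> b0 XC; have Xi i : `|v 0 i * X i| <= `|v 0 i| * C i * b by rewrite normrM -mulrA ler_wpM2l.
rewrite !mulrDl; apply: (le_trans (ler_normD _ _)); rewrite lerD//.
by apply: (le_trans (ler_normD _ _)); rewrite lerD.
Qed.

(** Induction on the order: the previous estimate, applied to each partial derivative, expands the
    derivative along the line, and [cubic_step] integrates it. [taylor_axis4] repeats the step. *)
Lemma taylor_axis3 f v : bdiff 3 K f -> exists2 C, 0 <= C &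
  forall s : R, K (x + s *: v) ->
  `|f (x + s *: v) - (f x + along v f x * s + along2 v v f x / 2 * s ^+ 2)| <= C * `|s| ^+ 3.
Proof.
move=> bf.
have /choice[C HC] i : exists C, 0 <= C /\ forall s : R, K (x + s *: v) ->
    `|partial i f (x + s *: v) - (partial i f x + along v (partial i f) x * s)| <= C * `|s| ^+ 2.
  by have [C C0 HC] := taylor_axis2 v (bdiffS bf i); exists C.
exists (`|v 0 0| * C 0 + `|v 0 1| * C 1 + `|v 0 2| * C 2).
  by rewrite !addr_ge0// mulr_ge0//; exact: (HC _).1.
move=> s Ks.
have := @cubic_step (fun t => f (x + t *: v)) (fun t => along v f (x + t *: v))
  (`|v 0 0| * C 0 + `|v 0 1| * C 1 + `|v 0 2| * C 2) (along v f x) (along2 v v f x) 0 s 2.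
rewrite scale0r addr0 !mul0r addr0 => H.
rewrite -(addrA (f x)) opprD addrA; apply: H.
- by rewrite !addr_ge0// mulr_ge0//; exact: (HC _).1.
- move=> t t01; apply: is_derive_path; first by apply: bdiffW; exact: bdiffW.
  exact: cball_line.
- move=> t t01; have Kt := cball_line k0 Ks t01; rewrite mul0r addr0.
  have := @sum_bound v (fun i => partial i f (x + (t * s) *: v) -
    (partial i f x + along v (partial i f) x * (t * s))) C (`|s| ^+ 2).
  rewrite exprn_ge0// => /(_ isT) H.
  have <- : v 0 0 * (partial 0 f x + along v (partial 0 f) x * (t * s)) +
    v 0 1 * (partial 1 f x + along v (partial 1 f) x * (t * s)) +
    v 0 2 * (partial 2 f x + along v (partial 2 f) x * (t * s)) =
    along v f x + along2 v v f x * (t * s).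
    rewrite /along2 [along v f x]/along.
    exact: lincomb2.
  rewrite along_sub; apply: H.
  move=> i; apply: (le_trans ((HC i).2 _ Kt)); rewrite ler_wpM2l ?(HC i).1//.
  have /andP[t0 t1] := t01; rewrite lerXn2r ?nnegrE// normrM (ger0_norm t0).
  by rewrite ler_piMl.
Qed.

Lemma taylor_axis4 f v : bdiff 4 K f -> exists2 C, 0 <= C &
  forall s : R, K (x + s *: v) ->
  `|f (x + s *: v) - (f x + along v f x * s + along2 v v f x / 2 * s ^+ 2 +
     along3 v f x / 6 * s ^+ 3)| <= C * `|s| ^+ 4.
Proof.
move=> bf.
have /choice[C HC] i : exists C, 0 <= C /\ forall s : R, K (x + s *: v) ->
    `|partial i f (x + s *: v) - (partial i f x + along v (partial i f) x * s
       + along2 v v (partial i f) x / 2 * s ^+ 2)| <= C * `|s| ^+ 3.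
  by have [C C0 HC] := taylor_axis3 v (bdiffS bf i); exists C.
exists (`|v 0 0| * C 0 + `|v 0 1| * C 1 + `|v 0 2| * C 2).
  by rewrite !addr_ge0// mulr_ge0//; exact: (HC _).1.
move=> s Ks.
have := @cubic_step (fun t => f (x + t *: v)) (fun t => along v f (x + t *: v))
  (`|v 0 0| * C 0 + `|v 0 1| * C 1 + `|v 0 2| * C 2) (along v f x) (along2 v v f x)
  (along3 v f x / 2) s 3.
rewrite scale0r addr0 (_ : along3 v f x / 2 / 3 = along3 v f x / 6); last by field.
move=> H; rewrite -!(addrA (f x)) opprD addrA; apply: H.
- by rewrite !addr_ge0// mulr_ge0//; exact: (HC _).1.
- move=> t t01; apply: is_derive_path; first by do 2 apply: bdiffW; exact: bdiffW.
  exact: cball_line.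
- move=> t t01; have Kt := cball_line k0 Ks t01.
  have := @sum_bound v (fun i => partial i f (x + (t * s) *: v) -
    (partial i f x + along v (partial i f) x * (t * s) +
     along2 v v (partial i f) x / 2 * (t * s) ^+ 2)) C (`|s| ^+ 3).
  rewrite exprn_ge0// => /(_ isT) H.
  have <- : v 0 0 * (partial 0 f x + along v (partial 0 f) x * (t * s) + along2 v v (partial 0 f) x / 2 * (t * s) ^+ 2) +
    v 0 1 * (partial 1 f x + along v (partial 1 f) x * (t * s) + along2 v v (partial 1 f) x / 2 * (t * s) ^+ 2) +
    v 0 2 * (partial 2 f x + along v (partial 2 f) x * (t * s) + along2 v v (partial 2 f) x / 2 * (t * s) ^+ 2) =
    along v f x + along2 v v f x * (t * s) + along3 v f x / 2 * (t * s) ^+ 2.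
    rewrite /along3 [along2 v v f x]/along2 [along v f x]/along.
    exact: lincomb3.
  rewrite along_sub; apply: H.
  move=> i; apply: (le_trans ((HC i).2 _ Kt)); rewrite ler_wpM2l ?(HC i).1//.
  have /andP[t0 t1] := t01; rewrite lerXn2r ?nnegrE// normrM (ger0_norm t0).
  by rewrite ler_piMl.
Qed.

End ball.
End taylor.

(** * Charts of the Heisenberg group *)

Section chart.
Context {R : realType}.
Local Notation V := 'rV[R]_3.
Variables (c1 c2 c3 co si : R).
Hypothesis cs : co ^+ 2 + si ^+ 2 = 1.

Let al : R := 2 * (co * c2 - si * c1).
Let be : R := - (2 * (si * c2 + co * c1)).

(* The rotated horizontal frame [co X1 + si X2], [- si X1 + co X2] at the
   center of the chart. *)
Definition frame1 : V := row3 co si al.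
Definition frame2 : V := row3 (- si) co be.

(** In rotated coordinates at the centre this is the group product of (0, eta, tau) and (phi, 0, 0):
    phi is followed along the normal horizontal field. That product creates the term
    [2 * z.1.2 * z.1.1]. *)
Definition chart (z : R * R * R) : V :=
  row3 (c1 + z.1.1 * co - z.1.2 * si) (c2 + z.1.1 * si + z.1.2 * co)
    (c3 + z.1.1 * al + z.1.2 * be + z.2 + 2 * z.1.2 * z.1.1).

Definition unchart (y : V) : R * R * R :=
  let f := co * (y 0 0 - c1) + si * (y 0 1 - c2) in
  let e := co * (y 0 1 - c2) - si * (y 0 0 - c1) in
  (f, e, y 0 2 - c3 - f * al - e * be - 2 * e * f).

Lemma chartE z : [/\ chart z 0 0 = c1 + z.1.1 * co - z.1.2 * si,
  chart z 0 1 = c2 + z.1.1 * si + z.1.2 * co &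
  chart z 0 2 = c3 + z.1.1 * al + z.1.2 * be + z.2 + 2 * z.1.2 * z.1.1].
Proof. exact: row3E. Qed.

Lemma unchartK : cancel unchart chart.
Proof.
move=> y; have [h0 h1 h2] := chartE (unchart y).
apply: eq_row3; rewrite ?h0 ?h1 ?h2 /unchart /=; clear h0 h1 h2;
  move: (y 0 0) (y 0 1) (y 0 2) => y0 y1 y2.
- by rewrite (_ : _ - _ = c1 + (co ^+ 2 + si ^+ 2) * (y0 - c1)); [rewrite cs; ring|ring].
- by rewrite (_ : _ + _ = c2 + (co ^+ 2 + si ^+ 2) * (y1 - c2)); [rewrite cs; ring|ring].
- ring.
Qed.

Lemma chart_axis e : chart (0, e, 0) = row3 c1 c2 c3 + e *: frame2.
Proof.
have [h0 h1 h2] := chartE (0, e, 0); have [g0 g1 g2] := row3E c1 c2 c3.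
have [f0 f1 f2] := row3E (- si) co be.
have E (a b : V) i : (a + e *: b) 0 i = a 0 i + e * b 0 i by rewrite !mxE.
by apply: eq_row3; rewrite E ?h0 ?h1 ?h2 ?g0 ?g1 ?g2 /frame2 ?f0 ?f1 ?f2 /=; ring.
Qed.

Lemma chart0 : chart (0, 0, 0) = row3 c1 c2 c3.
Proof. by rewrite chart_axis scale0r addr0. Qed.

(** Left translations and rotations about the vertical axis are isometries; as polynomials the two
    sides agree modulo co^2 + si^2 = 1. *)
Lemma hdist_chart z z' : hdist (chart z) (chart z') ^+ 4 = korK z z'.
Proof.
rewrite /hdist hnorm4E /hmul /hinv.
have [-> -> ->] := row3E ((- chart z) 0 0 + chart z' 0 0) ((- chart z) 0 1 + chart z' 0 1)
  ((- chart z) 0 2 + chart z' 0 2 - 2 * (- chart z) 0 0 * chart z' 0 1 + 2 * (- chart z) 0 1 * chart z' 0 0).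
have E (a : V) i : (- a) 0 i = - a 0 i by rewrite mxE.
rewrite !E.
have [-> -> ->] := chartE z; have [-> -> ->] := chartE z'.
rewrite /korK.
move: z z' => [[f e] t] [[f' e'] t'] /=.
rewrite /al /be.
set X := f' - f; set Y := e' - e.
congr (_ ^+ 2 + _ ^+ 2).
  rewrite [RHS](_ : _ = (co ^+ 2 + si ^+ 2) * (X ^+ 2 + Y ^+ 2)); last by rewrite cs mul1r.
  by rewrite /X /Y; ring.
rewrite [RHS](_ : _ = t' - t + 2 * (e' * f' - e * f) + 2 * (co ^+ 2 + si ^+ 2) * (e' * f - e * f')); last first.
  by rewrite cs /X /Y; ring.
rewrite /X /Y.
ring.
Qed.

Let K : R := 5 + `|al| + `|be|.

Let K5 : 5 <= K. Proof. by have := normr_ge0 al; have := normr_ge0 be; rewrite /K; lra. Qed.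

Let ds (z' z : R * R * R) := `|z'.1.1 - z.1.1| + `|z'.1.2 - z.1.2| + `|z'.2 - z.2|.

Let ds0 z' z : 0 <= ds z' z. Proof. by rewrite !addr_ge0. Qed.

Lemma rot_le1 : `|co| <= 1 /\ `|si| <= 1.
Proof.
have := cs; have := sqr_ge0 co; have := sqr_ge0 si => h1 h2 h3.
by split; rewrite -(@ler_sqr _ `|_|) ?nnegrE// expr1n real_normK ?num_real//; lra.
Qed.

Lemma chart_diff z z' : [/\ (chart z' - chart z) 0 0 = (z'.1.1 - z.1.1) * co - (z'.1.2 - z.1.2) * si,
  (chart z' - chart z) 0 1 = (z'.1.1 - z.1.1) * si + (z'.1.2 - z.1.2) * co &
  (chart z' - chart z) 0 2 = (z'.1.1 - z.1.1) * al + (z'.1.2 - z.1.2) * be + (z'.2 - z.2)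
    + 2 * (z'.1.2 * z'.1.1 - z.1.2 * z.1.1)].
Proof.
have E (a b : V) i : (a - b) 0 i = a 0 i - b 0 i by rewrite !mxE.
have [h0 h1 h2] := chartE z; have [h0' h1' h2'] := chartE z'.
by rewrite !E h0 h1 h2 h0' h1' h2'; split; ring.
Qed.

Lemma norm1_chart z z' : cube 1 z -> cube 1 z' -> norm1 (chart z' - chart z) <= K * ds z' z.
Proof.
move=> [a1 a2 a3] [b1 b2 b3]; have [co1 si1] := rot_le1.
rewrite /norm1; have [-> -> ->] := chart_diff z z'.
rewrite (_ : z'.1.2 * z'.1.1 - z.1.2 * z.1.1 =
  (z'.1.2 - z.1.2) * z'.1.1 + z.1.2 * (z'.1.1 - z.1.1)); last by ring.
rewrite /ds; set X := z'.1.1 - z.1.1; set Y := z'.1.2 - z.1.2; set T := z'.2 - z.2.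
have m (p q b : R) : `|q| <= b -> `|p * q| <= b * `|p|.
  by move=> h; rewrite normrM mulrC ler_wpM2r.
have t (p q a b : R) : `|p| <= a -> `|q| <= b -> `|p + q| <= a + b.
  by move=> ha hb; rewrite (le_trans (ler_normD _ _))// lerD.
have h0 : `|X * co - Y * si| <= 1 * `|X| + 1 * `|Y|.
  by apply: t; [exact: m|rewrite normrN; exact: m].
have h1 : `|X * si + Y * co| <= 1 * `|X| + 1 * `|Y| by apply: t; exact: m.
have h2 : `|X * al + Y * be + T + 2 * (Y * z'.1.1 + z.1.2 * X)| <=
    `|al| * `|X| + `|be| * `|Y| + `|T| + 2 * (1 * `|Y| + 1 * `|X|).
  apply: (t _ _ _ _ _ _); first by apply: (t _ _ _ _ _ _) => //; apply: (t _ _ _ _ _ _); exact: m.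
  rewrite normrM ger0_norm// ler_wpM2l//; apply: t; first exact: m.
  by rewrite mulrC; exact: m.
have p1 : 0 <= `|al| * (`|Y| + `|T|) by rewrite mulr_ge0// addr_ge0.
have p2 : 0 <= `|be| * (`|X| + `|T|) by rewrite mulr_ge0// addr_ge0.
have x0 := normr_ge0 X; have y0 := normr_ge0 Y; have t0 := normr_ge0 T.
rewrite /K; lra.
Qed.

Lemma norm_le_norm1 (w : V) : `|w| <= norm1 w.
Proof.
apply: mx3_norm_le; first exact: norm1_ge0.
by rewrite /norm1; apply: ord3P; [rewrite -addrA lerDl addr_ge0|
      rewrite addrAC lerDr addr_ge0|rewrite lerDr addr_ge0].
Qed.

Section level.
Variables (u : V -> R) (k : R).
Hypothesis k0 : 0 < k.
Local Notation x := (row3 c1 c2 c3).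
Hypothesis bu : bdiff 4 (cball x k) u.

(** On the unit cube the chart is [K]-Lipschitz for the sum of coordinate differences, which is at
    most 3 dl from the centre; [K * (3 * dl) <= k] keeps the image in the ball. *)
Definition chart_radius : R := Num.min 1 (k / (3 * K)).
Local Notation dl := chart_radius.

Let dlP : [/\ 0 < dl, dl <= 1 & K * (3 * dl) <= k].
Proof.
have K0 : 0 < 3 * K by have := K5; lra.
have d0 : 0 < dl by rewrite lt_min ltr01 divr_gt0.
split => //; first by rewrite ge_min lexx.
have : dl * (3 * K) <= k by rewrite -ler_pdivlMr// ge_min lexx orbT.
by lra.
Qed.

Let cube1 z : cube dl z -> cube 1 z.
Proof. by have [_ h _] := dlP; move=> [h1 h2 h3]; split; lra. Qed.

Lemma chart_cball z : cube dl z -> cball x k (chart z).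
Proof.
move=> cz; have [d0 d1 d2] := dlP; have [h1 h2 h3] := cz.
have c0 : cube 1 ((0, 0, 0) : R * R * R) by split; rewrite /= normr0.
rewrite /cball /= -chart0 (le_trans (norm_le_norm1 _))//.
apply: (le_trans (norm1_chart c0 (cube1 cz))); rewrite /ds /= !subr0.
apply: le_trans d2; rewrite ler_wpM2l//; have := K5; lra.
Qed.

(** The partial derivatives of [u \o chart]; their second summands come from the bilinear term of
    the chart. *)
Definition level1 z := along frame1 u (chart z) + 2 * z.1.2 * partial 2 u (chart z).
Definition level2 z := along frame2 u (chart z) + 2 * z.1.1 * partial 2 u (chart z).
Definition level3 z := partial 2 u (chart z).

Let frameE : [/\ frame1 0 0 = co, frame1 0 1 = si & frame1 0 2 = al] /\
  [/\ frame2 0 0 = - si, frame2 0 1 = co & frame2 0 2 = be].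
Proof. by split; exact: row3E. Qed.

Lemma along_chart z z' : along (chart z' - chart z) u (chart z) =
  (z'.1.1 - z.1.1) * level1 z + (z'.1.2 - z.1.2) * level2 z + (z'.2 - z.2) * level3 z
  + 2 * (z'.1.1 - z.1.1) * (z'.1.2 - z.1.2) * partial 2 u (chart z).
Proof.
rewrite /level1 /level2 /level3 /along; have [[-> -> ->] [-> -> ->]] := frameE.
have [-> -> ->] := chart_diff z z'.
move: (partial 0 u _) (partial 1 u _) (partial 2 u _) => p0 p1 p2.
ring.
Qed.

Let lip := lipb (cube dl) ds.

Let lip_partial i : lip (fun z => partial i u (chart z)).
Proof.
have bi : bdiff 1 (cball x k) (partial i u) by do 2 apply: bdiffW; exact: bdiffS.
have [M HM] := bi.1; have [L L0 HL] := bdiff_lip bi.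
have Kp : 0 <= K by have := K5; lra.
exists (`|M| + L * K); first by rewrite addr_ge0// mulr_ge0.
move=> z cz; split.
  apply: (le_trans (HM _ (chart_cball cz))); apply: (le_trans (ler_norm M)).
  by rewrite lerDl mulr_ge0.
move=> z' cz'; apply: (le_trans (HL _ _ (chart_cball cz') (chart_cball cz))).
apply: (@le_trans _ _ (L * (K * ds z z'))).
  by rewrite ler_wpM2l// norm1_chart//; exact: cube1.
by rewrite mulrA ler_wpM2r// lerDr.
Qed.

Let lip1 : lip (fun z => z.1.1).
Proof.
exists 1 => // z cz; have [h _ _] := cube1 cz; split => // z' _.
by rewrite mul1r /ds -addrA lerDl addr_ge0.
Qed.

Let lip2 : lip (fun z => z.1.2).
Proof.
exists 1 => // z cz; have [_ h _] := cube1 cz; split => // z' _.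
by rewrite mul1r /ds addrAC lerDr addr_ge0.
Qed.

Let lip_along w : lip (fun z => along w u (chart z)).
Proof.
apply: (lipbD (F := fun z => w 0 0 * partial 0 u (chart z) + w 0 1 * partial 1 u (chart z))
  (G := fun z => w 0 2 * partial 2 u (chart z))).
  apply: (lipbD (F := fun z => w 0 0 * partial 0 u (chart z)) (G := fun z => w 0 1 * partial 1 u (chart z))).
    exact: (lipbM ds0 (lipb_cst _ ds0 _) (lip_partial 0)).
  exact: (lipbM ds0 (lipb_cst _ ds0 _) (lip_partial 1)).
exact: (lipbM ds0 (lipb_cst _ ds0 _) (lip_partial 2)).
Qed.

Let lip_level : [/\ lip level1, lip level2 & lip level3].
Proof.
split.
- apply: (lipbD (lip_along frame1) (G := fun z => 2 * z.1.2 * partial 2 u (chart z))).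
  exact: (lipbM ds0 (lipbM ds0 (lipb_cst _ ds0 _) lip2) (lip_partial 2)).
- apply: (lipbD (lip_along frame2) (G := fun z => 2 * z.1.1 * partial 2 u (chart z))).
  exact: (lipbM ds0 (lipbM ds0 (lipb_cst _ ds0 _) lip1) (lip_partial 2)).
- exact: (lip_partial 2).
Qed.

Let taylor : exists2 C, 0 <= C & forall z z', cube dl z -> cube dl z' ->
    `|u (chart z') - u (chart z) - ((z'.1.1 - z.1.1) * level1 z + (z'.1.2 - z.1.2) * level2 z + (z'.2 - z.2) * level3 z)| <=
    C * ((z'.1.1 - z.1.1) ^+ 2 + (z'.1.2 - z.1.2) ^+ 2 + (z'.2 - z.2) ^+ 2).
Proof.
have [C C0 HC] : exists2 C, 0 <= C & forall y y', cball x k y -> cball x k y' ->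
    `|u y' - u y - along (y' - y) u y| <= C * norm1 (y' - y) ^+ 2.
  by apply: bdiff_taylor2; do 2 apply: bdiffW.
have [B B0 HB] : exists2 B, 0 <= B & forall z i, cball x k z -> `|partial i u z| <= B.
  by apply: bdiff_partials; do 3 apply: bdiffW.
exists (3 * C * K ^+ 2 + B); first by rewrite addr_ge0// mulr_ge0 ?sqr_ge0// mulr_ge0.
move=> z z' cz cz'; have := HC _ _ (chart_cball cz) (chart_cball cz').
have := HB _ 2 (chart_cball cz); have := norm1_chart (cube1 cz) (cube1 cz').
rewrite along_chart /ds; set N := norm1 _; have N0 : 0 <= N by exact: norm1_ge0.
set W := _ * level1 z + _ + _; set p := partial 2 u _.
set X := z'.1.1 - z.1.1; set Y := z'.1.2 - z.1.2; set T := z'.2 - z.2.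
move=> HN Hp HT.
rewrite (_ : _ - W = (u (chart z') - u (chart z) - (W + 2 * X * Y * p)) + 2 * X * Y * p); last by ring.
apply: (le_trans (ler_normD _ _)); rewrite (mulrDl (3 * C * K ^+ 2)) lerD//.
  apply: (le_trans HT); rewrite (mulrC 3) -!mulrA ler_wpM2l//.
  apply: (@le_trans _ _ ((K * (`|X| + `|Y| + `|T|)) ^+ 2)).
    by rewrite lerXn2r ?nnegrE// (le_trans _ HN).
  have hS : (`|X| + `|Y| + `|T|) ^+ 2 <= 3 * (X ^+ 2 + Y ^+ 2 + T ^+ 2).
    rewrite -(real_normK (num_real X)) -(real_normK (num_real Y)) -(real_normK (num_real T)).
    have := sqr_ge0 (`|X| - `|Y|); have := sqr_ge0 (`|X| - `|T|); have := sqr_ge0 (`|Y| - `|T|).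
    lra.
  have := ler_wpM2l (sqr_ge0 K) hS; lra.
have hXY : `|2 * X * Y| <= X ^+ 2 + Y ^+ 2 + T ^+ 2.
  rewrite ler_norml.
  have := sqr_ge0 (X - Y); have := sqr_ge0 (X + Y); have := sqr_ge0 T.
  by move=> h1 h2 h3; apply/andP; split; lra.
rewrite normrM [leLHS]mulrC.
exact: ler_pM.
Qed.

Hypothesis u0 : u x = 0.
Hypothesis u2 : along frame2 u x = 0.
Hypothesis u1 : 0 < along frame1 u x.

Let axis_cball e : `|e| <= dl -> cball x k (x + e *: frame2).
Proof.
move=> he; rewrite -chart_axis; apply: chart_cball; have [d0 _ _] := dlP.
by split => //=; rewrite normr0 ltW.
Qed.

(** The eta-axis is the straight line [chart_axis], so the axis expansions are Taylor expansions of
    [u] and its partials on it. The summand [2 * partial 2 u x] in the slope of [level1] comes from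
    its explicit factor [2 * z.1.2]. *)
Lemma chart_level_data : exists C, level_data (u \o chart) level1 level2 level3 dl C
  (along frame1 u x) (along2 frame1 frame2 u x + 2 * partial 2 u x)
  (partial 2 u x) (along frame2 (partial 2 u) x)
  (along2 frame2 frame2 u x / 2) (along3 frame2 u x / 6).
Proof.
have [d0 d1 _] := dlP.
pose D : set R := [set e | `|e| <= dl].
pose W (e : R) := e ^+ 2.
pose X i e := partial i u (x + e *: frame2) - (partial i u x + along frame2 (partial i u) x * e).
have d_X i : domin D W (X i).
  have bi : bdiff 2 (cball x k) (partial i u) by apply: bdiffW; exact: bdiffS.
  have [C C0 HC] := taylor_axis2 (ltW k0) frame2 bi.
  exists C => e /axis_cball /HC; by rewrite real_normK ?num_real.
have b_e : bddon D id by exists dl => e.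
have d_e2 : domin D W (fun e => e ^+ 2) by apply: domin_le => e _; rewrite ger0_norm ?sqr_ge0.
have d_along w : domin D W (fun e => w 0 0 * X 0 e + w 0 1 * X 1 e + w 0 2 * X 2 e).
  have := d_X 0; have := d_X 1; have := d_X 2 => d2 d1' d0'.
  by apply: dominD; [apply: dominD|]; apply: dominMl => //; exact: bddon_cst.
have partialE i e : partial i u (x + e *: frame2) =
    partial i u x + along frame2 (partial i u) x * e + X i e.
  by rewrite /X [RHS]addrC subrK.
have aux0 (w0 w1 w2 p0 p1 p2 q0 q1 q2 r0 r1 r2 e : R) :
    w0 * (p0 + q0 * e + r0) + w1 * (p1 + q1 * e + r1) + w2 * (p2 + q2 * e + r2) =
    w0 * p0 + w1 * p1 + w2 * p2 + (w0 * q0 + w1 * q1 + w2 * q2) * e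
      + (w0 * r0 + w1 * r1 + w2 * r2) by ring.
have alongE w e : along w u (x + e *: frame2) = along w u x + along2 w frame2 u x * e
    + (w 0 0 * X 0 e + w 0 1 * X 1 e + w 0 2 * X 2 e).
  rewrite /along2 [along w u _]/along [along w u x]/along !partialE.
  exact: aux0.
have aux (A1 A2 A3 A4 S X2 e : R) : A2 + A1 * e + S + 2 * e * (A4 + A3 * e + X2)
    - (A2 + (A1 + 2 * A4) * e) = S + 2 * e * X2 + 2 * A3 * e ^+ 2 by ring.
have [C1 H1] : domin D W (fun e => level1 (0, e, 0) -
    (along frame1 u x + (along2 frame1 frame2 u x + 2 * partial 2 u x) * e)).
  apply: (domin_eq (Y := fun e => (frame1 0 0 * X 0 e + frame1 0 1 * X 1 e + frame1 0 2 * X 2 e)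
     + (2 * e) * X 2 e + 2 * along frame2 (partial 2 u) x * e ^+ 2)).
    move=> e De; rewrite /level1 chart_axis alongE /= partialE.
    exact: aux.
  apply: (dominD (X := fun e => _) (Y := fun e => _ * e ^+ 2)).
    apply: (dominD (X := fun e => _) (Y := fun e => 2 * e * X 2 e)); first exact: d_along.
    apply: (dominMl (X := fun e => 2 * e) (Y := X 2)) => //.
    by apply: (bddonM (F := fun=> 2) (G := id)) => //; exact: bddon_cst.
  by apply: (dominMl (X := fun e => _) (Y := fun e => e ^+ 2)) => //; exact: bddon_cst.
have aux2 (A S p e : R) : 0 + A * e + S + 2 * 0 * p - 2 * (A / 2) * e = S by field.
have [C2 H2] : domin D W (fun e => level2 (0, e, 0) - 2 * (along2 frame2 frame2 u x / 2) * e).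
  apply: (domin_eq (Y := fun e => frame2 0 0 * X 0 e + frame2 0 1 * X 1 e + frame2 0 2 * X 2 e)); last exact: d_along.
  by move=> e De; rewrite /level2 chart_axis alongE /= u2; exact: aux2.
have [C3 H3] : domin D W (fun e => level3 (0, e, 0) -
   (partial 2 u x + along frame2 (partial 2 u) x * e)).
  by apply: domin_eq (d_X 2) => e De; rewrite /level3 chart_axis.
have [C4 C40 H4] := taylor_axis4 (ltW k0) frame2 bu.
have [C5 C50 H5] := taylor.
have [[L1 L10 HL1] [L2 L20 HL2] [L3 L30 HL3]] := lip_level.
pose C := `|C1| + `|C2| + `|C3| + C4 + C5 + L1 + L2 + L3.
have n1 := normr_ge0 C1; have n2 := normr_ge0 C2; have n3 := normr_ge0 C3.
have up (X' Y Z : R) : 0 <= Z -> X' <= Y * Z -> `|Y| <= C -> X' <= C * Z.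
  move=> Z0 XY YC; apply: (le_trans XY); rewrite ler_wpM2r//.
  exact: le_trans (ler_norm _) YC.
exists C; split => //.
- by rewrite /C; lra.
- move=> z z' cz cz'; apply: (up _ C5); first by rewrite !addr_ge0 ?sqr_ge0.
    exact: H5.
  by rewrite ger0_norm// /C; lra.
- move=> z z' cz cz' gi gigi.
  have c0 : 0 <= ds z' z by exact: ds0.
  have [l1 l2 l3] : [/\ `|L1| <= C, `|L2| <= C & `|L3| <= C].
    by rewrite !ger0_norm// /C; split; lra.
  case: gigi => ->.
  + exact: up c0 ((HL1 _ cz').2 _ cz) l1.
  + exact: up c0 ((HL2 _ cz').2 _ cz) l2.
  + exact: up c0 ((HL3 _ cz').2 _ cz) l3.
- move=> e De; rewrite /= chart_axis.
  apply: (up _ C4); first by rewrite (exprM _ 2 2) sqr_ge0.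
    have := H4 e (axis_cball De); rewrite u0 u2 mul0r !add0r (exprM `|e| 2 2) real_normK ?num_real//.
    by rewrite -exprM.
  by rewrite ger0_norm// /C; lra.
- move=> e De; apply: (up _ C1); [exact: sqr_ge0|exact: H1|rewrite /C; lra].
- move=> e De; apply: (up _ C2); [exact: sqr_ge0|exact: H2|rewrite /C; lra].
- move=> e De; apply: (up _ C3); [exact: sqr_ge0|exact: H3|rewrite /C; lra].
Qed.

End level.
End chart.

(** * Curvatures *)

Section curvature.
Context {R : realType}.
Local Notation V := 'rV[R]_3.
Implicit Types (x w y : V) (f P Q : V -> R).

Lemma is_derive_coord x w i : is_derive x w (fun y : V => y 0 i) (w 0 i).
Proof.
apply: is_derive_of_line.
have -> : (fun t => (x + t *: w) 0 i) = (fun t => x 0 i + t * w 0 i).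
  by apply/funext => t; rewrite !mxE.
by apply: is_derive_eq; rewrite /GRing.scale/=; ring.
Qed.

Lemma is_derive_norm2 x w P Q (dP dQ : R) : 0 < P x ^+ 2 + Q x ^+ 2 ->
  is_derive x w P dP -> is_derive x w Q dQ ->
  is_derive x w (fun y => Num.sqrt (P y ^+ 2 + Q y ^+ 2))
    ((P x * dP + Q x * dQ) / Num.sqrt (P x ^+ 2 + Q x ^+ 2)).
Proof.
move=> N0 hP hQ; apply: is_derive_of_line.
have x0 : x + 0 *: w = x by rewrite scale0r addr0.
have hP' : is_derive (0 : R) (1 : R) (fun t => P (x + t *: w)) dP.
  by apply: is_derive_line; rewrite x0.
have hQ' : is_derive (0 : R) (1 : R) (fun t => Q (x + t *: w)) dQ.
  by apply: is_derive_line; rewrite x0.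
have hS : is_derive (0 : R) (1 : R) (fun t => P (x + t *: w) ^+ 2 + Q (x + t *: w) ^+ 2)
    (2 * (P x * dP + Q x * dQ)).
  by apply: is_derive_eq; rewrite /GRing.scale/= x0; ring.
have hs : is_derive (P (x + 0 *: w) ^+ 2 + Q (x + 0 *: w) ^+ 2) (1 : R) Num.sqrt
    (2 * Num.sqrt (P x ^+ 2 + Q x ^+ 2))^-1.
  by rewrite x0; exact: is_derive1_sqrt.
have := @is_derive1_comp _ _ (fun t => P (x + t *: w) ^+ 2 + Q (x + t *: w) ^+ 2) 0 _ _ hs hS.
move=> h; apply: is_derive_eq.
by rewrite /GRing.scale/=; field; rewrite gt_eqF// sqrtr_gt0.
Qed.

Lemma is_derive_div x w P Q (dP dQ : R) : Q x != 0 ->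
  is_derive x w P dP -> is_derive x w Q dQ ->
  is_derive x w (fun y => P y / Q y) (dP / Q x - P x * dQ / Q x ^+ 2).
Proof.
move=> Q0 hP hQ; apply: is_derive_of_line.
have x0 : x + 0 *: w = x by rewrite scale0r addr0.
have hP' : is_derive (0 : R) (1 : R) (fun t => P (x + t *: w)) dP.
  by apply: is_derive_line; rewrite x0.
have hQ' : is_derive (0 : R) (1 : R) (fun t => Q (x + t *: w)) dQ.
  by apply: is_derive_line; rewrite x0.
have hV := @is_deriveV _ (fun t => Q (x + t *: w)) 0 _ _ (_ : Q (x + 0 *: w) != 0) hQ'.
rewrite x0 in hV; have {}hV := hV Q0.
apply: is_derive_eq; rewrite /GRing.scale/= x0.
by field.
Qed.

(** The nine second derivatives are independent variables. The first derivative [t], produced by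
    differentiating the coefficients of X1 and X2, cancels in the mixed term. *)
Lemma hor_mean_curv_identity (a b c s t u00 u01 u02 u10 u11 u12 u20 u21 u22 : R) :
  s ^+ 2 * (1 * u00 + 0 * u01 + 2 * b * u02 + 2 * (0 * t + b * (1 * u20 + 0 * u21 + 2 * b * u22)))
  - c * s * (1 * u10 + 0 * u11 + 2 * b * u12 - 2 * (1 * t + a * (1 * u20 + 0 * u21 + 2 * b * u22))
    + (0 * u00 + 1 * u01 + - (2 * a) * u02 + 2 * (1 * t + b * (0 * u20 + 1 * u21 + - (2 * a) * u22))))
  + c ^+ 2 * (0 * u10 + 1 * u11 + - (2 * a) * u12 - 2 * (0 * t + a * (0 * u20 + 1 * u21 + - (2 * a) * u22)))
  = - s * (- s * u00 + c * u01 + - (2 * (s * b + c * a)) * u02)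
  + c * (- s * u10 + c * u11 + - (2 * (s * b + c * a)) * u12)
  + - (2 * (s * b + c * a)) * (- s * u20 + c * u21 + - (2 * (s * b + c * a)) * u22).
Proof. ring. Qed.

Variables (u : V -> R) (x : V) (k a b : R).
Hypothesis k0 : 0 < k.
Hypothesis bu : bdiff 4 (cball x k) u.
Hypothesis xa : x 0 0 = a.
Hypothesis xb : x 0 1 = b.

Lemma along_X1 y : along (X1 y) u y = partial 0 u y + 2 * y 0 1 * partial 2 u y.
Proof. by rewrite /along /X1; have [-> -> ->] := row3E (1 : R) 0 (2 * y 0 1); rewrite mul1r mul0r addr0. Qed.

Lemma along_X2 y : along (X2 y) u y = partial 1 u y - 2 * y 0 0 * partial 2 u y.
Proof. by rewrite /along /X2; have [-> -> ->] := row3E (0 : R) 1 (- (2 * y 0 0)); rewrite mul1r mul0r add0r mulNr. Qed.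

Lemma along_X3 y : along (X3 y) u y = partial 2 u y.
Proof. by rewrite /along /X3; have [-> -> ->] := row3E (0 : R) 0 1; rewrite mul1r !mul0r !add0r. Qed.

Lemma vf_deriveE (X : V -> V) y : cball x k y -> vf_derive X u y = along (X y) u y.
Proof. by move=> Ky; apply: derive_along; exact: bu.2.1. Qed.

Lemma near_cball : \forall y \near x, cball x k y.
Proof.
apply/nbhs_ballP; exists k => //= y; rewrite -ball_normE/= distrC => /ltW.
by [].
Qed.

Let p y := partial 0 u y + 2 * y 0 1 * partial 2 u y.
Let q y := partial 1 u y - 2 * y 0 0 * partial 2 u y.
Let n y := Num.sqrt (p y ^+ 2 + q y ^+ 2).

Let vf1 y : cball x k y -> vf_derive (@X1 R) u y = p y.
Proof. by move=> /vf_deriveE ->; exact: along_X1. Qed.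

Let vf2 y : cball x k y -> vf_derive (@X2 R) u y = q y.
Proof. by move=> /vf_deriveE ->; exact: along_X2. Qed.

Let hgn y : cball x k y -> hgrad_norm u y = n y.
Proof. by move=> Ky; rewrite /hgrad_norm vf1// vf2. Qed.

Let xK : cball x k x. Proof. by apply: cball_center; exact: ltW. Qed.

Let is_derive_partial w i : is_derive x w (partial i u) (along w (partial i u) x).
Proof. by apply: is_derive_along; apply: (bdiffS bu i).2.1. Qed.

Let t := partial 2 u x.

Let dp w := along w (partial 0 u) x + 2 * (w 0 1 * t + b * along w (partial 2 u) x).
Let dq w := along w (partial 1 u) x - 2 * (w 0 0 * t + a * along w (partial 2 u) x).

Let is_derive_p w : is_derive x w p (dp w).
Proof.
have h0 := is_derive_partial w 0; have h2 := is_derive_partial w 2.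
have hc := is_derive_coord x w 1.
rewrite /p; apply: is_derive_eq; rewrite /GRing.scale/= xb /dp /t.
move: (along w (partial 0 u) x) (along w (partial 2 u) x) (partial 2 u x) (w 0 1) => A1 A2 A3 A4.
ring.
Qed.

Let is_derive_q w : is_derive x w q (dq w).
Proof.
have h0 := is_derive_partial w 1; have h2 := is_derive_partial w 2.
have hc := is_derive_coord x w 0.
rewrite /q; apply: is_derive_eq; rewrite /GRing.scale/= xa /dq /t.
move: (along w (partial 1 u) x) (along w (partial 2 u) x) (partial 2 u x) (w 0 0) => A1 A2 A3 A4.
ring.
Qed.

Hypothesis n0 : 0 < n x.

Let N0 : 0 < p x ^+ 2 + q x ^+ 2.
Proof. by rewrite -sqrtr_gt0. Qed.

Let is_derive_n w : is_derive x w n ((p x * dp w + q x * dq w) / n x).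
Proof. exact: is_derive_norm2. Qed.

Let co := p x / n x.
Let si := q x / n x.

Lemma rot_unit : co ^+ 2 + si ^+ 2 = 1.
Proof.
rewrite /co /si !exprMn -mulrDl exprVn sqr_sqrtr ?(ltW N0)//.
by rewrite divff// gt_eqF.
Qed.

(** Explicit formulas hold only on the ball, which suffices for a derivative at its centre. *)
Let vfE (X : V -> V) f g d : (forall y, cball x k y -> f y = g y) ->
  is_derive x (X x) g d -> vf_derive X f x = d.
Proof.
move=> fg hd; rewrite /vf_derive (@near_eq_derive _ _ _ _ g); first by case: hd.
by near do apply: fg; exact: near_cball.
Unshelve. all: by end_near. Qed.

Let f2 := frame2 a b co si.

(** Differentiating the unit horizontal normal (co, si) removes the part along the normal. What
    remains is the quadratic form with entries si^2, - co si, co^2, the second derivative of [u]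
    along e_1 frozen at [x]. *)
Lemma hor_mean_curvE : hor_mean_curv u x = along2 f2 f2 u x / n x.
Proof.
have nx : n x != 0 by rewrite gt_eqF.
rewrite /hor_mean_curv.
have d1 := is_derive_div nx (is_derive_p (X1 x)) (is_derive_n (X1 x)).
have d2 := is_derive_div nx (is_derive_q (X2 x)) (is_derive_n (X2 x)).
rewrite (vfE _ d1) => [|y Ky]; last by rewrite vf1// hgn.
rewrite (vfE _ d2) => [|y Ky]; last by rewrite vf2// hgn.
have -> : p x = co * n x by rewrite /co divfK.
have -> : q x = si * n x by rewrite /si divfK.
have si2 : si ^+ 2 = 1 - co ^+ 2 by have := rot_unit; lra.
have aux (dp1 dp2 dq1 dq2 N : R) : N != 0 ->
  dp1 / N - co * N * ((co * N * dp1 + si * N * dq1) / N) / N ^+ 2 +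
  (dq2 / N - si * N * ((co * N * dp2 + si * N * dq2) / N) / N ^+ 2) =
  (si ^+ 2 * dp1 - co * si * (dq1 + dp2) + co ^+ 2 * dq2) / N.
  move=> N_0; rewrite (_ : co ^+ 2 = 1 - si ^+ 2); last by rewrite si2; ring.
  have E : co ^+ 2 = 1 - si ^+ 2 by rewrite si2; ring.
  rewrite [LHS](_ : _ = ((1 - co ^+ 2) * dp1 - co * si * (dq1 + dp2) + (1 - si ^+ 2) * dq2) / N); last by field.
  by rewrite E; field.
rewrite aux//; congr (_ / _).
rewrite /dp /dq /along2 /along -/t.
rewrite /X1 /X2 xa xb; have [-> -> ->] := row3E (1 : R) 0 (2 * b).
have [-> -> ->] := row3E (0 : R) 1 (- (2 * a)).
rewrite /f2; have [-> -> ->] := row3E (- si) co (- (2 * (si * b + co * a))).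
exact: hor_mean_curv_identity.
Qed.

Lemma imag_curvE : imag_curv u x = 4 * t / n x.
Proof. by rewrite /imag_curv (hgn xK) (vf_deriveE _ xK) along_X3. Qed.

(** Quotient rule. The term [2 * t] is the derivative along e_1 of the coefficients of X1 and X2,
    simplified by co^2 + si^2 = 1. *)
Lemma char_imag_curvE : vf_derive (char_field u) (imag_curv u) x =
  4 * (along f2 (partial 2 u) x / n x - t * (along2 (frame1 a b co si) f2 u x + 2 * t) / n x ^+ 2).
Proof.
have nx : n x != 0 by rewrite gt_eqF.
have cE : char_field u x = f2.
  rewrite /char_field (hgn xK) (vf1 xK) (vf2 xK) /X1 /X2 xa xb.
  have E (N A B : R) (v w : V) i :
      (N *: (A *: v - B *: w)) 0 i = N * (A * v 0 i - B * w 0 i) by rewrite !mxE.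
  have [g0 g1 g2] := row3E (1 : R) 0 (2 * b).
  have [h0 h1 h2] := row3E (0 : R) 1 (- (2 * a)).
  have [f0 f1 f3] := row3E (- si) co (- (2 * (si * b + co * a))).
  apply: eq_row3; rewrite E ?g0 ?g1 ?g2 ?h0 ?h1 ?h2 /f2 /frame2 ?f0 ?f1 ?f3 /co /si.
  - by field.
  - by field.
  - by field.
have hi : is_derive x f2 (fun y => 4 * partial 2 u y) (4 * along f2 (partial 2 u) x).
  have h2 := is_derive_partial f2 2.
  by apply: is_derive_eq; rewrite /GRing.scale/=; ring.
have := is_derive_div nx hi (is_derive_n f2); rewrite -cE => hd.
rewrite (vfE _ hd); last first.
  by move=> y Ky; rewrite /imag_curv (hgn Ky) (vf_deriveE _ Ky) along_X3.
rewrite cE -/t.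
have -> : p x = co * n x by rewrite /co divfK.
have -> : q x = si * n x by rewrite /si divfK.
have aux (A N dp' dq' : R) : N != 0 -> 4 * A / N - 4 * t * ((co * N * dp' + si * N * dq') / N) / N ^+ 2 =
  4 * (A / N - t * (co * dp' + si * dq') / N ^+ 2) by move=> N_0; field.
rewrite aux//; congr (4 * (_ - t * _ / _)).
rewrite /dp /dq /along2.
rewrite [X in 2 * (X * t + b * _)](_ : _ = co); last by have [] := row3E (- si) co (- (2 * (si * b + co * a))).
rewrite [X in 2 * (X * t + a * _)](_ : _ = - si); last by have [] := row3E (- si) co (- (2 * (si * b + co * a))).
rewrite {1 2 3}/frame1; have [-> -> ->] := row3E co si (2 * (co * b - si * a)).
have aux2 (A0 A1 A2 : R) : co * (A0 + 2 * (co * t + b * A2)) + si * (A1 - 2 * (- si * t + a * A2)) =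
    co * A0 + si * A1 + 2 * (co * b - si * a) * A2 + 2 * t.
  rewrite [RHS](_ : _ = co * A0 + si * A1 + 2 * (co * b - si * a) * A2 + 2 * t * (co ^+ 2 + si ^+ 2)); last first.
    by rewrite rot_unit; ring.
  by move: co si => c s; ring.
exact: aux2.
Qed.

End curvature.

(** * Characteristic points *)

Section characteristic_point.
Context {R : realType}.
Local Notation V := 'rV[R]_3.
Variables (S U : set V) (u : V -> R) (x : V).
Hypothesis lev : level_set_on S U u.
Hypothesis smu : smooth_on U u.
Hypothesis Sx : S x.
Hypothesis Ux : U x.

Let m := partial 2 u x.
Hypothesis p0 : partial 0 u x + 2 * x 0 1 * m = 0.
Hypothesis q0 : partial 1 u x - 2 * x 0 0 * m = 0.

Let m_neq0 : m != 0.
Proof.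
have [_ gr _] := lev; apply/eqP => m0; apply: (gr x Ux).
move: p0 q0; rewrite m0 !mulr0 addr0 subr0 => p0' q0'.
by apply/rowP => i; rewrite !mxE; move: i; apply: ord3P.
Qed.

Let along0 (v : V) : along v u x = m * (v 0 2 - 2 * x 0 1 * v 0 0 + 2 * x 0 0 * v 0 1).
Proof.
have -> : along v u x = v 0 0 * partial 0 u x + v 0 1 * partial 1 u x + v 0 2 * m by [].
have -> : partial 0 u x = - (2 * x 0 1 * m) by apply/eqP; rewrite -addr_eq0 p0.
have -> : partial 1 u x = 2 * x 0 0 * m by apply/eqP; rewrite -subr_eq0 q0.
move: (x 0 0) (x 0 1) (v 0 0) (v 0 1) (v 0 2) => x0 x1 v0 v1 v2.
by ring.
Qed.

Lemma horizontalP (v : V) : horizontal_space x v <->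
  v 0 2 - 2 * x 0 1 * v 0 0 + 2 * x 0 0 * v 0 1 = 0.
Proof.
have E (A B : R) (w z : V) i : (A *: w + B *: z) 0 i = A * w 0 i + B * z 0 i by rewrite !mxE.
have [g0 g1 g2] := row3E (1 : R) 0 (2 * x 0 1).
have [h0 h1 h2] := row3E (0 : R) 1 (- (2 * x 0 0)).
split => [[A [B ->]]|H].
  by rewrite !E /X1 /X2 g0 g1 g2 h0 h1 h2; ring.
exists (v 0 0), (v 0 1).
apply: eq_row3; rewrite E /X1 /X2 ?g0 ?g1 ?g2 ?h0 ?h1 ?h2; [by ring|by ring|].
move: (v 0 2) (v 0 0) (v 0 1) (x 0 1) (x 0 0) H => v2 v0 v1 x1 x0 H.
by apply/eqP; rewrite -subr_eq0; apply/eqP; rewrite -H; ring.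
Qed.

Let du y : U y -> differentiable u y.
Proof. by have [h _] := smu 1; exact: h. Qed.

Lemma tangent_horizontal : tangent_space S x `<=` horizontal_space x.
Proof.
move=> v [gam [g0 gS dg]]; apply/horizontalP.
have [oU _ SU] := lev.
have dfg : differentiable gam 0 by apply/derivable1_diffP; case: dg.
have dug : differentiable u (gam 0) by rewrite g0; exact: du.
have E : 'D_1 (u \o gam) 0 = along v u x.
  rewrite deriveE; last exact: differentiable_comp.
  have dgam : 'd gam 0 (1 : R) = v by rewrite -deriveE//; case: dg.
  by rewrite diff_comp//= dgam -deriveE// g0 derive_along//; exact: du.
have : 'D_1 (u \o gam) 0 = 0.
  rewrite (@near_eq_derive _ _ _ _ (cst 0)); first by rewrite derive_cst.
  have cg : gam t @[t --> (0 : R)] --> gam 0 by exact: differentiable_continuous.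
  have nU : \forall t \near (0 : R), U (gam t).
    by apply: cg; rewrite g0; exact: open_nbhs_nbhs.
  near=> t => /=.
  have : ([set y | u y = 0] `&` U) (gam t) by rewrite -SU; split; near: t.
  by case.
rewrite E along0 => /eqP; rewrite mulf_eq0 (negbTE m_neq0)/= => /eqP.
by [].
Unshelve. all: by end_near. Qed.

(** Tangent vectors are velocities of curves in [S], so a curve has to be produced. The line x + t v
    is corrected vertically by xi(t), found by the intermediate value theorem since [u] has vertical
    slope [m]. As xi(t) is O(t^2), the velocity at 0 is still v, however irregular xi may be. *)
Lemma horizontal_tangent : horizontal_space x `<=` tangent_space S x.
Proof.
move=> v /horizontalP hv.
have av : along v u x = 0 by rewrite along0 hv mulr0.
have [oU _ SU] := lev.
have ux : u x = 0.
  by have [] : ([set y | u y = 0] `&` U) x by rewrite -SU.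
have [k k0 [kU bu]] := Ck_bdiff oU Ux (smu 2).
have [M M0 HM] := bdiff_taylor2 bu.
pose e3 : V := row3 0 0 1; have [e30 e31 e32] := row3E (0 : R) 0 1.
have [N NE] : exists N, N = norm1 v by exists (norm1 v).
(* Makes the vertical gain [L * t ^+ 2 * |m|] exceed the Taylor error by t^2, so [u] has opposite
   signs at the two ends. *)
pose L := (M * (N + 1) ^+ 2 + 1) / `|m|.
have m0 : 0 < `|m| by rewrite normr_gt0.
have MN0 : 0 <= M * (N + 1) ^+ 2 by rewrite mulr_ge0 ?sqr_ge0.
have L0 : 0 < L by rewrite divr_gt0// ltr_wpDl.
have N0 : 0 <= N by rewrite NE norm1_ge0.
pose e := Num.min 1 (Num.min L^-1 (k / (N + 1))).
have N1 : 0 < N + 1 by lra.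
have e0 : 0 < e by rewrite !lt_min ltr01 invr_gt0 L0 divr_gt0.
have eL : e * L <= 1.
  by rewrite -ler_pdivlMr// mul1r !ge_min lexx orbT.
have ek : e * (N + 1) <= k by rewrite -ler_pdivlMr// !ge_min lexx !orbT.
pose pt (t s : R) : V := (x + t *: v) + s *: e3.
have ptE t s : pt t s - x = t *: v + s *: e3.
  by rewrite /pt -(addrA x) (addrC x) addrK.
have N1pt t s : norm1 (pt t s - x) <= `|t| * N + `|s|.
  rewrite ptE /norm1; have E i : (t *: v + s *: e3) 0 i = t * v 0 i + s * e3 0 i by rewrite !mxE.
  rewrite !E /e3 e30 e31 e32 !mulr0 !addr0 mulr1 !normrM NE /norm1 !mulrDr -addrA -!addrA.
  do 2 rewrite lerD2l.
  by rewrite (le_trans (ler_normD _ _))// normrM.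
have sb (t s : R) : `|t| <= e -> `|s| <= L * t ^+ 2 -> `|s| <= `|t|.
  move=> te st; apply: (le_trans st).
  rewrite -(real_normK (num_real t)) expr2 mulrA ler_piMl//.
  by rewrite mulrC (le_trans _ eL)// ler_wpM2r// ltW.
have ptK t s : `|t| <= e -> `|s| <= L * t ^+ 2 -> cball x k (pt t s).
  move=> te st; rewrite /cball /= (le_trans (norm_le_norm1 _))//.
  apply: (le_trans (N1pt t s)); have := sb t s te st => ss.
  apply: (@le_trans _ _ (`|t| * (N + 1))); first by rewrite mulrDr mulr1 lerD2l.
  by apply: (le_trans _ ek); rewrite ler_wpM2r// ltW.
have xK : cball x k x by apply: cball_center; exact: ltW.
have est t s : `|t| <= e -> `|s| <= L * t ^+ 2 ->
    `|u (pt t s) - s * m| <= M * (N + 1) ^+ 2 * t ^+ 2.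
  move=> te st; have := HM x (pt t s) xK (ptK _ _ te st).
  have -> : along (pt t s - x) u x = s * m.
    have E i : (t *: v + s *: e3) 0 i = t * v 0 i + s * e3 0 i by rewrite !mxE.
    rewrite ptE along0 !E /e3 e30 e31 e32.
    transitivity (m * (t * (v 0 2 - 2 * x 0 1 * v 0 0 + 2 * x 0 0 * v 0 1) + s)).
      move: (v 0 2) (v 0 0) (v 0 1) (x 0 1) (x 0 0) => v2 v0 v1 x1 x0.
      by ring.
    by rewrite hv mulr0 add0r mulrC.
  rewrite ux subr0 => /le_trans; apply.
  rewrite -mulrA ler_wpM2l// -(real_normK (num_real t)) -exprMn lerXn2r ?nnegrE ?norm1_ge0//.
    by rewrite mulr_ge0// ltW.
  apply: (le_trans (N1pt t s)); have := sb t s te st; lra.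
have sol t : exists s, `|t| <= e -> `|s| <= L * t ^+ 2 /\ u (pt t s) = 0.
  have [te|_] := leP `|t| e; last by exists 0.
  have r0 : 0 <= L * t ^+ 2 by rewrite mulr_ge0 ?sqr_ge0// ltW.
  have le : - (L * t ^+ 2) <= L * t ^+ 2 by lra.
  have inb s : s \in `[- (L * t ^+ 2), L * t ^+ 2] -> `|s| <= L * t ^+ 2.
    by rewrite in_itv/= ler_norml.
  have cont : {within `[- (L * t ^+ 2), L * t ^+ 2], continuous (fun s => u (pt t s))}.
    apply: derivable_within_continuous => s /inb hs.
    have h := @is_derive_path _ x k u (x + t *: v) e3 s (bdiffW bu) (ptK _ _ te hs).
    by case: h.
  have est1 := est t (L * t ^+ 2) te; have est2 := est t (- (L * t ^+ 2)) te.
  rewrite normrN ger0_norm// in est2; rewrite ger0_norm// in est1.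
  move: (est1 (lexx _)) (est2 (lexx _)); rewrite !ler_norml => /andP[a1 a2] /andP[a3 a4].
  have t0 : 0 <= t ^+ 2 := sqr_ge0 t.
  have mL : L * t ^+ 2 * `|m| = M * (N + 1) ^+ 2 * t ^+ 2 + t ^+ 2.
    by rewrite /L mulrAC divfK ?gt_eqF// mulrDl mul1r.
  have [s /inb hs us] : exists2 s, s \in `[- (L * t ^+ 2), L * t ^+ 2] & u (pt t s) = 0.
    apply: (IVT le cont); rewrite ge_min le_max.
    have [mp|mn] := leP 0 m.
      rewrite ger0_norm// in mL.
      by apply/andP; split; apply/orP; [left|right]; lra.
    rewrite ltr0_norm// in mL.
    by apply/andP; split; apply/orP; [right|left]; lra.
  by exists s => _.
have [xi xiP] := choice sol.
have z0 : `|0 : R| <= e by rewrite normr0 ltW.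
exists (fun t => pt t (xi t)); split.
- have [h _] := xiP 0 z0.
  move: h; rewrite expr0n mulr0 normr_le0 => /eqP ->.
  by rewrite /pt !scale0r !addr0.
- near=> t; have te : `|t| <= e by near: t; apply/nbhs_ballP; exists e => //= y; rewrite /ball/= sub0r normrN => /ltW.
  have [h ut] := xiP t te.
  have : ([set y | u y = 0] `&` U) (pt t (xi t)) by split => //; apply: kU; exact: ptK.
  by rewrite -SU => -[].
- apply: (is_derive_quadratic (C := L * `|e3|) (e := e) e0) => h he.
  have [h0 _] := xiP 0 z0.
  move: h0; rewrite expr0n mulr0 normr_le0 => /eqP ->.
  rewrite addr0 /pt !scale0r !addr0.
  rewrite (_ : _ - _ = xi h *: e3); last by apply/rowP => i; rewrite !mxE; ring.
  have [hx _] := xiP h he.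
  by rewrite normrZ mulrAC ler_wpM2r.
Unshelve. all: by end_near. Qed.

(** Used by contraposition: at a noncharacteristic point the horizontal gradient cannot vanish. *)
Lemma tangent_eq_horizontal : tangent_space S x = horizontal_space x.
Proof. by apply/seteqP; split; [exact: tangent_horizontal|exact: horizontal_tangent]. Qed.

End characteristic_point.

(** * The measure in the chart *)

Section pushforward_chart.
Context {R : realType}.
Local Notation V := 'rV[R]_3.

Lemma measurable_coord i : measurable_fun setT ((fun y : V => y 0 i) : borel_heis R -> R).
Proof.
apply: (measurability _ (RGenOInfty.measurableE R)) => //.
move=> _ [_ [t ->] <-]; rewrite setTI; apply: sub_sigma_algebra => /=.
apply: open_comp => [y _|]; first exact: coord_continuous.
by rewrite set_itvE; exact: open_gt.
Qed.

(** Carries the measure from the Borel sets of row vectors to the product sigma-algebra of triples,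
    where Tonelli is applied. *)
Lemma measurable_unchart (c1 c2 c3 co si : R) :
  measurable_fun setT (unchart c1 c2 c3 co si : borel_heis R -> (R * R * R)%type).
Proof.
have m0 := measurable_coord 0; have m1 := measurable_coord 1; have m2 := measurable_coord 2.
rewrite /unchart /=.
have mA (i : 'I_3) (a b : R) : measurable_fun setT ((fun y : V => a * (y 0 i - b)) : borel_heis R -> R).
  by apply: measurable_funM => //; apply: measurable_funB => //; exact: measurable_coord.
have mf : measurable_fun setT ((fun y : V => co * (y 0 0 - c1) + si * (y 0 1 - c2)) : borel_heis R -> R).
  by apply: measurable_funD; exact: mA.
have me : measurable_fun setT ((fun y : V => co * (y 0 1 - c2) - si * (y 0 0 - c1)) : borel_heis R -> R).
  by apply: measurable_funB; exact: mA.
apply: measurable_fun_pair; first by apply: measurable_fun_pair.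
apply: measurable_funB.
  apply: measurable_funB; last by apply: measurable_funM => //.
  apply: measurable_funB; last by apply: measurable_funM => //.
  by apply: measurable_funB => //.
by apply: measurable_funM => //; apply: measurable_funM => //.
Qed.

Section uniform.
Variables (mu : {measure set (borel_heis R) -> \bar R}) (c1 c2 c3 co si c : R).
Hypothesis cs : co ^+ 2 + si ^+ 2 = 1.
Local Notation chart := (chart c1 c2 c3 co si).
Local Notation unchart := (unchart c1 c2 c3 co si).
Hypothesis c0 : 0 < c.
Hypothesis munif : forall (x : V) (r : R), spt mu x -> 0 < r -> mu (hball x r) = (c * r ^+ 3)%:E.

Definition chart_measure := image_measure mu (measurable_unchart c1 c2 c3 co si).

Lemma chart_measure_kball z r : 0 < r -> chart_measure (kball z r) = mu (hball (chart z) r).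
Proof.
move=> r0; rewrite /chart_measure image_measureE; congr (mu _).
have E y : hdist (chart z) y ^+ 4 = korK z (unchart y).
  by rewrite -(hdist_chart c1 c2 c3 cs) unchartK.
by apply/seteqP; split => y; rewrite /kball /hball /= -E ler_pXn2r// nnegrE ?sqrtr_ge0 ?(ltW r0).
Qed.

Lemma ksupp_chart z : spt mu (chart z) -> ksupp chart_measure z.
Proof. by move=> sz r r0; rewrite chart_measure_kball//; exact: sz. Qed.

Lemma kuniform_chart : kuniform chart_measure c.
Proof.
move=> z r sz r0; rewrite chart_measure_kball//; apply: munif => //.
by move=> e e0; rewrite -chart_measure_kball//; exact: sz.
Qed.

(** The balls about one point of the support exhaust the space and have finite mass by
    uniformity. *)
Lemma sigma_finite_chart z : spt mu (chart z) -> sigma_finite setT chart_measure.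
Proof.
move=> sz; exists (fun n => kball z n.+1%:R).
  apply/seteqP; split => // y _; exists (Num.truncn (korK z y)) => //.
  rewrite /kball /=.
  have h : korK z y <= (Num.truncn (korK z y)).+1%:R by rewrite ltW// truncnS_gt.
  apply: (le_trans h); rewrite -natrX ler_nat.
  by rewrite -{1}(expn1 (Num.truncn _).+1) leq_pexp2l.
move=> n; split; first exact: measurable_kball.
by rewrite chart_measure_kball// munif// ltry.
Qed.

End uniform.
End pushforward_chart.

Theorem corollary5p2 (R : realType)
    (mu : {measure set (borel_heis R) -> \bar R}) (Sigma : set 'rV[R]_3)
    (mu_unif : three_uniform mu)
    (Sigma_surf : analytic_surface Sigma)
    (Sigma_spt : Sigma `<=` spt mu)
    (U : set 'rV[R]_3) (u : 'rV[R]_3 -> R)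
    (u_smooth : smooth_on U u)
    (u_level : level_set_on Sigma U u)
    (x : 'rV[R]_3) (Sigma_x : Sigma x) (U_x : U x)
    (x_nonchar : noncharacteristic Sigma x) :
  hor_mean_curv u x ^+ 2 + 3 / 2 * imag_curv u x ^+ 2
    + 4 * vf_derive (char_field u) (imag_curv u) x = 0.
Proof.
have [oU gr SU] := u_level.
have [_ [cc cc0 munif]] := mu_unif.
have [k k0 [kU bu]] := Ck_bdiff oU U_x (u_smooth 4).
pose a := x 0 0; pose b := x 0 1; pose t := partial 2 u x.
pose p := partial 0 u x + 2 * b * t; pose q := partial 1 u x - 2 * a * t.
pose n := Num.sqrt (p ^+ 2 + q ^+ 2).
have n0 : 0 < n.
  rewrite lt0r sqrtr_ge0 andbT; apply/eqP => nE; apply: x_nonchar.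
  have : p ^+ 2 + q ^+ 2 == 0.
    by rewrite eq_le addr_ge0 ?sqr_ge0// andbT -sqrtr_eq0 -/n nE.
  rewrite paddr_eq0 ?sqr_ge0// !sqrf_eq0 => /andP[/eqP p0 /eqP q0].
  exact: (tangent_eq_horizontal u_level u_smooth Sigma_x U_x p0 q0).
have nx : n != 0 by rewrite gt_eqF.
have cs : (p / n) ^+ 2 + (q / n) ^+ 2 = 1 by exact: rot_unit n0.
pose co := p / n; pose si := q / n; rewrite -/co -/si in cs.
have -> : hor_mean_curv u x = along2 (frame2 a b co si) (frame2 a b co si) u x / n.
  exact: hor_mean_curvE k0 bu erefl erefl n0.
have -> : imag_curv u x = 4 * t / n by exact: imag_curvE k0 bu.
have -> : vf_derive (char_field u) (imag_curv u) x =
    4 * (along (frame2 a b co si) (partial 2 u) x / n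
         - t * (along2 (frame1 a b co si) (frame2 a b co si) u x + 2 * t) / n ^+ 2).
  exact: char_imag_curvE k0 bu erefl erefl n0.
have pE : p = co * n by rewrite /co divfK.
have qE : q = si * n by rewrite /si divfK.
have xE : row3 a b (x 0 2) = x by have [h0 h1 h2] := row3E a b (x 0 2); apply: eq_row3.
have u0 : u x = 0 by have [] : ([set y | u y = 0] `&` U) x by rewrite -SU.
have pU : partial 0 u x = p - 2 * b * t by rewrite /p addrK.
have qU : partial 1 u x = q + 2 * a * t by rewrite /q subrK.
have u1 : along (frame1 a b co si) u x = n.
  rewrite /along /frame1; have [-> -> ->] := row3E co si (2 * (co * b - si * a)).
  rewrite pU qU -/t pE qE.
  transitivity ((co ^+ 2 + si ^+ 2) * n); last by rewrite cs mul1r.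
  by ring.
have u2 : along (frame2 a b co si) u x = 0.
  rewrite /along /frame2; have [-> -> ->] := row3E (- si) co (- (2 * (si * b + co * a))).
  by rewrite pU qU -/t pE qE; ring.
have bu' : bdiff 4 (cball (row3 a b (x 0 2)) k) u by rewrite xE.
have u0' : u (row3 a b (x 0 2)) = 0 by rewrite xE.
have u2' : along (frame2 a b co si) u (row3 a b (x 0 2)) = 0 by rewrite xE.
have u1' : 0 < along (frame1 a b co si) u (row3 a b (x 0 2)) by rewrite xE u1.
have [C ld] := chart_level_data cs k0 bu' u0' u2' u1'.
rewrite xE u1 -/t in ld.
have [phi [A [del [M [gd gz]]]]] := level_graph ld.
have gS z : box del z -> Sigma (chart a b (x 0 2) co si (graph_pt phi z)).
  move=> /gz[cz uz]; have yK := chart_cball (x 0 2) cs k0 cz.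
  have : ([set y | u y = 0] `&` U) (chart a b (x 0 2) co si (graph_pt phi z)).
    by split => //; apply: kU; rewrite -[X in cball X]xE; exact: yK.
  by rewrite -SU => -[].
have b00 : box del (0, 0) by apply/boxP; rewrite /= normr0 ltW// (gd_del gd).
pose nu := chart_measure mu a b (x 0 2) co si.
have nu_sf : sigma_finite setT nu.
  by apply: (sigma_finite_chart cs munif (z := graph_pt phi (0, 0))); apply: Sigma_spt; exact: gS.
(* Tonelli asks for a sigma-finite measure as a structure, assembled here from [nu_sf]. *)
pose nuM := Measure_isSigmaFinite.Build _ _ _ nu nu_sf.
pose nu' := HB.pack_for {sigma_finite_measure set (R * R * R)%type -> \bar R} (Measure.sort nu) nuM.
have unif' : kuniform nu' cc by exact: (kuniform_chart cs munif).
have supp' z : box del z -> ksupp nu' (graph_pt phi z).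
  by move=> /gS/Sigma_spt; exact: (ksupp_chart cs).
have := @graph_second_variation R phi A del M _ _ _ _ gd nu' cc cc0 unif' supp'.
set X := along2 _ _ u x; set Y := along _ _ x; set W := along2 _ _ u x.
move=> key.
(* The graph coefficients are a = - H_0 / 2, b = - P_0 / 4 and c = - e_1(P_0) / 4. *)
transitivity (8 * ((- (X / 2) / n) ^+ 2 / 2 + 3 * (- t / n) ^+ 2
   - 2 * (- (Y + (W + 2 * t) * (- t / n)) / n))); last by rewrite key mulr0.
by field.
Qed.
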